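(* Let $d,k\ge 1$ be integers and let $\alpha_1,\beta_1,\dots,\alpha_k,\beta_k\in(0,d)$ satisfy $$\alpha_1+\dots+\alpha_k>(k-1)d,\qquad \beta_1+\dots+\beta_k>(k-1)d.$$ Let $\mathcal R_1,\dots,\mathcal R_k$ be independent random subsets of $\mathbb Z^d$ with the following property: there are constants $0<c\le C<\infty$ such that for every $i\in\{1,\dots,k\}$, every finite set $B\subset\mathbb Z^d$ containing the origin and every $x\in\mathbb Z^d\setminus\{0\}$ with $|x|\ge 2\,\mathrm{diam}(B)$, $$c\,|x|^{-\beta_i}\,\mathrm{Cap}_{\alpha_i}(B)\le \mathbb P\big(\mathcal R_i\cap(x+B)\neq\emptyset\big)\le C\,|x|^{-\beta_i}\,\mathrm{Cap}_{\alpha_i}(B).$$ Then there are constants $0<c'\le C'<\infty$, depending only on $d,k,(\alpha_i),(\beta_i)$ and on the hypothesis constants $c,C$, such that for every finite set $A\subset\mathbb Z^d$ containing the origin and every $x\in\mathbb Z^d$ with $|x|$ sufficiently large (depending on $A$ and on $d,k,(\alpha_i),(\beta_i)$), $$c'\le \frac{\mathbb P\big((\mathcal R_1+\dots+\mathcal R_k)\cap(x+A)\neq\emptyset\big)}{|x|^{(k-1)d-\beta_1-\dots-\beta_k}\;\mathrm{Cap}_{\alpha_1+\dots+\alpha_k-(k-1)d}(A)}\le C'.$$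
   Context: $|\cdot|$ is the Euclidean norm and $\mathrm{diam}$ the Euclidean diameter. For a nonempty finite set $A\subset\mathbb Z^d$ and $0<\beta<d$, the discrete Newtonian capacity is $$\mathrm{Cap}_\beta(A):=\Big(\inf_\mu\sum_{x,y\in A}\mu(x)\mu(y)\,(|x-y|\vee 1)^{-\beta}\Big)^{-1},$$ the infimum being over all probability measures $\mu$ on $A$. The Minkowski sum is $A+B:=\{a+b: a\in A,\ b\in B\}$, and $x+A=\{x+a:a\in A\}$. *)

(* Defs.v *)
From HB Require Import structures.
From mathcomp Require Export all_boot all_order all_algebra finmap.
From mathcomp Require Export all_classical all_reals all_analysis.
Export Order.TTheory GRing.Theory Num.Theory.
Set Implicit Arguments.
Unset Strict Implicit.
Unset Printing Implicit Defensive.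

Local Open Scope classical_set_scope.
Local Open Scope ring_scope.

Notation lattice d := 'rV[int]_d.

(* The library norm on row vectors is the sup norm, hence this definition. *)
Definition enorm {R : realType} {d : nat} (x : lattice d) : R :=
  Num.sqrt (\sum_(j < d) (x ord0 j)%:~R ^+ 2).

Definition diam {R : realType} {d : nat} (A : {fset lattice d}) : R :=
  \big[Num.max/0]_(x <- A) \big[Num.max/0]_(y <- A) enorm (x - y).

(* Probability measures on the finite set A, given by their mass functions;
   the values of mu outside A are irrelevant. *)
Definition prob_on {R : realType} {d : nat} (A : {fset lattice d})
    (mu : lattice d -> R) : Prop :=
  (forall x, x \in A -> 0 <= mu x) /\ \sum_(x <- A) mu x = 1.

Definition energy {R : realType} {d : nat} (b : R) (A : {fset lattice d})
    (mu : lattice d -> R) : R :=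
  \sum_(x <- A) \sum_(y <- A)
    mu x * mu y * (Num.max (enorm (x - y)) 1) `^ (- b).

Definition Cap {R : realType} {d : nat} (b : R) (A : {fset lattice d}) : R :=
  (inf [set energy b A mu | mu in prob_on A])^-1.

Definition msum {d : nat} (A B : set (lattice d)) : set (lattice d) :=
  [set a + b | a in A & b in B].

Definition translate {d : nat} (x : lattice d) (A : {fset lattice d}) :
    set (lattice d) :=
  [set x + a | a in [set` A]].

(* The sigma-algebra on the subsets of Z^d is the product one: it is generated
   by the events {S : z \in S}. *)
Definition point_events (d : nat) : set (set (set (lattice d))) :=
  range (fun z => [set S : set (lattice d) | S z]).

Definition setspace (d : nat) := g_sigma_algebraType (@point_events d).

Definition mutually_independent {disp disp' : measure_display}
    {Omega : measurableType disp} {T : measurableType disp'} {R : realType}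
    (P : probability Omega R) (I : finType) (X : I -> {RV P >-> T}) : Prop :=
  forall (J : {set I}) (E : I -> set T), (forall i, measurable (E i)) ->
    (P (\bigcap_(i in [set` J]) (X i @^-1` E i)) =
     \prod_(i in J) P (X i @^-1` E i))%E.

Definition hit_prob {disp : measure_display} {Omega : measurableType disp}
    {R : realType} (P : probability Omega R) {d : nat}
    (S : Omega -> set (lattice d)) (x : lattice d) (A : {fset lattice d}) : R :=
  fine (P [set w | S w `&` translate x A !=set0]).

(* Main.v *)
Require Import Defs.
From mathcomp Require Import zify ring lra.
Import numFieldNormedType.Exports.

(** The random sets are known only through their hitting probabilities, and
    these only up to constants: nothing is said about two-point functions or
    about any Markov structure, so that neither a second moment nor a first
    hitting argument applies to them directly. What replaces both is that
    hitting estimates can be traded. The set [A - S] meets [Q] exactly when [S]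
    meets [A - Q]. Hence, to evaluate the mean of [Cap_g (A - S)] for a random
    [S], one replaces [Cap_g] by the hitting probability of an auxiliary random
    set [Q], swaps [S] and [Q], applies the hypothesis on [S] to the fixed set
    [A - Q], and is left with the mean of [Cap_a (A - Q)], in which only [Q] is
    random; and [Q] may be chosen at will. The outcome, [cap_dif_le] and
    [cap_dif_ge], is that if [S] lives in a box of side [L] and hits with
    probability of the order of [p Cap_a], then the mean of [Cap_g (A - S)] is
    of the order of [p L ^ d Cap_e A], where [e = a + g - d].

    The two directions ask for opposite virtues of [Q]. For the upper bound,
    [Q] is obtained in a dyadic box by keeping, at a proportion of the scales
    fixed by the dimension, one half at random, and both halves at the other
    scales. The second moment method bounds its hitting probabilities from
    below ([regfam_hit]); and since no point of [Q] is exceptional, the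
    equilibrium charges of [A] can be spread over [A - Q] so as to have
    potential at least one there ([cap_dif_regular]). For the lower bound, [Q]
    is fractal percolation. Its hitting probabilities are bounded from above by
    capacity, through the comparison with electrical resistance on the binary
    tree ([miss_ge_avoid]) and the comparison of tree energy with Euclidean
    energy ([energy_le_tree_energy]); its two-point function gives the mean
    energy of the spread charges, by the composition rule for powers of the
    distance ([conv_bpow], [avg_cap_dif]).

    Revealing the summands one at a time, as in the recursion [hitsum], turns
    these two estimates into bounds for the sum. From above ([hitsum_le]) every
    summand is cut into balls of the size of [A]. Balls centred at
    [y_1, ..., y_k] contribute the product of the [|y_i| ^ (- beta_i)], and the
    sum over centres adding up to [x] is an iterated convolution, of the order
    of [|x| ^ ((k - 1) d - sum_i beta_i)]. Close to the origin, where the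
    hypothesis is silent, probabilities are bounded by one; this adds a term
    which depends on [A] but decays faster in [|x|], and it is the reason why
    [x] must be large depending on [A]. From below ([hitsum_ge]) a single ball
    per summand suffices, of radius of the order of [|x|]. *)

Set Implicit Arguments.
Unset Strict Implicit.
Unset Printing Implicit Defensive.
Local Open Scope ring_scope.

(** * The sup norm on the lattice *)

Definition snorm {d : nat} (x : lattice d) : nat := \max_(j < d) `|x ord0 j|%N.

(** The distance to the origin that enters all powers below; being a natural
    number at least one, it needs no separate treatment of the origin. *)
Definition bracket {d : nat} (x : lattice d) : nat := maxn 1 (snorm x).

Section Norms.
Context {d : nat}.
Implicit Types x y z : lattice d.

Lemma snormP x (m : nat) :
  reflect (forall j, (`|x ord0 j| <= m)%N) (snorm x <= m)%N.
Proof.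
apply: (iffP (bigmax_leqP _ _ _)) => [H j|H j _]; exact: H.
Qed.

Lemma snorm0 : snorm (0 : lattice d) = 0%N.
Proof.
by apply/eqP; rewrite -leqn0; apply/snormP => j; rewrite mxE.
Qed.

Lemma snormN x : snorm (- x) = snorm x.
Proof. by apply: eq_bigr => j _; rewrite mxE abszN. Qed.

Lemma leq_coord x j : (`|x ord0 j| <= snorm x)%N.
Proof. exact: (leq_bigmax j). Qed.

Lemma snormD x y : (snorm (x + y) <= snorm x + snorm y)%N.
Proof.
apply/snormP => j; rewrite mxE; have := leq_coord x j; have := leq_coord y j.
by move: (snorm x) (snorm y) (x _ _) (y _ _) => m n a b; lia.
Qed.

Lemma snormB x y : (snorm (x - y) <= snorm x + snorm y)%N.
Proof. by rewrite -(snormN y); exact: snormD. Qed.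

Lemma rowBE x y j : (x - y) ord0 j = x ord0 j - y ord0 j.
Proof. by rewrite !mxE. Qed.

Lemma snorm_distC x y : snorm (x - y) = snorm (y - x).
Proof. by rewrite -snormN opprB. Qed.

Lemma snorm_eq0 x : (snorm x == 0)%N = (x == 0).
Proof.
apply/idP/eqP => [|->]; last by rewrite snorm0.
rewrite -leqn0 => /snormP H; apply/rowP => j; rewrite mxE.
by apply/eqP; rewrite -absz_eq0 -leqn0.
Qed.

Lemma snorm_mulrn x n : snorm (x *+ n) = (n * snorm x)%N.
Proof.
rewrite /snorm big_distrr /=; apply: eq_bigr => j _.
by rewrite mulmxnE -mulr_natl abszM natz absz_nat.
Qed.

Lemma bracket_gt0 x : (0 < bracket x)%N.
Proof. by rewrite /bracket leq_max. Qed.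

Lemma bracket0 : bracket (0 : lattice d) = 1%N.
Proof. by rewrite /bracket snorm0. Qed.

Lemma bracketN x : bracket (- x) = bracket x.
Proof. by rewrite /bracket snormN. Qed.

Lemma bracket_distC x y : bracket (x - y) = bracket (y - x).
Proof. by rewrite -bracketN opprB. Qed.

Lemma bracketD x y : (bracket (x + y) <= bracket x + bracket y)%N.
Proof. rewrite /bracket; have := snormD x y; lia. Qed.

Lemma bracketE x : x != 0 -> bracket x = snorm x.
Proof. rewrite -snorm_eq0 /bracket; lia. Qed.

Lemma bracket_leP x m : (0 < m)%N -> (bracket x <= m)%N = (snorm x <= m)%N.
Proof. rewrite /bracket; lia. Qed.

(** The sup-norm ball, listed through its coordinates shifted to be natural
    numbers, which makes its cardinality immediate. *)
Definition cube (m : nat) : {fset lattice d} :=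
  [fset x in [seq \row_j ((f j : nat)%:Z - m%:Z)
             | f : {ffun 'I_d -> 'I_(2 * m).+1}]]%fset.

Lemma cubeP m x : (x \in cube m) = (snorm x <= m)%N.
Proof.
rewrite inE; apply/mapP/snormP => [[f _ ->] j|H].
  by rewrite mxE; have := ltn_ord (f j); move: (f j : nat) => a; lia.
exists [ffun j => inord (absz (x ord0 j + m%:Z))]; first by rewrite mem_enum.
by apply/rowP => j; rewrite mxE ffunE inordK; have := H j; move: (x _ _) => a; lia.
Qed.

Lemma card_cube m : #|` cube m| = ((2 * m).+1 ^ d)%N.
Proof.
rewrite card_fseq undup_id; first by rewrite size_map -cardE card_ffun !card_ord.
rewrite map_inj_uniq ?enum_uniq // => f g /rowP fg; apply/ffunP => j.
by apply: val_inj; move: (fg j); rewrite !mxE /=; lia.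
Qed.

Lemma card_ball_le (F : {fset lattice d}) (a : lattice d) m :
  (forall x, x \in F -> (snorm (x - a) <= m)%N) -> (#|` F| <= (2 * m).+1 ^ d)%N.
Proof.
move=> H; rewrite -card_cube.
have inj : injective (fun x => x - a) by exact: addIr.
suff /fsubset_leq_card : ([fset x - a | x in F] `<=` cube m)%fset.
  by rewrite card_imfset.
by apply/fsubsetP => y /imfsetP[x /= xF ->]; rewrite cubeP H.
Qed.

End Norms.

Definition shift {d : nat} (z : lattice d) (A : {fset lattice d}) : {fset lattice d} :=
  [fset (z + x)%R | x in A]%fset.

Definition fsetdif {d : nat} (A B : {fset lattice d}) : {fset lattice d} :=
  [fset (x - y)%R | x in A, y in B]%fset.

Section Shift.
Context {d : nat}.
Implicit Types (x y z : lattice d) (A B : {fset lattice d}).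

Lemma mem_shift z A x : (x \in shift z A) = (x - z \in A).
Proof.
apply/imfsetP/idP => [[y yA ->]|xA]; first by rewrite addrC addKr.
by exists (x - z); rewrite // addrC subrK.
Qed.

Lemma fsetdifP A B x :
  reflect (exists a, exists2 b, a \in A & b \in B /\ x = a - b) (x \in fsetdif A B).
Proof.
apply: (iffP idP) => [/imfset2P[a aA [b bB ->]]|[a [b aA [bB ->]]]].
  by exists a, b.
by apply/imfset2P; exists a => //; exists b.
Qed.

Lemma mem_fsetdif A B a b : a \in A -> b \in B -> a - b \in fsetdif A B.
Proof. by move=> aA bB; apply/fsetdifP; exists a, b. Qed.

End Shift.

(** * Comparison of norms and of kernels *)

Definition kern {R : realType} {d : nat} (b : R) (z : lattice d) : R :=
  (Num.max (enorm z) 1) `^ (- b).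

(** The sup-norm counterpart of [kern], comparable to it up to constants;
    balls of the sup norm can be counted exactly. *)
Definition bpow {R : realType} {d : nat} (b : R) (z : lattice d) : R :=
  (bracket z)%:R `^ (- b).

Section Kernels.
Context {R : realType} {d : nat}.
Implicit Types (x y z : lattice d) (a b : R).

Lemma powRN_anti (s t b : R) : 0 <= b -> 0 < s -> s <= t -> t `^ (- b) <= s `^ (- b).
Proof.
move=> b0 s0 st; have t0 : 0 < t by exact: lt_le_trans st.
rewrite !powRN lef_pV2 ?posrE ?powR_gt0 //.
by apply: ge0_ler_powR; rewrite // ?nnegrE ltW.
Qed.

Lemma powR_mulN (s b : R) : 0 < s -> s `^ b * s `^ (- b) = 1.
Proof. by move=> s0; rewrite powRN divff // gt_eqF // powR_gt0. Qed.

Lemma natr_powR_gt0 n b : (0 < n)%N -> 0 < (n%:R : R) `^ b.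
Proof. by move=> n0; apply: powR_gt0; rewrite ltr0n. Qed.

Lemma normr_intr (n : int) : `|n%:~R| = `|n|%N%:R :> R.
Proof. by rewrite -intr_norm -abszE pmulrn. Qed.

Lemma enorm_ge x : (snorm x)%:R <= enorm x :> R.
Proof.
suff H j : `|x ord0 j|%N%:R <= enorm x :> R.
  rewrite /snorm; elim/big_ind : _ => [|m n mx nx|j _]; [exact: sqrtr_ge0| |exact: H].
  by rewrite /maxn; case: ifP.
rewrite -normr_intr -sqrtr_sqr ler_wsqrtr // (bigD1 j) //= lerDl sumr_ge0 //.
by move=> i _; rewrite sqr_ge0.
Qed.

Lemma enorm_le x : enorm x <= d%:R * (snorm x)%:R :> R.
Proof.
rewrite -[leRHS]ger0_norm -?sqrtr_sqr ?mulr_ge0 // ler_wsqrtr //.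
apply: (@le_trans _ _ (\sum_(j < d) (snorm x)%:R ^+ 2)).
  apply: ler_sum => j _; rewrite -real_normK ?num_real // normr_intr.
  by rewrite ler_pXn2r ?nnegrE // ler_nat leq_coord.
rewrite sumr_const card_ord exprMn -[leLHS]mulr_natl ler_wpM2r ?sqr_ge0 //.
by rewrite -natrX ler_nat; nia.
Qed.

Lemma maxe_ge x : (bracket x)%:R <= Num.max (enorm x) 1 :> R.
Proof. rewrite le_max /bracket /maxn; case: ifP => _; rewrite ?enorm_ge //= lexx orbT //. Qed.

Lemma maxe_le x : (0 < d)%N -> Num.max (enorm x) 1 <= d%:R * (bracket x)%:R :> R.
Proof.
move=> d0; rewrite ge_max; apply/andP; split.
  by apply: le_trans (enorm_le x) _; rewrite -!natrM ler_nat leq_mul2l leq_maxr orbT.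
by rewrite -natrM ler1n muln_gt0 d0 bracket_gt0.
Qed.

Lemma kern_gt0 b x : 0 < kern b x :> R.
Proof. by apply: powR_gt0; rewrite lt_max ltr01 orbT. Qed.

Lemma kern_le1 b x : 0 <= b -> kern b x <= 1 :> R.
Proof.
move=> b0; rewrite -[leRHS](powRr0 (Num.max (enorm x) 1)) ler_powR ?oppr_le0 //.
by rewrite le_max lexx orbT.
Qed.

Lemma enorm0 : enorm (0 : lattice d) = 0 :> R.
Proof. by apply/le_anti; rewrite sqrtr_ge0 andbT (le_trans (enorm_le _)) // snorm0 mulr0. Qed.

Lemma kern0 b : kern b (0 : lattice d) = 1 :> R.
Proof. by rewrite /kern enorm0 max_r // powR1. Qed.

Lemma enormN x : enorm (- x) = enorm x :> R.
Proof.
by congr Num.sqrt; apply: eq_bigr => j _; rewrite mxE rmorphN sqrrN.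
Qed.

Lemma kern_distC b x y : kern b (x - y) = kern b (y - x) :> R.
Proof. by rewrite /kern -enormN opprB. Qed.

Lemma bpow_gt0 b x : 0 < bpow b x :> R.
Proof. by apply: natr_powR_gt0; exact: bracket_gt0. Qed.

Lemma bpow_ge0 b x : 0 <= bpow b x :> R.
Proof. exact/ltW/bpow_gt0. Qed.

Lemma bpow_le1 b x : 0 <= b -> bpow b x <= 1 :> R.
Proof.
by move=> b0; rewrite -[leRHS](powRr0 (bracket x)%:R) ler_powR ?oppr_le0 // ler1n bracket_gt0.
Qed.

Lemma kern_le_bpow b x : 0 <= b -> kern b x <= bpow b x :> R.
Proof. by move=> b0; apply: powRN_anti => //; rewrite ?maxe_ge // ltr0n bracket_gt0. Qed.

Lemma bpow_le_kern b x : (0 < d)%N -> 0 <= b -> bpow b x <= d%:R `^ b * kern b x :> R.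
Proof.
move=> d0 b0; rewrite /bpow /kern.
apply: (@le_trans _ _ (d%:R `^ b * (d%:R * (bracket x)%:R) `^ (- b))).
  by rewrite powRM ?ler0n // mulrA powR_mulN ?mul1r ?ltr0n.
rewrite ler_wpM2l ?powR_ge0 // powRN_anti ?maxe_le //.
by rewrite lt_max ltr01 orbT.
Qed.

(** A kernel bound survives multiplying the distance by a constant; this is
    how the comparisons of distances below turn into comparisons of kernels. *)
Lemma bpow_scale b (c m n : nat) : 0 <= b -> (0 < n)%N -> (n <= c * m)%N ->
  (m%:R : R) `^ (- b) <= c%:R `^ b * n%:R `^ (- b).
Proof.
move=> b0 n0 nm; have cm : (0 < c * m)%N by exact: leq_trans nm.
have [c0 m0] : (0 < c)%N /\ (0 < m)%N by move: cm; rewrite muln_gt0 => /andP.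
have -> : (m%:R : R) `^ (- b) = c%:R `^ b * (c * m)%:R `^ (- b).
  by rewrite natrM powRM ?ler0n // mulrA powR_mulN ?mul1r ?ltr0n.
by rewrite ler_wpM2l ?powR_ge0 // powRN_anti ?ltr0n ?ler_nat.
Qed.

End Kernels.

Lemma up_log2_le (m : nat) : (0 < m)%N -> (2 ^ up_log 2 m <= 2 * m)%N.
Proof.
move=> m0; have [m1|m1] := leqP m 1; first by rewrite (_ : m = 1%N) //; lia.
have /andP[+ _] := up_log_bounds (isT : (1 < 2)%N) m1.
by case: (up_log 2 m) => [|k] /=; rewrite ?expnS; lia.
Qed.

(** * Lattice sums of powers of the distance *)

Section RadialSums.
Context {R : realType} {d : nat}.
Implicit Types (F : {fset lattice d}) (a x y z : lattice d) (b s : R).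

Lemma pow2X (e : R) n : ((2 ^ n)%N%:R : R) `^ e = (2 `^ e) ^+ n.
Proof. by rewrite natrX -powR_mulrn // powRAC powR_mulrn ?powR_ge0. Qed.

Lemma sum_imfset (h : lattice d -> lattice d) F (G : lattice d -> R) :
  injective h -> \sum_(y <- [fset h x | x in F]%fset) G y = \sum_(x <- F) G (h x).
Proof. by move=> inj; rewrite big_imfset // => x y _ _; exact: inj. Qed.

Lemma sum_ball_le F (P : pred (lattice d)) (f : lattice d -> R) (c : R) (m : nat) :
  0 <= c -> (forall y, P y -> (snorm y <= m)%N) -> (forall y, P y -> f y <= c) ->
  \sum_(y <- F | P y) f y <= ((2 * m).+1 ^ d)%N%:R * c.
Proof.
move=> c0 Pm fc; apply: (@le_trans _ _ (\sum_(y <- F | P y) c)).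
  by apply: ler_sum => y /fc.
rewrite big_fset_condE big_seq_fsetE /= sumr_const -[leLHS]mulr_natl.
rewrite ler_wpM2r // ler_nat -cardfE; apply: (@card_ball_le _ _ 0) => x.
by rewrite !inE subr0 => /andP[_ /Pm].
Qed.

Lemma shell_mass (b : R) n : 
  ((2 * 2 ^ n.+1).+1 ^ d)%N%:R * (2 ^ n)%N%:R `^ (- b) 
    <= 5 ^+ d * (2 `^ (d%:R - b)) ^+ n :> R.
Proof.
rewrite -pow2X.
have -> : ((2 ^ n)%N%:R : R) `^ (d%:R - b) = (2 ^ n)%N%:R ^+ d * (2 ^ n)%N%:R `^ (- b).
  rewrite powRD ?powR_mulrn ?ler0n //; apply/implyP => _.
  by rewrite pnatr_eq0 expn_eq0.
rewrite mulrA ler_wpM2r ?powR_ge0 // -exprMn [((_ ^ d)%N)%:R]natrX.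
apply: lerXn2r; rewrite ?nnegrE ?mulr_ge0 ?ler0n // -natrM ler_nat expnS.
have : (0 < 2 ^ n)%N by rewrite expn_gt0.
lia.
Qed.

Lemma bpow_le_pow2 b y n : 0 <= b -> (2 ^ n <= bracket y)%N -> bpow b y <= (2 ^ n)%N%:R `^ (- b) :> R.
Proof.
by move=> b0 H; apply: powRN_anti; rewrite // ?ler_nat // ltr0n expn_gt0.
Qed.

Lemma powR2_gt1 (e : R) : 0 < e -> 1 < 2 `^ e.
Proof.
by move=> e0; rewrite /powR pnatr_eq0 /= -[ltLHS]expR0 ltr_expR mulr_gt0 // ln_gt0 // ltr1n.
Qed.

(** Each dyadic shell contributes a fixed multiple of a geometric progression
    of ratio greater than one. *)
Lemma sum_bpow_inner_dyadic (b : R) : 0 <= b < d%:R -> exists2 C : R, 0 < C &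
  forall F n, \sum_(y <- F | (bracket y <= 2 ^ n)%N) bpow b y <= C * (2 `^ (d%:R - b)) ^+ n.
Proof.
move=> /andP[b0 bd]; set th := 2 `^ _.
have th1 : 1 < th.
  by rewrite powR2_gt1 // subr_gt0.
have th1' : 0 < th - 1 by rewrite subr_gt0.
have d3 : 0 < 3 ^+ d :> R by exact: exprn_gt0.
have d5 : 0 < 5 ^+ d / (th - 1) :> R by rewrite divr_gt0 // exprn_gt0.
exists (3 ^+ d + 5 ^+ d / (th - 1)); first exact: addr_gt0.
move=> F; elim=> [|n IH].
  rewrite expr0 mulr1; apply: (@le_trans _ _ (3 ^+ d)); last by rewrite lerDl ltW.
  apply: le_trans (@sum_ball_le F _ _ 1 1 _ _ _) _ => //.
  - by move=> y; rewrite expn0 bracket_leP.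
  - by move=> y _; apply: bpow_le1.
  by rewrite mulr1 natrX.
rewrite (bigID (fun y => (bracket y <= 2 ^ n)%N)) /=.
apply: (@le_trans _ _ ((3 ^+ d + 5 ^+ d / (th - 1)) * th ^+ n + 5 ^+ d * th ^+ n)).
  apply: lerD.
    apply: le_trans (IH); rewrite [leLHS]big_seq_cond [leRHS]big_seq_cond.
    rewrite le_eqVlt; apply/orP; left; apply/eqP; apply: eq_bigl => y.
    case: (y \in F) => //=; apply/andP/idP => [[]//|H]; split => //.
    by apply: leq_trans H _; rewrite leq_exp2l.
  apply: le_trans (shell_mass b n); apply: sum_ball_le; first exact: powR_ge0.
    by move=> y /andP[H _]; rewrite -bracket_leP ?expn_gt0.
  by move=> y /andP[_]; rewrite -ltnNge => /ltnW; exact: bpow_le_pow2.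
rewrite -mulrDl exprS mulrA ler_wpM2r ?exprn_ge0 ?powR_ge0 //.
have E : 5 ^+ d / (th - 1) * (th - 1) = 5 ^+ d by rewrite divfK ?gt_eqF.
rewrite -{2}E; set e := 5 ^+ d / _; rewrite -subr_ge0.
have -> : (3 ^+ d + e) * th - (3 ^+ d + e + e * (th - 1)) = 3 ^+ d * (th - 1) by ring.
by rewrite mulr_ge0 // ltW.
Qed.

(** Below the critical exponent the sum over a ball is of the order of its
    outermost dyadic shell. *)
Lemma sum_bpow_inner (b : R) : 0 <= b < d%:R -> exists2 C : R, 0 < C &
  forall F m, (0 < m)%N ->
    \sum_(y <- F | (bracket y <= m)%N) bpow b y <= C * m%:R `^ (d%:R - b).
Proof.
move=> bd; have [C C0 H] := sum_bpow_inner_dyadic bd.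
have db : 0 <= d%:R - b by rewrite subr_ge0 ltW; case/andP: bd.
exists (C * 2 `^ (d%:R - b)); first by rewrite mulr_gt0 // powR_gt0.
move=> F m m0; pose n := up_log 2 m.
have mn : (m <= 2 ^ n)%N by exact: up_logP.
have nm : (2 ^ n <= 2 * m)%N by exact: up_log2_le.
apply: (@le_trans _ _ (\sum_(y <- F | (bracket y <= 2 ^ n)%N) bpow b y)).
  rewrite [leRHS](bigID (fun y => (bracket y <= m)%N)) /=.
  rewrite [X in _ <= X + _](eq_bigl (fun y => (bracket y <= m)%N)); last first.
    by move=> y; apply: andb_idl => H'; exact: leq_trans H' mn.
  by rewrite lerDl sumr_ge0 // => y _; exact: bpow_ge0.
apply: le_trans (H F n) _; rewrite -mulrA ler_pM2l // -pow2X -powRM ?ler0n //.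
by apply: ge0_ler_powR => //; rewrite ?nnegrE ?mulr_ge0 ?ler0n // -natrM ler_nat.
Qed.

(** Above the critical exponent the sum outside a ball is of the order of its
    innermost dyadic shell. *)
Lemma sum_bpow_outer (s : R) : d%:R < s -> exists2 C : R, 0 < C &
  forall F m, (0 < m)%N ->
    \sum_(y <- F | (m <= bracket y)%N) bpow s y <= C * m%:R `^ (d%:R - s).
Proof.
move=> ds; set th : R := 2 `^ (d%:R - s).
have s0 : 0 <= s by apply: le_trans (ltW ds).
have th0 : 0 < th by rewrite powR_gt0.
have th1 : 0 < 1 - th.
  by rewrite subr_gt0 /th -opprB powRN invf_lt1 ?powR_gt0 // powR2_gt1 // subr_gt0.
have d5 : 0 < 5 ^+ d / (1 - th) :> R by rewrite divr_gt0 // exprn_gt0.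
have dyadic F k n : \sum_(y <- F | (2 ^ n <= bracket y < 2 ^ (n + k))%N) bpow s y
    <= 5 ^+ d / (1 - th) * th ^+ n.
  elim: k n => [|k IH] n.
    rewrite big_pred0 => [|y]; last by rewrite addn0; lia.
    by apply: mulr_ge0; [exact: ltW|apply: exprn_ge0; exact: ltW].
  rewrite (bigID (fun y => (bracket y < 2 ^ n.+1)%N)) /=.
  apply: (@le_trans _ _ (5 ^+ d * th ^+ n + 5 ^+ d / (1 - th) * th ^+ n.+1)).
    apply: lerD.
      apply: le_trans (shell_mass s n); apply: sum_ball_le; first exact: powR_ge0.
        by move=> y /andP[_ H]; rewrite -bracket_leP ?expn_gt0 // ltnW.
      by move=> y /andP[/andP[H _] _]; exact: bpow_le_pow2.
    apply: le_trans (IH n.+1); rewrite le_eqVlt; apply/orP; left; apply/eqP.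
    apply: eq_bigl => y; rewrite addSnnS -leqNgt.
    have : (2 ^ n <= 2 ^ n.+1)%N by rewrite leq_exp2l.
    lia.
  have E : 5 ^+ d / (1 - th) * (1 - th) = 5 ^+ d by rewrite divfK ?gt_eqF.
  rewrite -{1}E exprS; set e := 5 ^+ d / _; rewrite le_eqVlt; apply/orP; left.
  by apply/eqP; ring.
exists (5 ^+ d / (1 - th) * 2 `^ (s - d%:R)); first by rewrite mulr_gt0 // powR_gt0.
move=> F m m0; pose n := trunc_log 2 m.
have /andP[nm mn] := trunc_log_bounds (isT : (1 < 2)%N) m0.
pose k := (\max_(y <- F) bracket y)%N.
apply: (@le_trans _ _ (\sum_(y <- F | (2 ^ n <= bracket y < 2 ^ (n + k))%N) bpow s y)).
  rewrite [leRHS](bigID (fun y => (m <= bracket y)%N)) /=.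
  rewrite big_seq_cond [X in _ <= X + _]big_seq_cond.
  rewrite [X in _ <= X + _](eq_bigl (fun y => (y \in F) && (m <= bracket y)%N)); last first.
    move=> y; case yF : (y \in F) => //=; case my : (m <= bracket y)%N; rewrite ?andbF //.
    rewrite (leq_trans nm my) /= andbT.
    have : (bracket y <= k)%N by apply: leq_bigmax_seq.
    have : (k < 2 ^ k)%N by exact: ltn_expl.
    have : (2 ^ k <= 2 ^ (n + k))%N by rewrite leq_exp2l // leq_addl.
    lia.
  by rewrite lerDl sumr_ge0 // => y _; exact: bpow_ge0.
apply: le_trans (dyadic F k n) _; rewrite -[leRHS]mulrA ler_pM2l // -pow2X.
rewrite -opprB; apply: bpow_scale => //; first by rewrite subr_ge0 ltW.
by rewrite -expnS ltnW.
Qed.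

Lemma bpow_mul (b s : R) x : bpow b x * bpow s x = bpow (b + s) x :> R.
Proof.
rewrite /bpow opprD powRD //; apply/implyP => _.
by rewrite pnatr_eq0 -lt0n bracket_gt0.
Qed.

(** Where [y] is closer to the origin than to [a], the distance from [y] to [a]
    is at least of the order of both [|a|] and [|y|]; the first bound is used
    inside the ball of radius [|a|], the second outside it. *)
Lemma conv_half (b s : R) : 0 <= b < d%:R -> 0 <= s -> d%:R < b + s ->
  exists2 C : R, 0 < C & forall F a,
    \sum_(y <- F | (bracket y <= bracket (a - y)%R)%N) bpow b y * bpow s (a - y) <= C * bpow (b + s - d%:R) a.
Proof.
move=> bd s0 bs.
have [C1 C10 H1] := sum_bpow_inner bd; have [C2 C20 H2] := sum_bpow_outer bs.
exists (2 `^ s * C1 + C2); first by rewrite addr_gt0 // mulr_gt0 // powR_gt0.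
move=> F a; have a0 := bracket_gt0 a; rewrite (bigID (fun y => (bracket y <= bracket a)%N)) /= mulrDl.
apply: lerD.
  apply: (@le_trans _ _ (\sum_(y <- F | (bracket y <= bracket a)%N) bpow b y * (2 `^ s * bpow s a))).
    rewrite big_mkcondl /=; apply: ler_sum => y ya; case: ifP => [H|_].
      rewrite ler_wpM2l ?bpow_ge0 //; apply: (@bpow_scale _ s 2) => //.
      have := bracketD (a - y) y; rewrite subrK; lia.
    by rewrite !mulr_ge0 ?bpow_ge0 ?powR_ge0.
  rewrite -mulr_suml mulrC -!mulrA ler_wpM2l ?powR_ge0 //.
  apply: (@le_trans _ _ (bpow s a * (C1 * (bracket a)%:R `^ (d%:R - b)))).
    by rewrite ler_wpM2l ?bpow_ge0 ?H1.
  rewrite mulrCA ler_pM2l // /bpow -powRD; last first.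
    by apply/implyP => _; rewrite pnatr_eq0 -lt0n.
  by rewrite (_ : - s + (d%:R - b) = - (b + s - d%:R)) //; ring.
apply: (@le_trans _ _ (\sum_(y <- F | (bracket a <= bracket y)%N) bpow (b + s) y)); last first.
  by apply: le_trans (H2 _ _ a0) _; rewrite /bpow opprB.
rewrite big_mkcond [leRHS]big_mkcond; apply: ler_sum => y _; case: ifP.
  move=> /andP[H]; rewrite -ltnNge => /ltnW aley; rewrite aley.
  by rewrite -bpow_mul ler_wpM2l ?bpow_ge0 //; apply: powRN_anti; rewrite ?ltr0n ?bracket_gt0 ?ler_nat.
by move=> _; case: ifP => // _; exact: bpow_ge0.
Qed.

(** Discrete Riesz composition: convolving the powers [b] and [s] of the
    distance costs one factor of the volume. *)
Lemma conv_bpow (b s : R) : 0 <= b < d%:R -> 0 <= s < d%:R -> d%:R < b + s ->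
  exists2 C : R, 0 < C & forall F a,
    \sum_(y <- F) bpow b y * bpow s (a - y) <= C * bpow (b + s - d%:R) a.
Proof.
move=> bd sd bs; have sb : d%:R < s + b by rewrite addrC.
have [C1 C10 H1] := conv_half bd (proj1 (andP sd)) bs.
have [C2 C20 H2] := conv_half sd (proj1 (andP bd)) sb.
exists (C1 + C2); first exact: addr_gt0.
move=> F a; rewrite (bigID (fun y => (bracket y <= bracket (a - y)%R)%N)) /= mulrDl.
apply: lerD; first exact: H1.
rewrite (addrC b s).
have inj : injective (fun y : lattice d => a - y) by move=> y z /addrI/oppr_inj.
apply: le_trans (H2 [fset a - y | y in F]%fset a).
rewrite big_mkcond [leRHS]big_mkcond sum_imfset //; apply: ler_sum => y _.
rewrite subKr; case: ifP; last by move=> _; case: ifP => // _; rewrite mulr_ge0 ?bpow_ge0.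
by rewrite -ltnNge => /ltnW ->; rewrite mulrC.
Qed.

End RadialSums.

(** * Equilibrium measures *)

Section Minimizer.
Local Open Scope classical_set_scope.
Context {R : realType}.

Lemma continuous_sum (T : topologicalType) (I : Type) (r : seq I) (f : I -> T -> R) :
  (forall i, continuous (f i)) -> continuous (fun t => \sum_(i <- r) f i t).
Proof.
move=> cf; elim: r => [|i r IH] t.
  rewrite (_ : (fun t => _) = cst 0); first exact: cvg_cst.
  by apply/funext => x; rewrite big_nil.
rewrite (_ : (fun t => _) = fun t => f i t + \sum_(j <- r) f j t).
  by apply: cvgD; [exact: cf|exact: IH].
by apply/funext => x; rewrite big_cons.
Qed.

(** A quadratic form attains its minimum on the (compact) standard simplex. *)
Lemma simplex_argmin n (k : 'I_n -> 'I_n -> R) : (0 < n)%N ->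
  exists2 v : 'I_n -> R, (forall i, 0 <= v i) /\ \sum_i v i = 1 &
  forall u : 'I_n -> R, (forall i, 0 <= u i) -> \sum_i u i = 1 ->
    \sum_i \sum_j v i * v j * k i j <= \sum_i \sum_j u i * u j * k i j.
Proof.
move=> n0.
pose S : set 'rV[R]_n := [set v : 'rV[R]_n | forall i, `[0, 1] (v ord0 i)] `&`
   (fun v : 'rV[R]_n => \sum_i v ord0 i) @^-1` [set 1].
pose f (v : 'rV[R]_n) := \sum_i \sum_j v ord0 i * v ord0 j * k i j.
have cS : compact S.
  apply: compact_closedI; first by apply: (@rV_compact R n (fun=> `[0, 1])) => _; exact: segment_compact.
  apply: (@closed_comp _ _ (fun v : 'rV[R]_n => \sum_i v ord0 i)); last exact: closed_eq.
  by move=> v _; apply: continuous_sum => i; exact: coord_continuous.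
have cf : {within S, continuous f}.
  apply: continuous_subspaceT; apply: continuous_sum => i; apply: continuous_sum => j v.
  apply: (@continuousM R _ (fun w : 'rV[R]_n => w ord0 i * w ord0 j) (fun=> k i j)).
    by apply: continuousM; exact: coord_continuous.
  exact: cst_continuous.
have inS (u : 'I_n -> R) : (forall i, 0 <= u i) -> \sum_i u i = 1 -> S (\row_i u i).
  move=> u0 u1; split => /=; last by rewrite -[RHS]u1; apply: eq_bigr => i _; rewrite mxE.
  move=> i; rewrite mxE in_itv /= u0 -u1 (bigD1 i) //= lerDl sumr_ge0 // => j _.
have S0 : S !=set0.
  pose i0 := Ordinal n0; exists (\row_i (i == i0)%:R); apply: inS => [i|]; first exact: ler0n.
  by rewrite (bigD1 i0) //= big1 ?addr0 ?eqxx // => i /negbTE ->.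
have [c + cmin] := compact_EVT_min S0 cS cf.
rewrite inE => -[c01 c1]; exists (fun i => c ord0 i).
  by split => // i; have := c01 i; rewrite /= in_itv /= => /andP[].
move=> u u0 u1; have := cmin (\row_i u i); rewrite inE => /(_ (inS u u0 u1)).
rewrite /f => /le_trans; apply; rewrite le_eqVlt; apply/orP; left; apply/eqP.
by apply: eq_bigr => i _; apply: eq_bigr => j _; rewrite !mxE.
Qed.

End Minimizer.

Definition pot {R : realType} {d : nat} (b : R) (A : {fset lattice d})
    (mu : lattice d -> R) (x : lattice d) : R :=
  \sum_(y <- A) mu y * kern b (x - y).

Section Equilibrium.
Context {R : realType} {d : nat}.
Implicit Types (A B : {fset lattice d}) (x y z : lattice d) (b : R) (mu nu : lattice d -> R).

Lemma energyE b A mu : energy b A mu = \sum_(x <- A) mu x * pot b A mu x.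
Proof.
apply: eq_bigr => x _; rewrite mulr_sumr; apply: eq_bigr => y _.
by rewrite mulrA.
Qed.

Lemma sum_nth A (f : lattice d -> R) :
  \sum_(x <- A) f x = \sum_(i < size A) f (nth 0 A i).
Proof. by rewrite (big_nth 0) big_mkord. Qed.

Lemma exists_minimizer b A : A != fset0 ->
  exists2 mu, prob_on A mu & forall nu, prob_on A nu -> energy b A mu <= energy b A nu.
Proof.
move=> A0; have n0 : (0 < size A)%N by rewrite cardfs_gt0.
pose K (i j : 'I_(size A)) : R := kern b (nth 0 A i - nth 0 A j).
have enE nu : energy b A nu = \sum_(i < size A) \sum_(j < size A) nu (nth 0 A i) * nu (nth 0 A j) * K i j.
  by rewrite /energy sum_nth; apply: eq_bigr => i _; rewrite sum_nth.
have [v [v0 v1] vmin] := simplex_argmin K n0.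
pose mu x := if insub (index x A) is Some i then v i else 0.
have muE (i : 'I_(size A)) : mu (nth 0 A i) = v i.
  rewrite /mu index_uniq ?fset_uniq ?ltn_ord //.
  by rewrite insubT ?ltn_ord // => ?; congr v; apply: val_inj.
have mu_prob : prob_on A mu.
  split => [x _|]; first by rewrite /mu; case: insubP.
  by rewrite sum_nth -[RHS]v1; apply: eq_bigr => i _; rewrite muE.
exists mu => // nu [nu0 nu1]; rewrite !enE.
rewrite (eq_bigr (fun i => \sum_j v i * v j * K i j)); last first.
  by move=> i _; apply: eq_bigr => j _; rewrite !muE.
apply: (vmin (fun i : 'I_(size A) => nu (nth 0 A i))); last by rewrite -[RHS]nu1 sum_nth.
by move=> i; apply: nu0; rewrite mem_nth.
Qed.

Lemma prob_on_neq0 A mu : prob_on A mu -> A != fset0.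
Proof.
case=> _; apply: contra_eqN => /eqP ->; rewrite big_seq_fset0 /=.
by rewrite eq_sym oner_eq0.
Qed.

Lemma prob_pos A mu : prob_on A mu -> exists2 x, x \in A & 0 < mu x.
Proof.
move=> [mu0 mu1]; apply: contrapT => H; have := mu1; rewrite big_seq big1.
  by move/esym/eqP; rewrite oner_eq0.
move=> x xA; apply/eqP; apply: contrapT => /negP mux; apply: H; exists x => //.
by rewrite lt_def mux mu0.
Qed.

Lemma pot_ge0 b A nu x : (forall y, y \in A -> 0 <= nu y) -> 0 <= pot b A nu x.
Proof.
move=> nu0; rewrite /pot big_seq sumr_ge0 // => y yA.
by rewrite mulr_ge0 ?nu0 // ltW ?kern_gt0.
Qed.

Lemma energy_gt0 b A mu : prob_on A mu -> 0 < energy b A mu.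
Proof.
move=> muP; have [x xA mux] := prob_pos muP; case: muP => mu0 _.
rewrite energyE (bigD1_seq x) ?fset_uniq //=; apply: ltr_wpDr.
  by rewrite big_seq_cond sumr_ge0 // => y /andP[yA _]; rewrite mulr_ge0 ?mu0 ?pot_ge0.
rewrite mulr_gt0 // /pot (bigD1_seq x) ?fset_uniq //=.
apply: ltr_wpDr; last by rewrite mulr_gt0 ?kern_gt0.
rewrite big_seq_cond sumr_ge0 // => y /andP[yA _].
by rewrite mulr_ge0 ?mu0 // ltW ?kern_gt0.
Qed.

Lemma energy_le1 b A mu : 0 <= b -> prob_on A mu -> energy b A mu <= 1.
Proof.
move=> b0 [mu0 mu1]; rewrite energyE -[leRHS]mu1 big_seq [leRHS]big_seq.
apply: ler_sum => x xA; rewrite -[leRHS]mulr1 ler_wpM2l ?mu0 // -[leRHS]mu1.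
rewrite /pot big_seq [leRHS]big_seq; apply: ler_sum => y yA.
by rewrite -[leRHS]mulr1 ler_wpM2l ?mu0 ?kern_le1.
Qed.

Lemma capE b A mu : prob_on A mu ->
  (forall nu, prob_on A nu -> energy b A mu <= energy b A nu) ->
  Cap b A = (energy b A mu)^-1.
Proof.
move=> muP mumin; rewrite /Cap; congr (_^-1); apply/le_anti/andP; split.
  apply: ge_inf; last by exists mu.
  by exists 0 => _ [nu nuP <-]; exact/ltW/energy_gt0.
apply: lb_le_inf; first by exists (energy b A mu); exists mu.
by move=> _ [nu nuP <-]; exact: mumin.
Qed.

Lemma cap0 b : Cap b (fset0 : {fset lattice d}) = 0 :> R.
Proof.
rewrite /Cap [X in inf X](_ : _ = set0) ?inf0 ?invr0 //.
by rewrite -subset0 => t [mu /prob_on_neq0]; rewrite eqxx.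
Qed.

Lemma cap_ge0 b A : 0 <= Cap b A.
Proof.
have [->|A0] := eqVneq A fset0; first by rewrite cap0.
have [mu muP mumin] := exists_minimizer b A0.
by rewrite (capE muP mumin) invr_ge0 ltW ?energy_gt0.
Qed.

Lemma cap_ge1 b A : 0 <= b -> A != fset0 -> 1 <= Cap b A.
Proof.
move=> b0 A0; have [mu muP mumin] := exists_minimizer b A0.
by rewrite (capE muP mumin) invf_ge1 ?energy_gt0 // energy_le1.
Qed.

Lemma cap_ge_energy b A mu : prob_on A mu -> (energy b A mu)^-1 <= Cap b A.
Proof.
move=> muP; have [nu nuP numin] := exists_minimizer b (prob_on_neq0 muP).
by rewrite (capE nuP numin) lef_pV2 ?posrE ?energy_gt0 // numin.
Qed.

(** Shifting a little mass towards [x] changes the energy of [mu] to first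
    order by the difference between the potential at [x] and the energy; so
    for a minimizer that difference cannot be negative. *)
Lemma minimizer_pot_ge b A mu x : 0 <= b -> prob_on A mu ->
  (forall nu, prob_on A nu -> energy b A mu <= energy b A nu) ->
  x \in A -> energy b A mu <= pot b A mu x.
Proof.
move=> b0 muP mumin xA; have [mu0 mu1] := muP.
set E := energy b A mu; set U := pot b A mu x.
have E1 : E <= 1 by exact: energy_le1.
have U0 : 0 <= U by exact: pot_ge0.
rewrite leNgt; apply/negP => UE.
(* a shift small enough for the first-order gain to beat the second-order loss *)
pose t := (E - U) / 2.
have t0 : 0 < t by rewrite divr_gt0 // subr_gt0.
have t1 : t <= 1 by rewrite /t; lra.
pose nu y := (1 - t) * mu y + t * (y == x)%:R.
have sumx (f : lattice d -> R) : \sum_(y <- A) (y == x)%:R * f y = f x.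
  rewrite (bigD1_seq x) ?fset_uniq //= eqxx mul1r big1 ?addr0 // => y /negbTE ->.
  by rewrite mul0r.
have nuP : prob_on A nu.
  split => [y yA|]; first by rewrite addr_ge0 ?mulr_ge0 ?mu0 ?subr_ge0 // ltW.
  rewrite /nu big_split /= -!mulr_sumr mu1.
  have := sumx (fun=> 1); rewrite (eq_bigr (fun y => (y == x)%:R)) => [->|y _].
    by ring.
  by rewrite mulr1.
have potE z : pot b A nu z = (1 - t) * pot b A mu z + t * kern b (z - x).
  rewrite /pot mulr_sumr -(sumx (fun y => kern b (z - y))) mulr_sumr -big_split /=.
  by apply: eq_bigr => y _; rewrite /nu; ring.
have nuE : energy b A nu = (1 - t) ^+ 2 * E + 2 * t * (1 - t) * U + t ^+ 2.
  have UE' : \sum_(y <- A) mu y * kern b (y - x) = U.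
    by apply: eq_bigr => y _; rewrite kern_distC.
  transitivity (\sum_(y <- A) ((1 - t) ^+ 2 * (mu y * pot b A mu y)
     + t * (1 - t) * (mu y * kern b (y - x))
     + ((y == x)%:R * (t * (1 - t) * pot b A mu y + t ^+ 2 * kern b (y - x))))).
    by rewrite energyE; apply: eq_bigr => y _; rewrite potE /nu; ring.
  rewrite !big_split /= sumx -!mulr_sumr -energyE UE' subrr kern0 -/E -/U.
  by ring.
have := mumin _ nuP; rewrite nuE -/E => H.
have : 0 <= t * (t * (E - 2 * U + 1) - 2 * (E - U)).
  rewrite -[leRHS](_ : (1 - t) ^+ 2 * E + 2 * t * (1 - t) * U + t ^+ 2 - E = _).
    by rewrite subr_ge0.
  by ring.
rewrite pmulr_rge0 // leNgt => /negP; apply.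
have -> : 2 * (E - U) = 4 * t by rewrite /t; field.
have : t * (E - 2 * U + 1) <= t * 2 by rewrite ler_pM2l //; lra.
lra.
Qed.

Lemma minimizer_pot_eq b A mu x : 0 <= b -> prob_on A mu ->
  (forall nu, prob_on A nu -> energy b A mu <= energy b A nu) ->
  x \in A -> 0 < mu x -> pot b A mu x = energy b A mu.
Proof.
move=> b0 muP mumin xA mux; apply/le_anti; rewrite minimizer_pot_ge // andbT.
have [mu0 mu1] := muP.
have H : \sum_(y <- A) mu y * (pot b A mu y - energy b A mu) = 0.
  rewrite (eq_bigr (fun y => mu y * pot b A mu y - mu y * energy b A mu)); last first.
    by move=> y _; rewrite mulrBr.
  by rewrite big_split /= sumrN -energyE -mulr_suml mu1 mul1r subrr.
have : mu x * (pot b A mu x - energy b A mu) <= 0.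
  rewrite -H (bigD1_seq x) ?fset_uniq //= lerDl big_seq_cond sumr_ge0 //.
  by move=> y /andP[yA _]; rewrite mulr_ge0 ?mu0 // subr_ge0 minimizer_pot_ge.
by rewrite pmulr_rle0 // subr_le0.
Qed.

(** Maximum principle: the potential at any point is controlled by the one at
    the nearest point of the support, where it equals the energy. *)
Lemma max_principle b A mu y : (0 < d)%N -> 0 <= b -> prob_on A mu ->
  (forall nu, prob_on A nu -> energy b A mu <= energy b A nu) ->
  pot b A mu y <= (2 * d)%N%:R `^ b * energy b A mu.
Proof.
move=> d0 b0 muP mumin; have [mu0 mu1] := muP.
have ex : exists n, [exists x : A, (0 < mu (val x)) && (snorm (val x - y) == n)].
  have [x xA mux] := prob_pos muP; exists (snorm (x - y)).
  by apply/existsP; exists [` xA]%fset; rewrite mux eqxx.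
have [n /existsP[x /andP[mux /eqP xn]] nmin] := ex_minnP ex.
rewrite -(minimizer_pot_eq b0 muP mumin (valP x) mux) /pot mulr_sumr.
rewrite big_seq [leRHS]big_seq; apply: ler_sum => z zA.
have [->|muz] := eqVneq (mu z) 0; first by rewrite !mul0r mulr0.
have muz0 : 0 < mu z by rewrite lt_def muz mu0.
rewrite mulrCA ler_pM2l //.
have nz : (n <= snorm (z - y))%N.
  by apply: nmin; apply/existsP; exists [` zA]%fset; rewrite muz0 eqxx.
apply: le_trans (kern_le_bpow _ b0) _.
apply: (@le_trans _ _ (2%:R `^ b * bpow b (val x - z))).
  apply: bpow_scale; rewrite ?bracket_gt0 //.
  have := snormD (val x - y) (y - z); rewrite subrKA xn /bracket.
  by rewrite (snorm_distC z y) in nz; move: (snorm (val x - z)) (snorm (y - z)) nz => p q; lia.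
by rewrite natrM powRM ?ler0n // -mulrA ler_wpM2l ?powR_ge0 ?bpow_le_kern.
Qed.

(** Dual upper bound: a family of charges whose potential is at least [1] on
    [A] has total mass at least a constant times the capacity of [A]. *)
Lemma cap_le_mass b A (I : eqType) (r : seq I) (nu : I -> R) (y : I -> lattice d) :
  (0 < d)%N -> 0 <= b -> (forall i, i \in r -> 0 <= nu i) ->
  (forall x, x \in A -> 1 <= \sum_(i <- r) nu i * kern b (x - y i)) ->
  Cap b A <= (2 * d)%N%:R `^ b * \sum_(i <- r) nu i.
Proof.
move=> d0 b0 nu0 H; have [->|A0] := eqVneq A fset0.
  by rewrite cap0 mulr_ge0 ?powR_ge0 // big_seq sumr_ge0.
have [mu muP mumin] := exists_minimizer b A0; have [mu0 mu1] := muP.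
have E0 := energy_gt0 b muP.
rewrite (capE muP mumin) -(ler_pM2r E0) mulVf ?gt_eqF // -[leLHS]mu1.
apply: (@le_trans _ _ (\sum_(i <- r) nu i * pot b A mu (y i))).
  apply: (@le_trans _ _ (\sum_(x <- A) mu x * \sum_(i <- r) nu i * kern b (x - y i))).
    rewrite big_seq [leRHS]big_seq; apply: ler_sum => x xA.
    by rewrite -[leLHS]mulr1 ler_wpM2l ?mu0 ?H.
  under eq_bigr do rewrite mulr_sumr; rewrite exchange_big /= le_eqVlt.
  apply/orP; left; apply/eqP; apply: eq_bigr => i _; rewrite mulr_sumr.
  by apply: eq_bigr => x _; rewrite kern_distC mulrCA.
rewrite mulrAC mulr_sumr big_seq [leRHS]big_seq; apply: ler_sum => i ir.
by rewrite [leRHS]mulrC ler_wpM2l ?nu0 // max_principle.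
Qed.

(** Primal lower bound, for charges given with multiplicity. *)
Lemma cap_ge_charges b A (I : eqType) (r : seq I) (m : I -> R) (z : I -> lattice d) :
  0 <= b -> (forall i, i \in r -> 0 <= m i) -> (forall i, i \in r -> z i \in A) ->
  (\sum_(i <- r) m i) ^+ 2 <=
    Cap b A * \sum_(i <- r) \sum_(j <- r) m i * m j * kern b (z i - z j).
Proof.
move=> b0 m0 zA; set M := \sum_(i <- r) m i.
have M0 : 0 <= M by rewrite /M big_seq sumr_ge0.
have W0 : 0 <= \sum_(i <- r) \sum_(j <- r) m i * m j * kern b (z i - z j).
  rewrite big_seq sumr_ge0 // => i ir; rewrite big_seq sumr_ge0 // => j jr.
  by rewrite !mulr_ge0 ?m0 // ltW ?kern_gt0.
have [M00|Mn0] := eqVneq M 0; first by rewrite M00 expr0n mulr_ge0 ?cap_ge0.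
have {}M0 : 0 < M by rewrite lt_def Mn0.
pose mu x := \sum_(i <- r) (m i / M) * (z i == x)%:R.
have sumz (f : lattice d -> R) i : i \in r -> \sum_(x <- A) (z i == x)%:R * f x = f (z i).
  move=> ir; rewrite (bigD1_seq (z i)) ?fset_uniq ?zA //= eqxx mul1r big1 ?addr0 //.
  by move=> y; rewrite eq_sym => /negbTE ->; rewrite mul0r.
have summu (f : lattice d -> R) : \sum_(x <- A) mu x * f x = \sum_(i <- r) m i / M * f (z i).
  under eq_bigr do rewrite mulr_suml; rewrite exchange_big /= big_seq [RHS]big_seq.
  apply: eq_bigr => i ir; rewrite -sumz // mulr_sumr.
  by apply: eq_bigr => x _; rewrite mulrA.
have muP : prob_on A mu.
  split => [x xA|].
    rewrite /mu big_seq sumr_ge0 // => i ir.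
    by rewrite !mulr_ge0 ?ler0n ?m0 // invr_ge0 ltW.
  have := summu (fun=> 1); under eq_bigr do rewrite mulr1; move=> ->.
  by under eq_bigr do rewrite mulr1; rewrite -mulr_suml divff.
have E0 := energy_gt0 b muP.
have := cap_ge_energy b muP; rewrite -(ler_pM2r E0) mulVf ?gt_eqF // => H.
have -> : \sum_(i <- r) \sum_(j <- r) m i * m j * kern b (z i - z j) =
    M ^+ 2 * energy b A mu.
  rewrite energyE summu mulr_sumr; apply: eq_bigr => i _.
  rewrite /pot summu !mulr_sumr; apply: eq_bigr => j _.
  by field.
by rewrite mulrCA -[leLHS]mulr1 ler_pM2l // exprn_gt0.
Qed.

Lemma cap_mono b A B : 0 <= b -> (A `<=` B)%fset -> Cap b A <= Cap b B.
Proof.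
move=> b0 /fsubsetP AB; have [->|A0] := eqVneq A fset0; first by rewrite cap0 cap_ge0.
have [mu muP mumin] := exists_minimizer b A0; have [mu0 mu1] := muP.
have := @cap_ge_charges b B _ A mu id b0 mu0 AB.
rewrite mu1 expr1n -/(energy b A mu) (capE muP mumin) => H.
by rewrite -(ler_pM2r (energy_gt0 b muP)) mulVf ?gt_eqF ?energy_gt0.
Qed.

Lemma cap_translate_le b A z : 0 <= b -> Cap b A <= Cap b (shift z A).
Proof.
move=> b0; have [->|A0] := eqVneq A fset0; first by rewrite cap0 cap_ge0.
have [mu muP mumin] := exists_minimizer b A0; have [mu0 mu1] := muP.
have := @cap_ge_charges b (shift z A) _ A mu (fun x => z + x) b0 mu0.
rewrite mu1 expr1n (capE muP mumin) => H.
rewrite -(ler_pM2r (energy_gt0 b muP)) mulVf ?gt_eqF ?energy_gt0 //.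
apply: le_trans (H _) _; first by move=> x xA; rewrite mem_shift addrC addKr.
rewrite ler_wpM2l ?cap_ge0 // le_eqVlt; apply/orP; left; apply/eqP.
by apply: eq_bigr => x _; apply: eq_bigr => y _; rewrite opprD addrACA subrr add0r.
Qed.

Lemma cap_translate b A z : 0 <= b -> Cap b (shift z A) = Cap b A.
Proof.
move=> b0; apply/le_anti; rewrite cap_translate_le // andbT.
apply: le_trans (cap_translate_le (shift z A) (- z) b0) _; apply: cap_mono => //.
by apply/fsubsetP => x; rewrite !mem_shift opprK addrK.
Qed.

End Equilibrium.

(** * Dyadic boxes, doubled one coordinate at a time *)

Section DyadicBoxes.
Context {d : nat}.
Hypothesis d0 : (0 < d)%N.
Implicit Types (x y z : lattice d).

Definition dstep (m : nat) : lattice d :=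
  \row_(j < d) (if (j : nat) == (m %% d)%N then (2 ^ (m %/ d))%N%:Z else 0).

(** The boxes are binary: passing from one to the next doubles the side in the
    single direction [m %% d], so a tree of sub-boxes has two children per
    node whatever the dimension. *)
Fixpoint dbox (m : nat) : {fset lattice d} :=
  if m is n.+1 then (dbox n `|` shift (dstep n) (dbox n))%fset else [fset 0]%fset.

Definition dexp (m j : nat) : nat := (m %/ d + (j < m %% d))%N.

Lemma dexpS m j : (j < d)%N -> dexp m.+1 j = (dexp m j + (j == m %% d)%N)%N.
Proof.
move=> jd; have := divnS m d0; have := modnS m d; have := ltn_pmod m d0.
rewrite /dexp; case: ifP => [/dvdnP[q E]|_] + -> -> ; last first.
  by rewrite add0n; move: (m %% d)%N => r; lia.
have -> : (m %% d = d.-1)%N.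
  have -> : m = (q.-1 * d + d.-1)%N by case: q E => [|q]; nia.
  by rewrite modnMDl modn_small //; lia.
lia.
Qed.

Lemma dboxP m x :
  reflect (forall j, 0 <= x ord0 j < (2 ^ dexp m j)%N%:Z) (x \in dbox m).
Proof.
elim: m x => [|m IH] x /=.
  rewrite inE; apply: (iffP eqP) => [-> j|H]; first by rewrite mxE /dexp div0n mod0n.
  by apply/rowP => j; have := H j; rewrite mxE /dexp div0n mod0n /=; move: (x _ _) => a; lia.
pose j0 := Ordinal (ltn_pmod m d0).
have e0 : dexp m j0 = (m %/ d)%N by rewrite /dexp /= ltnn addn0.
have sE j : dstep m ord0 j = if j == j0 then (2 ^ (m %/ d))%N%:Z else 0.
  by rewrite mxE -val_eqE.
have eS (j : 'I_d) : dexp m.+1 j = (dexp m j + (j == j0))%N by rewrite dexpS.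
rewrite inE mem_shift; apply: (iffP orP) => [[/IH H|/IH H] j|H].
- have := H j; rewrite eS => /andP[-> H2] /=; apply: lt_le_trans H2 _.
  by rewrite lez_nat leq_exp2l // leq_addr.
- have := H j; rewrite eS rowBE sE.
  case: eqP => [->|_]; last by rewrite subr0 addn0.
  by rewrite e0 addn1 expnS; move: (x _ _) (2 ^ _)%N => a b; lia.
have := H j0; rewrite eS eqxx addn1 expnS e0 => H0.
have [lt|ge] := ltP (x ord0 j0) (2 ^ (m %/ d))%N%:Z.
  left; apply/IH => j; have := H j; rewrite eS; case: eqP => [->|_]; last by rewrite addn0.
  by rewrite e0 lt => /andP[->].
right; apply/IH => j; have := H j; rewrite eS rowBE sE.
case: eqP => [->|_]; last by rewrite subr0 addn0.
by move: H0 ge; rewrite e0; move: (x _ _) (2 ^ _)%N => a b; lia.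
Qed.

Lemma dbox_disjoint m x : x \in dbox m -> x - dstep m \notin dbox m.
Proof.
move=> /dboxP xm; apply/negP => /dboxP H.
pose j0 := Ordinal (ltn_pmod m d0).
have := H j0; have := xm j0; rewrite rowBE mxE /= eqxx /dexp /= ltnn addn0.
by move: (x _ _) (2 ^ _)%N => a b; lia.
Qed.

Lemma dboxS m x : (x \in dbox m.+1) = (x \in dbox m) || (x - dstep m \in dbox m).
Proof. by rewrite /= inE mem_shift. Qed.

Lemma dbox_right m x : x \in dbox m.+1 -> x \notin dbox m -> x - dstep m \in dbox m.
Proof. by rewrite dboxS => /orP[->|]. Qed.

Lemma dexpS_le m j : (j < d)%N -> (dexp m.+1 j <= (m %/ d).+1)%N.
Proof.
by move=> jd; rewrite dexpS // /dexp; move: (m %% d)%N => r; case: eqP; lia.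
Qed.

Lemma snorm_dbox (x y : lattice d) m n : (forall j, j < d -> dexp m j <= n)%N ->
  x \in dbox m -> y \in dbox m -> (snorm (x - y) <= 2 ^ n)%N.
Proof.
move=> H /dboxP xm /dboxP ym; apply/snormP => j; rewrite rowBE.
have := xm j; have := ym j.
have : (2 ^ dexp m j <= 2 ^ n)%N by rewrite leq_exp2l // H.
by move: (x _ _) (y _ _) (2 ^ dexp m j)%N (2 ^ n)%N => a b e f; lia.
Qed.

Lemma snorm_dboxS x y m :
  x \in dbox m.+1 -> y \in dbox m.+1 -> (snorm (x - y) <= 2 ^ (m %/ d).+1)%N.
Proof. by apply: snorm_dbox => j; exact: dexpS_le. Qed.

End DyadicBoxes.

(** * Two random subsets of a dyadic box *)

(** A finite list of sets stands for a set drawn uniformly from the list. *)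
Definition avg {R : realType} {T : Type} (s : seq T) (F : T -> R) : R :=
  (\sum_(t <- s) F t) / (size s)%:R.

Section Avg.
Context {R : realType} {T : eqType}.
Implicit Types (s : seq T) (F G : T -> R).

Lemma avg_ge0 s F : (forall t, t \in s -> 0 <= F t) -> 0 <= avg s F.
Proof.
by move=> F0; rewrite divr_ge0 ?ler0n // big_seq sumr_ge0.
Qed.

Lemma le_avg s F G : (forall t, t \in s -> F t <= G t) -> avg s F <= avg s G.
Proof.
move=> FG; rewrite ler_wpM2r ?invr_ge0 ?ler0n // big_seq [leRHS]big_seq.
exact: ler_sum.
Qed.

Lemma eq_avg s F G : (forall t, t \in s -> F t = G t) -> avg s F = avg s G.
Proof.
by move=> FG; congr (_ / _); rewrite big_seq [RHS]big_seq; exact: eq_bigr.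
Qed.

Lemma avgMl s (c : R) F : avg s (fun t => c * F t) = c * avg s F.
Proof. by rewrite /avg -mulr_sumr mulrA. Qed.

Lemma avgMr s (c : R) F : avg s (fun t => F t * c) = avg s F * c.
Proof. by rewrite /avg -mulr_suml mulrAC. Qed.

Lemma avgD s F G : avg s (fun t => F t + G t) = avg s F + avg s G.
Proof. by rewrite /avg big_split /= mulrDl. Qed.

Lemma avg_cst s (c : R) : (0 < size s)%N -> avg s (fun=> c) = c.
Proof.
move=> s0; rewrite /avg big_const_seq count_predT iter_addr_0 -[c *+ _]mulr_natr mulfK //.
by rewrite pnatr_eq0 -lt0n.
Qed.

Lemma avg_nseq n (a : T) F : (0 < n)%N -> avg (nseq n a) F = F a.
Proof.
move=> n0; rewrite -[RHS](@avg_cst (nseq n a)) ?size_nseq //.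
by apply: eq_avg => t /nseqP[->].
Qed.

Lemma avg_sum (I : eqType) (r : seq I) s (F : I -> T -> R) :
  avg s (fun t => \sum_(i <- r) F i t) = \sum_(i <- r) avg s (F i).
Proof. by rewrite /avg exchange_big /= mulr_suml. Qed.

Lemma avg_cat s1 s2 F : size s1 = size s2 ->
  avg (s1 ++ s2) F = (avg s1 F + avg s2 F) / 2.
Proof.
move=> E; rewrite /avg big_cat size_cat -E -mulrDl -mulrA -invfM natrD.
by congr (_ / _); ring.
Qed.

Lemma avg_map (h : T -> T) s F : avg [seq h t | t <- s] F = avg s (F \o h).
Proof. by rewrite /avg big_map size_map. Qed.

Lemma avg_pairs (h : T -> T -> T) s F :
  avg [seq h t u | t <- s, u <- s] F = avg s (fun t => avg s (fun u => F (h t u))).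
Proof.
rewrite /avg big_allpairs_dep size_allpairs natrM invfM mulrA; congr (_ / _).
by rewrite mulr_suml.
Qed.

(** Cauchy-Schwarz in the form used for second moments. *)
Lemma avg_CS s F G : (forall t, t \in s -> 0 <= G t) ->
  (forall t, t \in s -> G t = 0 -> F t = 0) ->
  avg s F ^+ 2 <= avg s (fun t => F t ^+ 2 / G t) * avg s G.
Proof.
move=> G0 GF; set a := avg s F; set g := avg s G; set q := avg s _.
have key l : 0 <= q - 2 * l * a + l ^+ 2 * g.
  have -> : q - 2 * l * a + l ^+ 2 * g =
      avg s (fun t => F t ^+ 2 / G t + (- (2 * l)) * F t + l ^+ 2 * G t).
    by rewrite !avgD !avgMl mulNr.
  apply: avg_ge0 => t ts; have [Gt|Gt] := eqVneq (G t) 0.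
    by rewrite Gt (GF _ ts Gt) !mulr0 expr0n mul0r !addr0.
  have -> : F t ^+ 2 / G t + - (2 * l) * F t + l ^+ 2 * G t = (F t / G t - l) ^+ 2 * G t.
    by field.
  by rewrite mulr_ge0 ?sqr_ge0 ?G0.
have q0 : 0 <= q by apply: avg_ge0 => t ts; rewrite mulr_ge0 ?sqr_ge0 // invr_ge0 G0.
have g0 : 0 <= g by exact: avg_ge0.
have [gz|gn] := eqVneq g 0; last first.
  have := key (a / g); rewrite -(pmulr_lge0 (x := g)) ?lt_def ?gn ?g0 //.
  have -> : (q - 2 * (a / g) * a + (a / g) ^+ 2 * g) * g = q * g - a ^+ 2 by field.
  by rewrite subr_ge0.
have [-> |an] := eqVneq a 0; first by rewrite expr0n mulr_ge0.
have := key ((q + 1) / (2 * a)); rewrite gz mulr0 addr0.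
have -> : q - 2 * ((q + 1) / (2 * a)) * a = - 1 by field.
by rewrite oppr_ge0 ler10.
Qed.

End Avg.

Definition meets {d : nat} (A B : {fset lattice d}) : bool := has (mem B) A.

Section Families.
Context {R : realType} {d : nat}.
Hypothesis d0 : (0 < d)%N.
Variable thin : pred nat.
Implicit Types (A B Q : {fset lattice d}) (x y z : lattice d) (mu : lattice d -> R).

Lemma meetsP A B : reflect (exists2 x, x \in A & x \in B) (meets A B).
Proof. exact: hasP. Qed.

Lemma meetsC A B : meets A B = meets B A.
Proof. by apply/meetsP/meetsP => -[x xA xB]; exists x. Qed.

Definition glue m (Q1 Q2 : {fset lattice d}) : {fset lattice d} :=
  (Q1 `|` shift (dstep m) Q2)%fset.

Definition pairs m (s : seq {fset lattice d}) := [seq glue m Q1 Q2 | Q1 <- s, Q2 <- s].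

(** At a thinning step exactly one of the two halves is kept, otherwise both
    are: such a set looks the same around each of its points. *)
Fixpoint regfam (m : nat) : seq {fset lattice d} :=
  if m is n.+1 then
    if thin n then regfam n ++ [seq shift (dstep n) Q | Q <- regfam n] else pairs n (regfam n)
  else [:: [fset 0]%fset].

(** Fractal percolation: at a thinning step everything is erased with
    probability one half. Disjoint sub-boxes behave independently below their
    common ancestor, which is what bounds hitting probabilities from above. *)
Fixpoint percfam (m : nat) : seq {fset lattice d} :=
  if m is n.+1 then
    let s := pairs n (percfam n) in
    if thin n then nseq (size s) fset0 ++ s else s
  else [:: [fset 0]%fset].

(** The probability that a given point of the box is retained. *)
Fixpoint retain (m : nat) : R :=
  if m is n.+1 then (if thin n then retain n / 2 else retain n) else 1.

(** The two-point function of percolation divided by [retain m], that is, the value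
    of [retain] at the step that separates [x] and [y]. *)
Fixpoint treeker (m : nat) x y : R :=
  if m is n.+1 then
    if (x \in dbox n) && (y \in dbox n) then treeker n x y
    else if (x \notin dbox n) && (y \notin dbox n) then treeker n (x - dstep n) (y - dstep n)
    else retain n
  else 1.

Lemma retain_gt0 m : 0 < retain m.
Proof. by elim: m => //= m IH; case: ifP => // _; rewrite divr_gt0. Qed.

Lemma retain_ge0 m : 0 <= retain m.
Proof. exact/ltW/retain_gt0. Qed.

Lemma retain_leS m : retain m.+1 <= retain m.
Proof. by rewrite /=; case: ifP => // _; have := retain_gt0 m; lra. Qed.

Lemma treeker_ge m x y : retain m <= treeker m x y.
Proof.
elim: m x y => [//|m IH] x y; apply: le_trans (retain_leS m) _ => /=.
by case: ifP => _; [exact: IH|case: ifP => _ //; exact: IH].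
Qed.

Lemma treeker_gt0 m x y : 0 < treeker m x y.
Proof. exact: lt_le_trans (retain_gt0 m) (treeker_ge m x y). Qed.

Lemma regfam_size m : (0 < size (regfam m))%N.
Proof.
elim: m => //= m IH; case: ifP => _; first by rewrite size_cat addn_gt0 IH.
by rewrite size_allpairs muln_gt0 IH.
Qed.

Lemma percfam_size m : (0 < size (percfam m))%N.
Proof.
elim: m => //= m IH; have : (0 < size (pairs m (percfam m)))%N by rewrite size_allpairs muln_gt0 IH.
by case: ifP => // _; rewrite size_cat => H; rewrite addn_gt0 H orbT.
Qed.

Lemma mem_glue m Q1 Q2 x : (x \in glue m Q1 Q2) = (x \in Q1) || (x - dstep m \in Q2).
Proof. by rewrite inE mem_shift. Qed.

Lemma pairsP m s Q :
  reflect (exists Q1 Q2, [/\ Q1 \in s, Q2 \in s & Q = glue m Q1 Q2]) (Q \in pairs m s).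
Proof.
apply: (iffP allpairsP) => [[[Q1 Q2] /= [H1 H2 ->]]|[Q1 [Q2 [H1 H2 ->]]]].
  by exists Q1, Q2.
by exists (Q1, Q2).
Qed.

Definition inbox m (s : seq {fset lattice d}) := forall Q, Q \in s -> (Q `<=` dbox m)%fset.

Lemma pairs_inbox m s : inbox m s -> inbox m.+1 (pairs m s).
Proof.
move=> H _ /pairsP[Q1 [Q2 [/H/fsubsetP H1 /H/fsubsetP H2 ->]]]; apply/fsubsetP => x.
by rewrite mem_glue dboxS => /orP[/H1 ->//|/H2 ->]; rewrite orbT.
Qed.

Lemma regfam_inbox m : inbox m (regfam m).
Proof.
elim: m => [|m IH] /=; first by move=> Q; rewrite inE => /eqP ->.
case: ifP => _; last exact: pairs_inbox.
move=> Q; rewrite mem_cat => /orP[/IH/fsubsetP H|/mapP[Q' /IH/fsubsetP H ->]];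
  apply/fsubsetP => x.
  by move/H => xm; rewrite dboxS xm.
by rewrite mem_shift dboxS => /H ->; rewrite orbT.
Qed.

Lemma percfam_inbox m : inbox m (percfam m).
Proof.
elim: m => [|m IH] /=; first by move=> Q; rewrite inE => /eqP ->.
have IHp := pairs_inbox IH; case: ifP => // _ Q.
by rewrite mem_cat => /orP[/nseqP[-> _]|/IHp //]; exact: fsub0set.
Qed.

Definition ind (x : lattice d) (Q : {fset lattice d}) : R := (x \in Q)%:R.

Lemma ind_out m s Q x : inbox m s -> Q \in s -> x \notin dbox m -> ind x Q = 0.
Proof.
by move=> H /H/fsubsetP QH; rewrite /ind; case xQ : (x \in Q) => //; rewrite QH.
Qed.

Lemma ind_glueL m s Q1 Q2 x : inbox m s -> Q2 \in s -> x \in dbox m ->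
  ind x (glue m Q1 Q2) = ind x Q1.
Proof.
move=> H Q2s xm; rewrite /ind mem_glue.
have := ind_out H Q2s (dbox_disjoint d0 xm); rewrite /ind.
by case: (_ \in Q2) => // /eqP; rewrite ?oner_eq0 // orbF.
Qed.

Lemma ind_glueR m s Q1 Q2 x : inbox m s -> Q1 \in s -> x \notin dbox m ->
  ind x (glue m Q1 Q2) = ind (x - dstep m) Q2.
Proof.
move=> H Q1s xm; rewrite /ind mem_glue.
have := ind_out H Q1s xm; rewrite /ind.
by case: (_ \in Q1) => // /eqP; rewrite oner_eq0.
Qed.

Lemma avg_pairsE m s (F : {fset lattice d} -> R) :
  avg (pairs m s) F = avg s (fun Q1 => avg s (fun Q2 => F (glue m Q1 Q2))).
Proof. exact: avg_pairs. Qed.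

Lemma pairs_1pt m s p x : (0 < size s)%N -> inbox m s ->
  (forall y, y \in dbox m -> avg s (ind y) = p) ->
  x \in dbox m.+1 -> avg (pairs m s) (ind x) = p.
Proof.
move=> s0 H Hp xm; rewrite avg_pairsE; case: (boolP (x \in dbox m)) => xl.
  rewrite -(Hp _ xl); apply: eq_avg => Q1 Q1s; rewrite -[RHS](avg_cst _ s0).
  by apply: eq_avg => Q2 Q2s; exact: ind_glueL Q2s xl.
rewrite -(Hp _ (dbox_right xm xl)) -[RHS](avg_cst _ s0); apply: eq_avg => Q1 Q1s.
by apply: eq_avg => Q2 Q2s; exact: ind_glueR Q1s xl.
Qed.

(** Points of different halves are retained independently, points of the same
    half as they are there. *)
Lemma pairs_2pt m s p (K : lattice d -> lattice d -> R) x y :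
  (0 < size s)%N -> inbox m s ->
  (forall y, y \in dbox m -> avg s (ind y) = p) ->
  (forall x y, x \in dbox m -> y \in dbox m -> avg s (fun Q => ind x Q * ind y Q) <= p * K x y) ->
  x \in dbox m.+1 -> y \in dbox m.+1 -> 
  avg (pairs m s) (fun Q => ind x Q * ind y Q) <=
    p * (if (x \in dbox m) && (y \in dbox m) then K x y
    else if (x \notin dbox m) && (y \notin dbox m) then K (x - dstep m) (y - dstep m)
    else p).
Proof.
move=> s0 H Hp HK xm ym; rewrite avg_pairsE.
case: (boolP (x \in dbox m)) => xl; case: (boolP (y \in dbox m)) => yl /=.
- apply: le_trans (HK _ _ xl yl); rewrite le_eqVlt; apply/orP; left; apply/eqP.
  apply: eq_avg => Q1 Q1s; rewrite -[RHS](avg_cst _ s0).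
  by apply: eq_avg => Q2 Q2s; rewrite (ind_glueL _ H Q2s xl) (ind_glueL _ H Q2s yl).
- rewrite -{1}(Hp _ xl) -(Hp _ (dbox_right ym yl)) -avgMr le_eqVlt.
  apply/orP; left; apply/eqP; apply: eq_avg => Q1 Q1s; rewrite -avgMl.
  by apply: eq_avg => Q2 Q2s; rewrite (ind_glueL _ H Q2s xl) (ind_glueR _ H Q1s yl).
- rewrite -{1}(Hp _ yl) -(Hp _ (dbox_right xm xl)) -avgMr le_eqVlt.
  apply/orP; left; apply/eqP; apply: eq_avg => Q1 Q1s; rewrite -avgMl.
  by apply: eq_avg => Q2 Q2s; rewrite (ind_glueL _ H Q2s yl) (ind_glueR _ H Q1s xl) mulrC.
apply: le_trans (HK _ _ (dbox_right xm xl) (dbox_right ym yl)).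
rewrite -[leRHS](avg_cst _ s0) le_eqVlt; apply/orP; left; apply/eqP.
apply: eq_avg => Q1 Q1s; apply: eq_avg => Q2 Q2s.
by rewrite (ind_glueR _ H Q1s xl) (ind_glueR _ H Q1s yl).
Qed.

Lemma ind_shift z x Q : ind x (shift z Q) = ind (x - z) Q.
Proof. by rewrite /ind mem_shift. Qed.

Lemma regfam_1pt m x : x \in dbox m -> avg (regfam m) (ind x) = retain m.
Proof.
elim: m x => [|m IH] x xm.
  by rewrite /avg /= big_seq1 /ind xm divr1.
have IHb := @regfam_inbox m; rewrite /=; case: ifP => th; last first.
  exact: pairs_1pt (regfam_size m) IHb IH xm.
rewrite avg_cat ?size_map // avg_map; congr (_ / 2).
rewrite (@eq_avg _ _ _ (ind x \o shift (dstep m)) (ind (x - dstep m))); last first.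
  by move=> Q _; rewrite /= ind_shift.
have z0 y : y \notin dbox m -> avg (regfam m) (ind y) = 0.
  move=> yl; rewrite -(avg_cst 0 (regfam_size m)); apply: eq_avg => Q Qs.
  exact: ind_out IHb Qs yl.
case: (boolP (x \in dbox m)) => xl.
  by rewrite IH // z0 ?addr0 // dbox_disjoint.
by rewrite z0 // add0r IH // dbox_right.
Qed.

Lemma regfam_2pt m x y : x \in dbox m -> y \in dbox m ->
  avg (regfam m) (fun Q => ind x Q * ind y Q) <= retain m * treeker m x y.
Proof.
elim: m x y => [|m IH] x y xm ym.
  by rewrite /avg /= big_seq1 /ind xm ym divr1.
have IHb := @regfam_inbox m; rewrite /=; case: ifP => th; last first.
  exact: pairs_2pt (regfam_size m) IHb (@regfam_1pt m) IH xm ym.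
rewrite avg_cat ?size_map // avg_map -mulrA [2^-1 * _]mulrC mulrA ler_pM2r ?invr_gt0 //.
rewrite (@eq_avg _ _ _ (_ \o shift (dstep m))
    (fun Q => ind (x - dstep m) Q * ind (y - dstep m) Q)); last first.
  by move=> Q _; rewrite /= !ind_shift.
have z0 u v : (u \notin dbox m) || (v \notin dbox m) ->
    avg (regfam m) (fun Q => ind u Q * ind v Q) = 0.
  move=> ul; rewrite -(avg_cst 0 (regfam_size m)); apply: eq_avg => Q Qs.
  by case/orP: ul => ul; rewrite (ind_out IHb Qs ul) ?mul0r ?mulr0.
case: (boolP (x \in dbox m)) => xl; case: (boolP (y \in dbox m)) => yl /=.
- by rewrite [X in _ + X]z0 ?(dbox_disjoint d0 xl) // addr0 IH.
- by rewrite z0 ?yl ?orbT // z0 ?(dbox_disjoint d0 xl) // addr0 mulr_ge0 ?retain_ge0.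
- by rewrite z0 ?xl // z0 ?(dbox_disjoint d0 yl) ?orbT // addr0 mulr_ge0 ?retain_ge0.
by rewrite z0 ?xl // add0r IH // dbox_right.
Qed.

Lemma percfam_1pt m x : x \in dbox m -> avg (percfam m) (ind x) = retain m.
Proof.
elim: m x => [|m IH] x xm.
  by rewrite /avg /= big_seq1 /ind xm divr1.
have H := pairs_1pt (percfam_size m) (@percfam_inbox m) IH xm; rewrite /=; case: ifP => // th.
rewrite avg_cat ?size_nseq // H avg_nseq ?size_allpairs ?muln_gt0 ?percfam_size //.
by rewrite /ind in_fset0 add0r.
Qed.

Lemma percfam_2pt m x y : x \in dbox m -> y \in dbox m ->
  avg (percfam m) (fun Q => ind x Q * ind y Q) <= retain m * treeker m x y.
Proof.
elim: m x y => [|m IH] x y xm ym.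
  by rewrite /avg /= big_seq1 /ind xm ym divr1.
have H := pairs_2pt (percfam_size m) (@percfam_inbox m) (@percfam_1pt m) IH xm ym.
rewrite /=; case: ifP => // th.
rewrite avg_cat ?size_nseq // -mulrA [2^-1 * _]mulrC mulrA ler_pM2r ?invr_gt0 //.
by rewrite avg_nseq ?size_allpairs ?muln_gt0 ?percfam_size // /ind in_fset0 mul0r add0r.
Qed.

End Families.

(** * Size, regularity and hitting probabilities of the first family *)

Section Regular.
Context {R : realType} {d : nat}.
Hypothesis d0 : (0 < d)%N.
Variable thin : pred nat.
Implicit Types (A B Q : {fset lattice d}) (x y z : lattice d) (mu : lattice d -> R).

Notation regfam := (@regfam d thin).
Notation percfam := (@percfam d thin).
Notation retain := (@retain R thin).
Notation treeker := (@treeker R d thin).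

Lemma card_shift z A : #|` shift z A| = #|` A|.
Proof. by rewrite card_imfset //= => x y /addrI. Qed.

Lemma card_glue m Q1 Q2 : (Q1 `<=` dbox m)%fset -> (Q2 `<=` dbox m)%fset ->
  #|` glue m Q1 Q2| = (#|` Q1| + #|` Q2|)%N.
Proof.
move=> /fsubsetP H1 /fsubsetP H2; rewrite cardfsU card_shift.
rewrite (_ : (_ `&` _)%fset = fset0) ?cardfs0 ?subn0 //.
apply/fsetP => x; rewrite !inE mem_shift; apply/negP => /andP[/H1 xm /H2].
by apply/negP; exact: dbox_disjoint.
Qed.

Lemma regfam_card m Q : Q \in regfam m -> #|` Q|%:R = 2 ^+ m * retain m :> R.
Proof.
elim: m Q => [|m IH] Q /=; first by rewrite inE => /eqP ->; rewrite cardfs1 expr0 mulr1.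
have p2 : 2 ^+ m.+1 * (retain m / 2) = 2 ^+ m * retain m by rewrite exprS; field.
case: ifP => _.
  by rewrite mem_cat p2 => /orP[/IH//|/mapP[Q' /IH E ->]]; rewrite card_shift.
move=> /pairsP[Q1 [Q2 [H1 H2 ->]]].
rewrite card_glue ?(regfam_inbox _ (thin := thin)) // natrD (IH _ H1) (IH _ H2) exprS; ring.
Qed.

Definition nbrs Q x (r : nat) : {fset lattice d} := [fset y in Q | (snorm (y - x) <= r)%N]%fset.

(** Seen from each of its points, a set of the first family is as large as
    its dimension demands, at all scales; that no point is exceptional
    is the reason for using this family. *)
Lemma regfam_regular m n Q x : (m <= n)%N -> Q \in regfam n -> x \in Q ->
  2 ^+ m * retain m <= #|` nbrs Q x (2 ^ (m %/ d).+1)|%:R :> R.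
Proof.
have shrink Q1 Q2 y z r : (shift z Q1 `<=` Q2)%fset -> y \in Q1 ->
    (#|` nbrs Q1 y r| <= #|` nbrs Q2 (z + y) r|)%N.
  move=> /fsubsetP H yQ; rewrite -(card_shift z); apply: fsubset_leq_card.
  apply/fsubsetP => u; rewrite mem_shift !inE /= => /andP[uQ ur].
  by rewrite opprD addrA ur andbT H // mem_shift.
elim: n m Q x => [|n IH] m Q x mn Qn xQ.
  have -> : m = 0%N by lia.
  rewrite expr0 mul1r /= ler1n cardfs_gt0; apply/fset0Pn; exists x.
  by rewrite !inE xQ subrr snorm0.
have [mn'|] := leqP m n; last first.
  move=> nm; have -> : m = n.+1 by lia.
  rewrite -(regfam_card Qn) ler_nat; apply: fsubset_leq_card; apply/fsubsetP => y yQ.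
  rewrite !inE yQ /=; have /fsubsetP H := regfam_inbox Qn.
  apply: leq_trans (snorm_dboxS d0 (H _ yQ) (H _ xQ)) _.
  by rewrite leq_exp2l // ltnS leq_div2r.
have step Q1 z : Q1 \in regfam n -> (shift z Q1 `<=` Q)%fset -> x - z \in Q1 ->
    2 ^+ m * retain m <= #|` nbrs Q x (2 ^ (m %/ d).+1)|%:R :> R.
  move=> Q1n HQ xz; apply: le_trans (IH m Q1 _ mn' Q1n xz) _.
  have := shrink Q1 Q (x - z) z (2 ^ (m %/ d).+1)%N HQ xz.
  by rewrite ler_nat (addrC z) subrK.
have sh0 Q1 : shift 0 Q1 = Q1 by apply/fsetP => u; rewrite mem_shift subr0.
move: Qn => /=; case: ifP => _.
  rewrite mem_cat => /orP[Qn|/mapP[Q' Q'n E]].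
    by apply: IH.
  apply: (step Q' (dstep n)) => //; rewrite ?E //.
  by move: xQ; rewrite E mem_shift.
move=> /pairsP[Q1 [Q2 [H1 H2 E]]]; move: xQ; rewrite E mem_glue => /orP[xQ|xQ].
  by rewrite -E; apply: (step Q1 0); rewrite ?subr0 // sh0 E fsubsetUl.
by rewrite -E; apply: (step Q2 (dstep n)) => //; rewrite E fsubsetUr.
Qed.

(** Second moment lower bound for hitting probabilities. *)
Lemma regfam_hit m B mu : (B `<=` dbox m)%fset -> prob_on B mu ->
  retain m <= avg (regfam m) (fun Q => (meets Q B)%:R) *
     \sum_(x <- B) \sum_(y <- B) mu x * mu y * treeker m x y.
Proof.
move=> /fsubsetP BH [mu0 mu1].
pose Z Q := \sum_(x <- B) mu x * ind x Q : R.
have EZ : avg (regfam m) Z = retain m.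
  rewrite avg_sum -[RHS]mul1r -mu1 mulr_suml big_seq [RHS]big_seq.
  by apply: eq_bigr => x /BH xm; rewrite avgMl regfam_1pt.
have EZ2 : avg (regfam m) (fun Q => Z Q ^+ 2) <=
    retain m * \sum_(x <- B) \sum_(y <- B) mu x * mu y * treeker m x y.
  rewrite (@eq_avg _ _ _ _ (fun Q => \sum_(x <- B) \sum_(y <- B) mu x * mu y * (ind x Q * ind y Q))).
    rewrite avg_sum mulr_sumr big_seq [leRHS]big_seq; apply: ler_sum => x xB.
    rewrite avg_sum mulr_sumr big_seq [leRHS]big_seq; apply: ler_sum => y yB.
    by rewrite avgMl [leRHS]mulrCA ler_wpM2l ?mulr_ge0 ?mu0 // regfam_2pt ?BH.
  move=> Q _; rewrite expr2 mulr_suml; apply: eq_bigr => x _.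
  by rewrite mulr_sumr; apply: eq_bigr => y _; ring.
have Z0 Q : ~~ meets Q B -> Z Q = 0.
  move=> HQ; rewrite /Z big_seq big1 // => x xB; rewrite /ind.
  case xQ : (x \in Q); last by rewrite mulr0.
  by move: HQ => /meetsP[]; exists x.
have Zge0 Q : 0 <= Z Q by rewrite /Z big_seq sumr_ge0 // => x xB; rewrite mulr_ge0 ?mu0 ?ler0n.
have ZZ Q : Q \in regfam m -> Z Q ^+ 2 = 0 -> Z Q = 0.
  by move=> _ /eqP; rewrite sqrf_eq0 => /eqP.
have CS : retain m ^+ 2 <= avg (regfam m) (fun Q => (meets Q B)%:R) * avg (regfam m) (fun Q => Z Q ^+ 2).
  rewrite -EZ; apply: le_trans (avg_CS _ ZZ) _ => [Q _|]; first exact: sqr_ge0.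
  apply: ler_wpM2r; first by apply: avg_ge0 => Q _; exact: sqr_ge0.
  apply: le_avg => Q _; case: (boolP (meets Q B)) => [HQ|/Z0 ->].
    have [->|ZQ] := eqVneq (Z Q) 0; first by rewrite expr0n mul0r ler01.
    by rewrite divff // sqrf_eq0.
  by rewrite expr0n mul0r.
rewrite -(ler_pM2l (@retain_gt0 R thin m)) -expr2; apply: le_trans CS _.
rewrite [leRHS]mulrCA ler_wpM2l //; apply: avg_ge0 => Q _; exact: ler0n.
Qed.

End Regular.

(** * Percolation and electrical resistance *)

Section Percolation.
Context {R : realType} {d : nat}.
Hypothesis d0 : (0 < d)%N.
Variable thin : pred nat.
Implicit Types (A B Q : {fset lattice d}) (x y z : lattice d) (mu : lattice d -> R).

Notation percfam := (@percfam d thin).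
Notation retain := (@retain R thin).
Notation treeker := (@treeker R d thin).

(** Lower bound on the probability that the percolation avoids a set of
    resistance [r]; it is submultiplicative for the parallel law of
    resistances and has enough slack at a thinning step. *)
Definition avoid (r : R) : R := if r <= 2 then 0 else (1 - 2 / r) ^+ 2.

Lemma avoid_ge0 r : 0 <= avoid r.
Proof. by rewrite /avoid; case: ifP => // _; exact: sqr_ge0. Qed.

Lemma avoid_parallel r1 r2 : 2 < r1 -> 2 < r2 ->
  avoid (r1 * r2 / (r1 + r2)) <= avoid r1 * avoid r2.
Proof.
move=> h1 h2; rewrite {1}/avoid; case: (leP (_ / _) 2) => [_|H]; first by rewrite mulr_ge0 ?avoid_ge0.
rewrite /avoid [r1 <= 2]leNgt h1 [r2 <= 2]leNgt h2 /= -exprMn.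
have -> : 2 / (r1 * r2 / (r1 + r2)) = 2 / r1 + 2 / r2.
  by field; rewrite !gt_eqF //; lra.
have i1 : 0 < 2 / r1 by rewrite divr_gt0 //; lra.
have i2 : 0 < 2 / r2 by rewrite divr_gt0 //; lra.
have j1 : 2 / r1 < 1 by rewrite ltr_pdivrMr ?mul1r //; lra.
have j2 : 2 / r2 < 1 by rewrite ltr_pdivrMr ?mul1r //; lra.
have : 2 / r1 + 2 / r2 < 1.
  have -> : 2 / r1 + 2 / r2 = 2 / (r1 * r2 / (r1 + r2)).
    by field; rewrite !gt_eqF //; lra.
  by rewrite ltr_pdivrMr ?mul1r //; lra.
move: (2 / r1) (2 / r2) i1 i2 j1 j2 => a b *.
have -> : (1 - a) * (1 - b) = (1 - (a + b)) + a * b by ring.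
have : 0 < a * b by rewrite mulr_gt0.
by move=> ?; rewrite lerXn2r ?nnegrE //; lra.
Qed.

Lemma avoid_thin r : 0 <= r -> avoid (2 * r + 1) <= (1 + avoid r) / 2.
Proof.
move=> r0; rewrite {2}/avoid; case: (leP r 2) => H.
  rewrite /avoid; case: (leP (_ + 1) 2) => H'; first by lra.
  have : 2 / (2 * r + 1) < 1 by rewrite ltr_pdivrMr ?mul1r //; lra.
  have : 2 / 5 <= 2 / (2 * r + 1) by rewrite ler_pM2l // lef_pV2 ?posrE //; lra.
  move: (2 / (2 * r + 1)) => a *; rewrite addr0 expr2; nra.
have r1 : (2 * r + 1 <= 2) = false by apply/negbTE; rewrite -ltNge; lra.
rewrite /avoid r1 -subr_ge0.
have -> : (1 + (1 - 2 / r) ^+ 2) / 2 - (1 - 2 / (2 * r + 1)) ^+ 2 =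
   (6 * r + 2) / (r ^+ 2 * (2 * r + 1) ^+ 2).
  by field; rewrite !gt_eqF //; lra.
by rewrite divr_ge0 ?mulr_ge0 ?sqr_ge0 //; lra.
Qed.

Definition tree_energy m B mu : R := \sum_(x <- B) \sum_(y <- B) mu x * mu y * treeker m x y.

Definition lhalf m B : {fset lattice d} := [fset x in B | x \in dbox m]%fset.
Definition rhalf m B : {fset lattice d} :=
  shift (- dstep m) [fset x in B | x \notin dbox m]%fset.

Lemma mem_rhalf m B x : (x \in rhalf m B) = (x + dstep m \in B) && (x + dstep m \notin dbox m).
Proof. by rewrite mem_shift opprK !inE. Qed.

Lemma rhalf_notin m B x : x \in rhalf m B -> x + dstep m \notin dbox m.
Proof. by rewrite mem_rhalf => /andP[]. Qed.

Lemma sum_halves m B (F : lattice d -> R) :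
  \sum_(x <- B) F x = \sum_(x <- lhalf m B) F x + \sum_(x <- rhalf m B) F (x + dstep m).
Proof.
rewrite (bigID (fun x => x \in dbox m)) /= [X in X + _]big_fset_condE [X in _ + X]big_fset_condE; congr (_ + _).
rewrite /rhalf sum_imfset; last exact: addrI.
by apply: eq_bigr => x _; rewrite addrAC addNr add0r.
Qed.

(** Mixing measures on the two halves: cross terms only see the separation at
    the last step. *)
Lemma tree_energy_mix m B (muL muR : lattice d -> R) (t u : R) :
  let mu x := if x \in dbox m then t * muL x else u * muR (x - dstep m) in
  tree_energy m.+1 B mu = t ^+ 2 * tree_energy m (lhalf m B) muL + u ^+ 2 * tree_energy m (rhalf m B) muR
    + 2 * (t * u * retain m * (\sum_(x <- lhalf m B) muL x) * (\sum_(x <- rhalf m B) muR x)).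
Proof.
move=> mu.
have muLE x : x \in lhalf m B -> mu x = t * muL x by rewrite /mu !inE => /andP[_ ->].
have muRE x : x \in rhalf m B -> mu (x + dstep m) = u * muR x.
  by move/rhalf_notin => H; rewrite /mu (negbTE H) addrK.
have inL x : x \in lhalf m B -> x \in dbox m by rewrite !inE => /andP[].
rewrite /tree_energy [LHS](sum_halves m).
have -> : \sum_(x <- lhalf m B) \sum_(y <- B) mu x * mu y * treeker m.+1 x y =
   t ^+ 2 * tree_energy m (lhalf m B) muL +
   t * u * retain m * (\sum_(x <- lhalf m B) muL x) * (\sum_(x <- rhalf m B) muR x).
  rewrite /tree_energy [X in _ = X + _]mulr_sumr [X in _ = _ + X * _]mulr_sumr mulr_suml -big_split /=.
  rewrite big_seq [RHS]big_seq; apply: eq_bigr => x xL; rewrite [LHS](sum_halves m); congr (_ + _).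
    rewrite mulr_sumr big_seq [RHS]big_seq; apply: eq_bigr => y yL.
    by rewrite (muLE _ xL) (muLE _ yL) /= (inL _ xL) (inL _ yL) /=; ring.
  rewrite mulr_sumr big_seq [RHS]big_seq; apply: eq_bigr => y yR.
  by rewrite (muLE _ xL) (muRE _ yR) /= (inL _ xL) (negbTE (rhalf_notin yR)) /=; ring.
have -> : \sum_(x <- rhalf m B) \sum_(y <- B) mu (x + dstep m) * mu y * treeker m.+1 (x + dstep m) y =
   u ^+ 2 * tree_energy m (rhalf m B) muR +
   t * u * retain m * (\sum_(x <- lhalf m B) muL x) * (\sum_(x <- rhalf m B) muR x).
  rewrite /tree_energy [X in _ = X + _]mulr_sumr [X in _ = _ + X]mulr_sumr -big_split /=.
  rewrite big_seq [RHS]big_seq; apply: eq_bigr => x xR; rewrite [LHS](sum_halves m) [LHS]addrC; congr (_ + _).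
    rewrite mulr_sumr big_seq [RHS]big_seq; apply: eq_bigr => y yR.
    rewrite (muRE _ xR) (muRE _ yR) /= (negbTE (rhalf_notin xR)) (negbTE (rhalf_notin yR)) /=.
    by rewrite !addrK; ring.
  rewrite mulr_sumr mulr_suml big_seq [RHS]big_seq; apply: eq_bigr => y yL.
  by rewrite (muLE _ yL) (muRE _ xR) /= (inL _ yL) (negbTE (rhalf_notin xR)) /=; ring.
by rewrite /tree_energy; ring.
Qed.

Lemma tree_energy_set0 m mu : tree_energy m fset0 mu = 0.
Proof. by rewrite /tree_energy big_seq_fset0. Qed.

Lemma treekerS_ge m x y : retain m <= treeker m.+1 x y.
Proof. by rewrite /=; case: ifP => _; [|case: ifP => _ //]; exact: treeker_ge. Qed.

Lemma tree_energy_ge m B mu (c : R) : (forall x y, c <= treeker m x y) -> prob_on B mu -> c <= tree_energy m B mu.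
Proof.
move=> Hc [mu0 mu1]; rewrite /tree_energy.
rewrite -[leLHS]mul1r -mu1 mulr_suml big_seq [leRHS]big_seq; apply: ler_sum => x xB.
rewrite -[X in mu x * X]mul1r -mu1 mulr_suml mulr_sumr big_seq [leRHS]big_seq.
by apply: ler_sum => y yB; rewrite mulrA ler_wpM2l ?mulr_ge0 ?mu0.
Qed.

Lemma mix_prob m B (muL muR : lattice d -> R) (t u : R) : 0 <= t -> 0 <= u ->
  (forall x, x \in lhalf m B -> 0 <= muL x) -> (forall x, x \in rhalf m B -> 0 <= muR x) ->
  t * (\sum_(x <- lhalf m B) muL x) + u * (\sum_(x <- rhalf m B) muR x) = 1 ->
  prob_on B (fun x => if x \in dbox m then t * muL x else u * muR (x - dstep m)).
Proof.
move=> t0 u0 L0 R0 E; split => [x xB|].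
  case: ifP => xm; first by rewrite mulr_ge0 ?L0 // !inE xB.
  by rewrite mulr_ge0 ?R0 // mem_rhalf subrK xB xm.
rewrite [LHS](sum_halves m) -[RHS]E !mulr_sumr; congr (_ + _).
  by rewrite big_seq [RHS]big_seq; apply: eq_bigr => x; rewrite !inE => /andP[_ ->].
rewrite big_seq [RHS]big_seq; apply: eq_bigr => x /rhalf_notin /negbTE ->.
by rewrite addrK.
Qed.

Lemma meets0 Q : meets Q fset0 = false.
Proof. by apply/meetsP => -[x _]; rewrite inE. Qed.

Lemma meets_glue m s Q1 Q2 B : inbox m s -> Q1 \in s -> Q2 \in s -> (B `<=` dbox m.+1)%fset ->
  meets (glue m Q1 Q2) B = meets Q1 (lhalf m B) || meets Q2 (rhalf m B).
Proof.
move=> H /H/fsubsetP H1 /H/fsubsetP H2 /fsubsetP HB.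
apply/meetsP/orP => [[x xQ xB]|[]/meetsP[x xQ]].
- move: xQ; rewrite mem_glue; case: (boolP (x \in dbox m)) => xm.
    rewrite orbC; case: (boolP (_ \in Q2)) => [/H2|_ /= xQ].
      by rewrite (negbTE (dbox_disjoint d0 xm)).
    by left; apply/meetsP; exists x; rewrite // !inE xB.
  case: (boolP (_ \in Q1)) => [/H1|_ /= xQ]; first by rewrite (negbTE xm).
  by right; apply/meetsP; exists (x - dstep m); rewrite // mem_rhalf subrK xB.
- by rewrite !inE => /andP[xB xm]; exists x; rewrite // mem_glue xQ.
by rewrite mem_rhalf => /andP[xB _]; exists (x + dstep m); rewrite // mem_glue addrK xQ orbT.
Qed.

Definition miss m B : R := avg (percfam m) (fun Q => (~~ meets Q B)%:R).

Lemma miss_ge0 m B : 0 <= miss m B.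
Proof. by apply: avg_ge0 => Q _; exact: ler0n. Qed.

Lemma miss0 m : miss m fset0 = 1.
Proof.
rewrite -[RHS](avg_cst 1 (@percfam_size d thin m)); apply: eq_avg => Q _.
by rewrite meets0.
Qed.

Lemma miss_pairs m B : (B `<=` dbox m.+1)%fset ->
  avg (pairs m (percfam m)) (fun Q => (~~ meets Q B)%:R) = miss m (lhalf m B) * miss m (rhalf m B).
Proof.
move=> HB; rewrite avg_pairsE /miss -avgMr; apply: eq_avg => Q1 H1.
rewrite -avgMl; apply: eq_avg => Q2 H2.
by rewrite (meets_glue (@percfam_inbox _ thin m) H1 H2 HB) negb_or -natrM mulnb.
Qed.

(** Lyons' comparison of percolation with electrical resistance: the hitting
    probability of [B] is bounded in terms of the energy of some measure on [B].
    The measure is built from those of the two halves, by splitting the mass in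
    proportion to the conductances, which makes resistances add in parallel. *)
Lemma miss_ge_avoid m B : (B `<=` dbox m)%fset -> B != fset0 ->
  exists2 mu, prob_on B mu & avoid (tree_energy m B mu / retain m - 1) <= miss m B.
Proof.
elim: m B => [|m IH] B HB B0.
  have BE : B = [fset 0]%fset.
    apply/eqP; rewrite eqEfsubset HB /= fsub1set; have /fset0Pn[x xB] := B0.
    by have /fsubsetP/(_ _ xB) := HB; rewrite inE => /eqP <-.
  exists (fun=> 1); first by split => [x _|]; rewrite ?ler01 // BE big_seq_fset1.
  rewrite BE /tree_energy !big_seq_fset1 /= !mulr1 divr1 subrr /avoid ler0n.
  exact: miss_ge0.
have HL : (lhalf m B `<=` dbox m)%fset by apply/fsubsetP => x; rewrite !inE => /andP[].
have HR : (rhalf m B `<=` dbox m)%fset.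
  apply/fsubsetP => x; rewrite mem_rhalf => /andP[xB xm].
  by rewrite -[x](addrK (dstep m)); apply: dbox_right => //; exact: (fsubsetP HB).
have p0 := @retain_gt0 R thin m.
suff [mu muP H] : exists2 mu, prob_on B mu &
    avoid (tree_energy m.+1 B mu / retain m - 1) <= miss m (lhalf m B) * miss m (rhalf m B).
  exists mu => //; rewrite /miss /=; case: ifP => th; last by rewrite (miss_pairs HB).
  have sp : (0 < size (pairs m (percfam m)))%N by rewrite size_allpairs muln_gt0 percfam_size.
  rewrite avg_cat ?size_nseq // avg_nseq // (miss_pairs HB) meetsC meets0 /=.
  have E0 : 0 <= tree_energy m.+1 B mu / retain m - 1.
    by rewrite subr_ge0 ler_pdivlMr // mul1r (tree_energy_ge _ muP) //; exact: treekerS_ge.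
  have -> : tree_energy m.+1 B mu / (retain m / 2) - 1 = 2 * (tree_energy m.+1 B mu / retain m - 1) + 1.
    by field; rewrite gt_eqF.
  by apply: le_trans (avoid_thin E0) _; rewrite ler_pM2r ?invr_gt0 // lerD2l.
have [L0|L0] := eqVneq (lhalf m B) fset0.
  have [R0|R0] := eqVneq (rhalf m B) fset0.
    have /fset0Pn[x xB] := B0; have [xm|xm] := boolP (x \in dbox m).
      by have : x \in lhalf m B by [rewrite !inE xB]; rewrite L0 inE.
    by have : x - dstep m \in rhalf m B by [rewrite mem_rhalf subrK xB]; rewrite R0 inE.
  have [mu [mu0 mu1] Hmu] := IH _ HR R0.
  exists (fun x => if x \in dbox m then 0 * 0 else 1 * mu (x - dstep m)).
    by apply: (@mix_prob m B (fun=> 0) mu) => //; rewrite L0 big_seq_fset0 mul1r mu1 mulr0 add0r.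
  rewrite (@tree_energy_mix m B (fun=> 0) mu) L0 tree_energy_set0 miss0 mul1r.
  by rewrite expr1n mul1r !mulr0 !mul0r mulr0 !(addr0, add0r).
have [muL [muL0 muL1] HmuL] := IH _ HL L0.
have [R0|R0] := eqVneq (rhalf m B) fset0.
  exists (fun x => if x \in dbox m then 1 * muL x else 0 * 0).
    by apply: (@mix_prob m B muL (fun=> 0)) => //; rewrite R0 big_seq_fset0 mul1r muL1 mulr0 addr0.
  rewrite (@tree_energy_mix m B muL (fun=> 0)) R0 tree_energy_set0 miss0 mulr1.
  by rewrite expr1n mul1r !mulr0 !mul0r mulr0 !(addr0, add0r).
have [muR [muR0 muR1] HmuR] := IH _ HR R0.
set rL := _ - 1 in HmuL; set rR := _ - 1 in HmuR.
have keL : tree_energy m (lhalf m B) muL = retain m * (rL + 1).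
  by rewrite /rL subrK mulrC divfK ?gt_eqF.
have keR : tree_energy m (rhalf m B) muR = retain m * (rR + 1).
  by rewrite /rR subrK mulrC divfK ?gt_eqF.
pose mix t u x := if x \in dbox m then t * muL x else u * muR (x - dstep m).
have mixP t u : 0 <= t -> 0 <= u -> t + u = 1 -> prob_on B (mix t u).
  by move=> t0 u0 tu; apply: mix_prob => //; rewrite muL1 muR1 !mulr1.
have mixE t u : t + u = 1 -> tree_energy m.+1 B (mix t u) / retain m - 1 = t ^+ 2 * rL + u ^+ 2 * rR.
  move=> tu; have -> : u = 1 - t by rewrite -tu addrC addKr.
  rewrite tree_energy_mix keL keR muL1 muR1.
  by field; rewrite gt_eqF.
have [rL2|rL2] := leP rL 2.
  exists (mix 1 0); first by apply: mixP; rewrite ?ler01 ?addr0.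
  rewrite mixE ?addr0 // expr1n mul1r expr0n mul0r addr0 /avoid rL2.
  by rewrite mulr_ge0 ?miss_ge0.
have [rR2|rR2] := leP rR 2.
  exists (mix 0 1); first by apply: mixP; rewrite ?ler01 ?add0r.
  rewrite mixE ?add0r // expr1n mul1r expr0n mul0r add0r /avoid rR2.
  by rewrite mulr_ge0 ?miss_ge0.
have rs : 0 < rL + rR by lra.
have tu : rR / (rL + rR) + rL / (rL + rR) = 1 by rewrite -mulrDl addrC divff ?gt_eqF.
exists (mix (rR / (rL + rR)) (rL / (rL + rR))).
  by apply: mixP => //; rewrite divr_ge0 //; lra.
rewrite mixE //.
have -> : (rR / (rL + rR)) ^+ 2 * rL + (rL / (rL + rR)) ^+ 2 * rR = rL * rR / (rL + rR).
  by field; rewrite gt_eqF.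
by apply: le_trans (avoid_parallel rL2 rR2) _; rewrite ler_pM ?avoid_ge0.
Qed.

Lemma percfam_hit m B : (B `<=` dbox m)%fset -> B != fset0 ->
  exists2 mu, prob_on B mu &
    avg (percfam m) (fun Q => (meets Q B)%:R) * tree_energy m B mu <= 6 * retain m.
Proof.
move=> HB B0; have [mu muP H] := miss_ge_avoid HB B0; exists mu => //.
have p0 := @retain_gt0 R thin m.
have hitE : avg (percfam m) (fun Q => (meets Q B)%:R) = 1 - miss m B.
  rewrite -[X in X - _](avg_cst 1 (@percfam_size d thin m)) /miss; apply/eqP.
  rewrite eq_sym subr_eq -avgD; apply/eqP/eq_avg => Q _.
  by case: (meets Q B); rewrite ?addr0 ?add0r.
rewrite hitE; set r := _ - 1 in H.
have r0 : 0 <= r by rewrite subr_ge0 ler_pdivlMr // mul1r (tree_energy_ge _ muP) //; exact: treeker_ge.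
have -> : tree_energy m B mu = retain m * (r + 1) by rewrite /r subrK mulrC divfK ?gt_eqF.
rewrite mulrCA [6 * _]mulrC ler_pM2l //.
apply: (@le_trans _ _ ((1 - avoid r) * (r + 1))).
  by rewrite ler_wpM2r ?lerD2l ?lerN2 // addr_ge0.
rewrite /avoid; case: (leP r 2) => r2; first by lra.
have rn : r != 0 by rewrite gt_eqF //; lra.
have -> : (1 - (1 - 2 / r) ^+ 2) * (r + 1) = 4 - 4 / r ^+ 2 by field.
have : 0 <= 4 / r ^+ 2 by rewrite divr_ge0 ?sqr_ge0.
lra.
Qed.

End Percolation.

(** * Dyadic cells *)

Lemma geom_tail {R : realType} (th : R) k K : th < 1 ->
  \sum_(n < K | (k <= n)%N) th ^+ n + th ^+ (maxn K k) / (1 - th) = th ^+ k / (1 - th).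
Proof.
move=> th1; elim: K => [|K IH]; first by rewrite big_ord0 add0r max0n.
rewrite big_mkcond big_ord_recr /= -big_mkcond /= -IH -addrA; congr (_ + _).
have [kK|Kk] := leqP k K.
  rewrite (_ : maxn K.+1 k = K.+1) ?(_ : maxn K k = K); try lia.
  by rewrite exprS; field; lra.
by rewrite add0r; congr (th ^+ _ / _); lia.
Qed.

Section Cells.
Context {R : realType} {d : nat}.
Implicit Types (A B Q : {fset lattice d}) (x y z : lattice d) (mu : lattice d -> R).

Definition cell (n : nat) x : lattice d := \row_j (x ord0 j %/ (2 ^ n)%N%:Z)%Z.

Lemma cell_near n x y : (snorm (x - y) <= 2 ^ n)%N -> cell n x - cell n y \in cube 1.
Proof.
move=> /snormP H; rewrite cubeP; apply/snormP => j; rewrite rowBE !mxE.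
have := H j; rewrite rowBE; have : (0 < 2 ^ n)%N by rewrite expn_gt0.
move: (x _ _) (y _ _) (2 ^ n)%N => a b p p0 ab; clear H.
have := divz_eq a p; have := divz_eq b p.
have pz : p%:Z != 0 by lia.
have := modz_ge0 a pz; have := modz_ge0 b pz.
have pp : 0 < p%:Z by lia.
have := ltz_pmod a pp; have := ltz_pmod b pp.
move: (a %% p)%Z (b %% p)%Z (a %/ p)%Z (b %/ p)%Z => u v s t *; nia.
Qed.

(** Interacting with a shifted copy costs at most as much as the mean of the
    two self-interactions. *)
Lemma sum_coincide A mu (g h : lattice d -> lattice d) :
  \sum_(x <- A) \sum_(y <- A) mu x * mu y * (g x == h y)%:R <=
  (\sum_(x <- A) \sum_(y <- A) mu x * mu y * (g x == g y)%:R +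
   \sum_(x <- A) \sum_(y <- A) mu x * mu y * (h x == h y)%:R) / 2.
Proof.
pose T := ([fset g x | x in A] `|` [fset h x | x in A])%fset.
have gT x : x \in A -> g x \in T by move=> xA; rewrite inE; apply/orP; left; apply/imfsetP; exists x.
have hT x : x \in A -> h x \in T by move=> xA; rewrite inE; apply/orP; right; apply/imfsetP; exists x.
pose m (f : lattice d -> lattice d) c := \sum_(x <- A) mu x * (f x == c)%:R.
have E (f k : lattice d -> lattice d) : (forall x, x \in A -> f x \in T) ->
    \sum_(x <- A) \sum_(y <- A) mu x * mu y * (f x == k y)%:R = \sum_(c <- T) m f c * m k c.
  move=> fT; under [RHS]eq_bigr do rewrite mulr_suml.
  rewrite [RHS]exchange_big /= big_seq [RHS]big_seq; apply: eq_bigr => x xA.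
  under [RHS]eq_bigr do rewrite mulr_sumr.
  rewrite [RHS]exchange_big /=; apply: eq_bigr => y _.
  rewrite (bigD1_seq (f x)) ?fset_uniq ?fT //= eqxx mulr1 big1 ?addr0; last first.
    by move=> c; rewrite eq_sym => /negbTE ->; rewrite mulr0 mul0r.
  by rewrite mulrA eq_sym.
rewrite !E // -big_split /= mulr_suml; apply: ler_sum => c _.
have := sqr_ge0 (m g c - m h c); rewrite sqrrB -!expr2; lra.
Qed.

(** A pair of points at distance at most [2 ^ n] lies in one of [3 ^ d] relative
    positions of cells of side [2 ^ n], each handled by [sum_coincide]. *)
Lemma sum_near_le A mu n : (forall x, x \in A -> 0 <= mu x) ->
  \sum_(x <- A) \sum_(y <- A) mu x * mu y * (snorm (x - y) <= 2 ^ n)%N%:R <=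
  (3 ^ d)%N%:R * \sum_(x <- A) \sum_(y <- A) mu x * mu y * (cell n x == cell n y)%:R.
Proof.
move=> mu0.
apply: (@le_trans _ _ (\sum_(s <- cube 1) \sum_(x <- A) \sum_(y <- A)
    mu x * mu y * (cell n x == s + cell n y)%:R)).
  rewrite [leRHS]exchange_big big_seq [leRHS]big_seq; apply: ler_sum => x xA.
  rewrite [leRHS]exchange_big big_seq [leRHS]big_seq; apply: ler_sum => y yA.
  rewrite -mulr_sumr ler_wpM2l ?mulr_ge0 ?mu0 //; case: (boolP (_ <= _)%N) => H; last first.
    by rewrite sumr_ge0 // => s _; rewrite ler0n.
  rewrite (bigD1_seq _ (cell_near H)) ?fset_uniq //= subrK eqxx lerDl sumr_ge0 // => s _.
apply: (@le_trans _ _ (\sum_(s <- @cube d 1) \sum_(x <- A) \sum_(y <- A)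
    mu x * mu y * (cell n x == cell n y)%:R)).
  apply: ler_sum => s _; apply: le_trans (sum_coincide _ _ _ _) _.
  rewrite [X in _ + X](_ : _ = \sum_(x <- A) \sum_(y <- A) mu x * mu y * (cell n x == cell n y)%:R).
    lra.
  apply: eq_bigr => x _; apply: eq_bigr => y _; by rewrite (inj_eq (addrI s)).
rewrite big_const_seq count_predT iter_addr_0 -[leLHS]mulr_natl.
by rewrite (card_cube 1).
Qed.

Hypothesis d0 : (0 < d)%N.

Lemma cell_step m n x y : x - dstep m \in dbox m -> y - dstep m \in dbox m ->
  cell n x = cell n y -> cell n (x - dstep m) = cell n (y - dstep m).
Proof.
move=> /(dboxP d0) xm /(dboxP d0) ym E; apply/rowP => j.
have [nm|mn] := leqP n (m %/ d); last first.
  have small (z : lattice d) : (0 <= z ord0 j < (2 ^ @dexp d m j)%N%:Z) -> cell n z ord0 j = 0.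
    move=> H; rewrite mxE divz_small //.
    have : (2 ^ @dexp d m j <= 2 ^ n)%N.
      by rewrite leq_exp2l // (leq_trans _ mn) // /dexp; case: ltnP; lia.
    by move: H; move: (z _ _) (2 ^ @dexp d m j)%N (2 ^ n)%N => a b c; lia.
  by rewrite !small.
have [k sE] : exists k : int, dstep m ord0 j = k * (2 ^ n)%N%:Z.
  rewrite mxE; case: ifP => _; last by exists 0; rewrite mul0r.
  by exists (2 ^ (m %/ d - n))%N%:Z; rewrite -PoszM -expnD subnK.
have := congr1 (fun z : lattice d => z ord0 j) E; rewrite !mxE.
have p0 : (2 ^ n)%N%:Z != 0 by rewrite eqz_nat expn_eq0.
move: sE; rewrite mxE => ->; rewrite -!mulNr ![_ + - k * _]addrC !divzMDl // => ->.
by [].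
Qed.

Lemma cell_split m n x y : (n <= m %/ d)%N -> x \in dbox m -> y - dstep m \in dbox m ->
  cell n x != cell n y.
Proof.
move=> nm /(dboxP d0) xm /(dboxP d0) ym; apply/eqP => E.
pose j0 := Ordinal (ltn_pmod m d0).
have := congr1 (fun z : lattice d => z ord0 j0) E; rewrite !mxE.
have := xm j0; have := ym j0; rewrite rowBE [dstep _ _ _]mxE /= eqxx /dexp /= ltnn addn0.
have -> : (2 ^ (m %/ d))%N%:Z = (2 ^ (m %/ d - n))%N%:Z * (2 ^ n)%N%:Z.
  by rewrite -PoszM -expnD subnK.
have p0 : 0 < (2 ^ n)%N%:Z by rewrite ltz_nat expn_gt0.
move: (x _ _) (y _ _) (2 ^ (m %/ d - n))%N%:Z (2 ^ n)%N%:Z p0 => a b e p p0 Hb Ha EE.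
have : (a %/ p)%Z < e by rewrite ltz_divLR //; case/andP: Ha.
have : e <= (b %/ p)%Z by rewrite lez_divRL //; case/andP: Hb => + _; lia.
by rewrite EE; lia.
Qed.

End Cells.

(** * Thinning at the rate of a given dimension *)

Section Dimension.
Context {R : realType} {d : nat}.
Hypothesis d0 : (0 < d)%N.
Variable g : R.
Hypothesis g0 : 0 < g.
Hypothesis gd : g < d%:R.
Implicit Types (A B Q : {fset lattice d}) (x y z : lattice d) (mu : lattice d -> R).

Let dR0 : 0 < d%:R :> R. Proof. by rewrite ltr0n. Qed.

(** The number of thinning steps among the first [m] follows the line of
    slope [g / d], so that [retain g_thin m] is of the order of [2 ^ (- m g / d)]. *)
Definition thin_count (m : nat) : nat := Num.truncn (m%:R * g / d%:R).
Definition g_thin : pred nat := fun m => thin_count m != thin_count m.+1.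

Lemma slope_ge0 m : 0 <= m%:R * g / d%:R.
Proof. by rewrite divr_ge0 ?mulr_ge0 ?ler0n // ltW. Qed.

Lemma thin_count_le m : (thin_count m)%:R <= m%:R * g / d%:R.
Proof. by have /andP[] := truncn_itv (slope_ge0 m). Qed.

Lemma thin_count_lt m : m%:R * g / d%:R < (thin_count m).+1%:R.
Proof. by have /andP[] := truncn_itv (slope_ge0 m). Qed.

Lemma thin_countS m : thin_count m.+1 = (thin_count m + g_thin m)%N.
Proof.
have E : m.+1%:R * g / d%:R = m%:R * g / d%:R + g / d%:R by rewrite -natr1; ring.
have s1 : g / d%:R < 1 by rewrite ltr_pdivrMr // mul1r.
have s0 : 0 < g / d%:R by rewrite divr_gt0.
have h1 := thin_count_le m.+1; have h2 := thin_count_lt m.+1.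
have h3 := thin_count_le m; have h4 := thin_count_lt m.
have a1 : (thin_count m <= thin_count m.+1)%N.
  by rewrite -ltnS -(ltr_nat R); lra.
have a2 : (thin_count m.+1 <= (thin_count m).+1)%N.
  by rewrite -ltnS -(ltr_nat R) -[X in _ < X]natr1; lra.
by rewrite /g_thin; case: eqP => /= [->|/eqP E']; [rewrite addn0|rewrite addn1; clear -a1 a2 E'; lia].
Qed.

Notation retain := (@retain R g_thin).
Notation treeker := (@treeker R d g_thin).
Notation regfam := (@regfam d g_thin).
Notation percfam := (@percfam d g_thin).

Lemma retain_count m : retain m = 2 `^ (- (thin_count m)%:R).
Proof.
elim: m => [|m IH].
  by rewrite /thin_count !mul0r truncn0 oppr0 powRr0.
rewrite /= thin_countS; case: ifP => _; last by rewrite addn0.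
by rewrite IH [(_ + true)%N]addn1 -[(thin_count m).+1%:R]natr1 opprD powRD ?powR_inv1 // pnatr_eq0 implybT.
Qed.

Lemma retain_ge m : 2 `^ (- (m%:R * g / d%:R)) <= retain m.
Proof. by rewrite retain_count ler_powR ?ler1n // lerN2 thin_count_le. Qed.

Lemma retain_le m : retain m <= 2 * 2 `^ (- (m%:R * g / d%:R)).
Proof.
rewrite retain_count -{2}(powRr1 (ler0n _ 2)) -powRD ?pnatr_eq0 ?implybT //.
by rewrite ler_powR ?ler1n //; have := thin_count_lt m; rewrite -natr1; lra.
Qed.

Lemma pow2_natr (n : nat) (e : R) : ((2 ^ n)%N%:R : R) `^ e = 2 `^ (n%:R * e).
Proof. by rewrite natrX -powR_mulrn // -powRrM. Qed.

Lemma floor_le m : (m %/ d)%N%:R <= m%:R / d%:R :> R.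
Proof. by rewrite ler_pdivlMr // -natrM ler_nat leq_trunc_div. Qed.

Lemma floor_gt m : m%:R / d%:R < (m %/ d).+1%:R :> R.
Proof. by rewrite ltr_pdivrMr // -natrM ltr_nat ltn_ceil. Qed.

Lemma retain_box_ge n : (2 ^ n)%N%:R `^ (- g) <= retain (d * n).
Proof.
apply: le_trans (retain_ge _); rewrite pow2_natr natrM le_eqVlt; apply/orP; left.
by apply/eqP; congr (2 `^ _); field; rewrite gt_eqF.
Qed.

Lemma retain_box_le n : retain (d * n) <= 2 * (2 ^ n)%N%:R `^ (- g).
Proof.
apply: le_trans (retain_le _) _; rewrite pow2_natr natrM le_eqVlt; apply/orP; left.
by apply/eqP; congr (_ * 2 `^ _); field; rewrite gt_eqF.
Qed.

Lemma treeker_le_bpow m x y : x \in dbox m -> y \in dbox m ->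
  treeker m x y <= 2 * 4 `^ g * bpow g (x - y).
Proof.
have one : 1 <= 2 * 4 `^ g.
  rewrite -[leLHS]mulr1 ler_pM ?ler01 ?ler1n //.
  by rewrite -[leLHS](powRr0 4) ler_powR ?ler1n // ltW.
elim: m x y => [|m IH] x y xm ym.
  by move: xm ym; rewrite !inE => /eqP -> /eqP ->; rewrite subrr /bpow bracket0 powR1 mulr1.
have sep : retain m <= 2 * 4 `^ g * bpow g (x - y).
  apply: le_trans (retain_le m) _; rewrite -[leRHS]mulrA ler_pM2l //.
  have -> : 2 `^ (- (m%:R * g / d%:R)) = 4 `^ g * 2 `^ (- ((m%:R / d%:R + 2) * g)).
    have -> : 4 = 2 `^ 2 :> R by rewrite powR_mulrn //; ring.
    rewrite -powRrM -powRD ?pnatr_eq0 ?implybT //; congr (2 `^ _); ring.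
  rewrite ler_wpM2l ?powR_ge0 //.
  have H : (bracket (x - y)%R <= 2 ^ (m %/ d).+1)%N.
    by rewrite bracket_leP ?expn_gt0 // snorm_dboxS.
  apply: le_trans (_ : (2 ^ (m %/ d).+1)%N%:R `^ (- g) <= _); last first.
    by apply: powRN_anti; rewrite ?ltr0n ?bracket_gt0 ?ler_nat // ltW.
  rewrite pow2_natr ler_powR ?ler1n // mulrN lerN2 ler_pM2r // -natr1.
  by have := floor_le m; lra.
rewrite /=; case: ifP => [/andP[xl yl]|_]; first exact: IH.
case: ifP => [/andP[xl yl]|_] //.
have -> : x - y = (x - dstep m) - (y - dstep m) by rewrite opprB addrA subrK.
by apply: IH; apply: dbox_right.
Qed.

Lemma treeker_le_kern m x y : x \in dbox m -> y \in dbox m ->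
  treeker m x y <= 2 * 4 `^ g * d%:R `^ g * kern g (x - y).
Proof.
move=> xm ym; apply: le_trans (treeker_le_bpow xm ym) _; rewrite -!mulrA.
by rewrite !ler_wpM2l ?powR_ge0 ?bpow_le_kern // ltW.
Qed.

Let th : R := 2 `^ (- g).
Let th1 : th < 1.
Proof. by rewrite /th powRN invf_lt1 ?powR_gt0 // powR2_gt1. Qed.
Let thX n : (2 ^ n)%N%:R `^ (- g) = th ^+ n. Proof. exact: pow2X. Qed.
Let th_gt0 : 0 < th. Proof. exact: powR_gt0. Qed.

Let thn0 n : 0 <= th ^+ n. Proof. by rewrite exprn_ge0 // ltW. Qed.

(** Two points share a cell only at the scales above their separation in the
    tree, and these scales form a convergent geometric series. *)
Lemma sum_cells_le m K x y : x \in dbox m -> y \in dbox m ->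
  \sum_(n < K) th ^+ n * (cell n x == cell n y)%:R <= treeker m x y / (1 - th).
Proof.
have tail k : \sum_(n < K | (k <= n)%N) th ^+ n <= th ^+ k / (1 - th).
  rewrite -(geom_tail k K th1) lerDl divr_ge0 ?exprn_ge0 ?subr_ge0 // ltW //.
elim: m x y => [|m IH] x y xm ym.
  apply: le_trans (_ : \sum_(n < K | (0 <= n)%N) th ^+ n <= _); last first.
    by rewrite -(expr0 th); exact: tail.
  apply: ler_sum => n _; rewrite -[leRHS]mulr1 ler_wpM2l ?thn0 //.
  by case: eqP.
have sep : (forall n, (n <= m %/ d)%N -> cell n x != cell n y) ->
    \sum_(n < K) th ^+ n * (cell n x == cell n y)%:R <= retain m / (1 - th).
  move=> H; apply: le_trans (_ : \sum_(n < K | ((m %/ d).+1 <= n)%N) th ^+ n <= _).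
    rewrite [leRHS]big_mkcond; apply: ler_sum => n _; case: ifP => [_|].
      by rewrite -[leRHS]mulr1 ler_wpM2l ?thn0 //; case: eqP.
    by rewrite ltnNge => /negbFE/H/negbTE ->; rewrite mulr0.
  apply: le_trans (tail _) _; rewrite ler_pM2r ?invr_gt0 ?subr_gt0 //.
  apply: le_trans (retain_ge m); rewrite -thX pow2_natr ler_powR ?ler1n // mulrN lerN2.
  by rewrite mulrAC ler_pM2r // ltW // floor_gt.
rewrite /=; case: ifP => [/andP[xl yl]|H1]; first exact: IH.
case: ifP => [/andP[xr yr]|H2].
  apply: le_trans (IH _ _ (dbox_right xm xr) (dbox_right ym yr)).
  apply: ler_sum => n _; rewrite ler_wpM2l ?thn0 //.
  case: eqP => [E|]; last by rewrite ler0n.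
  by rewrite (cell_step d0 (dbox_right xm xr) (dbox_right ym yr) E) eqxx.
apply: sep => n nm; have [xl|xr] := boolP (x \in dbox m).
  by apply: (cell_split d0 nm xl); apply: dbox_right; rewrite // -(andTb (_ \in _)) -xl H1.
have yl : y \in dbox m by move: H2; rewrite xr => /negbFE.
by rewrite eq_sym; apply: (cell_split d0 nm yl); exact: dbox_right.
Qed.

Lemma kern_le_scales N x y : (snorm (x - y) <= 2 ^ N)%N ->
  kern g (x - y) <= 2 `^ g * \sum_(n < N.+1) th ^+ n * (snorm (x - y) <= 2 ^ n)%N%:R.
Proof.
move=> H; apply: le_trans (kern_le_bpow _ (ltW g0)) _.
pose n := up_log 2 (bracket (x - y)%R).
have a0 := bracket_gt0 (x - y).
have an : (bracket (x - y)%R <= 2 ^ n)%N by exact: up_logP.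
have na : (2 ^ n <= 2 * bracket (x - y)%R)%N by exact: up_log2_le.
have nN : (n < N.+1)%N.
  by rewrite ltnS; apply: up_log_min => //; rewrite bracket_leP ?expn_gt0.
rewrite (bigD1 (Ordinal nN)) //= (_ : (snorm _ <= _)%N = true); last first.
  by rewrite -bracket_leP ?expn_gt0.
rewrite mulr1 mulrDr; apply: ler_wpDr.
  by rewrite mulr_ge0 ?powR_ge0 // sumr_ge0 // => i _; rewrite mulr_ge0 ?thn0 ?ler0n.
rewrite -thX; apply: bpow_scale; rewrite ?expn_gt0 // ltW //.
Qed.

(** Euclidean energy is bounded by tree energy: points that are close but far
    apart in the tree lie in neighbouring cells, and interactions between
    neighbouring cells are controlled by those inside each cell. *)
Lemma energy_le_tree_energy : exists2 C : R, 0 < C & forall N B mu,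
  (B `<=` dbox (d * N))%fset -> prob_on B mu -> energy g B mu <= C * tree_energy g_thin (d * N) B mu.
Proof.
have t0 : 0 < 1 - th by rewrite subr_gt0.
exists (2 `^ g * (3 ^ d)%N%:R / (1 - th)).
  by rewrite divr_gt0 // mulr_gt0 ?powR_gt0 // ltr0n expn_gt0.
move=> N B mu /fsubsetP HB [mu0 mu1].
have near x y : x \in B -> y \in B -> (snorm (x - y) <= 2 ^ N)%N.
  move=> /HB xm /HB ym; apply: (snorm_dbox d0 _ xm ym) => j jd.
  by rewrite /dexp mulKn // modnMr ltn0 addn0.
pose W n := \sum_(x <- B) \sum_(y <- B) mu x * mu y * (cell n x == cell n y)%:R.
apply: (@le_trans _ _ (2 `^ g * \sum_(n < N.+1) th ^+ n * ((3 ^ d)%N%:R * W n))).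
  apply: (@le_trans _ _ (2 `^ g * \sum_(n < N.+1) th ^+ n *
     \sum_(x <- B) \sum_(y <- B) mu x * mu y * (snorm (x - y) <= 2 ^ n)%N%:R)).
    under [X in _ <= _ * X]eq_bigr do rewrite mulr_sumr.
    rewrite exchange_big mulr_sumr /energy big_seq [leRHS]big_seq; apply: ler_sum => x xB.
    under [X in _ <= _ * X]eq_bigr do rewrite mulr_sumr.
    rewrite exchange_big mulr_sumr big_seq [leRHS]big_seq; apply: ler_sum => y yB.
    apply: le_trans (ler_wpM2l (mulr_ge0 (mu0 _ xB) (mu0 _ yB)) (kern_le_scales (near _ _ xB yB))) _.
    rewrite le_eqVlt; apply/orP; left; apply/eqP; rewrite mulrCA; congr (_ * _).
    by rewrite mulr_sumr; apply: eq_bigr => n _; ring.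
  rewrite ler_wpM2l ?powR_ge0 //; apply: ler_sum => n _.
  by rewrite ler_wpM2l ?thn0 // sum_near_le.
rewrite -!mulrA ler_wpM2l ?powR_ge0 //.
under eq_bigr do rewrite mulrCA; rewrite -mulr_sumr ler_wpM2l ?ler0n //.
under eq_bigr do rewrite /W mulr_sumr; rewrite exchange_big /= /tree_energy mulr_sumr.
rewrite big_seq [leRHS]big_seq; apply: ler_sum => x xB.
under eq_bigr do rewrite mulr_sumr; rewrite exchange_big /= mulr_sumr.
rewrite big_seq [leRHS]big_seq; apply: ler_sum => y yB.
under eq_bigr do rewrite mulrCA; rewrite -mulr_sumr mulrCA ler_wpM2l ?mulr_ge0 ?mu0 //.
by rewrite mulrC sum_cells_le ?HB.
Qed.

End Dimension.

(** * Surrogate random sets *)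

Section Surrogates.
Context {R : realType} {d : nat}.
Hypothesis d0 : (0 < d)%N.
Variable g : R.
Hypothesis g0 : 0 < g.
Hypothesis gd : g < d%:R.
Implicit Types (A B Q : {fset lattice d}) (x y z : lattice d) (mu : lattice d -> R).

Lemma side_gt0 N : 0 < (2 ^ N)%N%:R :> R.
Proof. by rewrite ltr0n expn_gt0. Qed.

Lemma side_split N (e : R) : (2 ^ N)%N%:R `^ (d%:R - e) = (2 ^ N)%N%:R ^+ d * (2 ^ N)%N%:R `^ (- e).
Proof.
by rewrite powRD ?powR_mulrn ?ler0n //; apply/implyP => _; rewrite gt_eqF ?side_gt0.
Qed.

Lemma side_exp N : 2 ^+ (d * N) = (2 ^ N)%N%:R ^+ d :> R.
Proof. by rewrite mulnC exprM natrX. Qed.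

(** What the upper bound requires of a surrogate: regularity at every point and
    scale, a size matching it, and hitting probabilities bounded from below by
    capacity. *)
Lemma surrogate_regular : exists2 C : R, 0 < C & forall N,
  exists Qs : seq {fset lattice d}, [/\ (0 < size Qs)%N, inbox (d * N) Qs,
    forall Q, Q \in Qs -> #|` Q|%:R <= C * (2 ^ N)%N%:R `^ (d%:R - g),
    forall Q x n, Q \in Qs -> x \in Q -> (n <= N)%N ->
      (2 ^ n)%N%:R `^ (d%:R - g) <= #|` nbrs Q x (2 ^ n.+1)|%:R :> R &
    forall B, (B `<=` dbox (d * N))%fset ->
      Cap g B <= C * (2 ^ N)%N%:R `^ g * avg Qs (fun Q => (meets Q B)%:R)].
Proof.
pose K := 2 * 4 `^ g * d%:R `^ g : R.
have K0 : 0 < K by rewrite !mulr_gt0 ?powR_gt0 ?ltr0n.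
exists (2 + K); first by rewrite addr_gt0.
move=> N; exists (@regfam d (@g_thin R d g) (d * N)); split.
- exact: regfam_size.
- exact: regfam_inbox.
- move=> Q HQ; rewrite (regfam_card (R := R) d0 HQ) side_exp side_split.
  rewrite mulrCA ler_wpM2l ?exprn_ge0 ?ler0n //.
  apply: le_trans (retain_box_le d0 g0 gd N) _.
  by rewrite ler_wpM2r ?powR_ge0 // lerDl ltW.
- move=> Q x n HQ xQ nN.
  have := regfam_regular (R := R) d0 (m := d * n) (leq_mul (leqnn d) nN) HQ xQ.
  rewrite mulKn //; apply: le_trans; rewrite side_exp side_split.
  by rewrite ler_wpM2l ?exprn_ge0 ?ler0n // retain_box_ge.
move=> B HB; have [->|B0] := eqVneq B fset0.
  rewrite cap0; apply: mulr_ge0; last by apply: avg_ge0 => Q _; rewrite ler0n.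
  by rewrite mulr_ge0 ?powR_ge0 ?addr_ge0 ?(ltW K0).
have [mu muP mumin] := exists_minimizer g B0; rewrite (capE muP mumin).
have E0 := energy_gt0 g muP.
have := @regfam_hit R d d0 (@g_thin R d g) _ _ _ HB muP; set a := avg _ _ => H.
have a0 : 0 <= a by apply: avg_ge0 => Q _; rewrite ler0n.
rewrite -(ler_pM2r E0) mulVf ?gt_eqF //.
have L0 : 0 < (2 ^ N)%N%:R `^ (- g) :> R by rewrite powR_gt0 ?side_gt0.
rewrite -(ler_pM2l L0) mulr1.
apply: le_trans (retain_box_ge d0 g0 gd N) _; apply: le_trans H _.
apply: (@le_trans _ _ (a * (K * energy g B mu))).
  rewrite ler_wpM2l //; case: muP => mu0 mu1.
  rewrite /energy mulr_sumr big_seq [leRHS]big_seq; apply: ler_sum => x xB.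
  rewrite mulr_sumr big_seq [leRHS]big_seq; apply: ler_sum => y yB.
  rewrite mulrCA ler_wpM2l ?mulr_ge0 ?mu0 //.
  by apply: treeker_le_kern => //; exact: (fsubsetP HB).
have -> : (2 ^ N)%N%:R `^ (- g) * ((2 + K) * (2 ^ N)%N%:R `^ g * a * energy g B mu) =
   ((2 ^ N)%N%:R `^ g * (2 ^ N)%N%:R `^ (- g)) * ((2 + K) * a * energy g B mu) by ring.
rewrite powR_mulN ?side_gt0 // mul1r mulrA ler_wpM2r ?(ltW E0) // mulrC ler_wpM2r //.
by rewrite lerDr.
Qed.

(** What the lower bound requires of a surrogate: hitting probabilities bounded
    from above by capacity, and correct one- and two-point functions. *)
Lemma surrogate_percolation : exists2 C : R, 0 < C & forall N,
  exists Qs : seq {fset lattice d}, [/\ (0 < size Qs)%N, inbox (d * N) Qs,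
    forall B, (B `<=` dbox (d * N))%fset ->
      avg Qs (fun Q => (meets Q B)%:R) <= C * (2 ^ N)%N%:R `^ (- g) * Cap g B,
    forall x, x \in dbox (d * N) -> (2 ^ N)%N%:R `^ (- g) <= avg Qs (ind x) :> R &
    forall x y, x \in dbox (d * N) -> y \in dbox (d * N) ->
      avg Qs (fun Q => ind x Q * ind y Q) <= C * (2 ^ N)%N%:R `^ (- g) * kern g (x - y)].
Proof.
have [C1 C10 HC1] := energy_le_tree_energy d0 g0 gd.
pose K := 2 * 4 `^ g * d%:R `^ g : R.
have K0 : 0 < K by rewrite !mulr_gt0 ?powR_gt0 ?ltr0n.
exists (12 * C1 + 2 * K); first by rewrite addr_gt0 // mulr_gt0.
move=> N; exists (@percfam d (@g_thin R d g) (d * N)); split.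
- exact: percfam_size.
- exact: percfam_inbox.
- move=> B HB; have [->|B0] := eqVneq B fset0.
    rewrite cap0 mulr0 -[leRHS](avg_cst 0 (@percfam_size d (@g_thin R d g) (d * N))).
    by apply: le_avg => Q _; rewrite meets0.
  have [mu muP H] := @percfam_hit R d d0 (@g_thin R d g) _ _ HB B0.
  have E0 := energy_gt0 g muP; have := cap_ge_energy g muP.
  rewrite -(ler_pM2r E0) mulVf ?gt_eqF // => H1.
  have L0 : 0 <= (2 ^ N)%N%:R `^ (- g) :> R by rewrite powR_ge0.
  rewrite -(ler_pM2r E0); rewrite -[leRHS]mulrA -[leRHS]mulrA.
  set a := avg _ _ in H *.
  apply: (@le_trans _ _ ((12 * C1 + 2 * K) * ((2 ^ N)%N%:R `^ (- g) * 1))); last first.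
    by rewrite !ler_wpM2l // addr_ge0 // mulr_ge0 // ltW.
  have a0 : 0 <= a by apply: avg_ge0 => Q _; rewrite ler0n.
  apply: (@le_trans _ _ (a * (C1 * tree_energy (@g_thin R d g) (d * N) B mu))).
    by rewrite ler_wpM2l // HC1.
  apply: (@le_trans _ _ (C1 * (6 * (2 * (2 ^ N)%N%:R `^ (- g))))).
    rewrite mulrCA ler_wpM2l ?(ltW C10) //; apply: le_trans H _.
    by rewrite ler_wpM2l // retain_box_le.
  rewrite mulr1 mulrDl; have := mulr_ge0 (ltW K0) L0; nra.
- by move=> x xm; rewrite percfam_1pt // retain_box_ge.
move=> x y xm ym; apply: le_trans (percfam_2pt d0 _ xm ym) _.
apply: (@le_trans _ _ (2 * (2 ^ N)%N%:R `^ (- g) * (K * kern g (x - y)))).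
  by rewrite ler_pM ?retain_ge0 ?retain_box_le ?treeker_le_kern // ltW ?treeker_gt0.
have := mulr_ge0 (powR_ge0 (2 ^ N)%N%:R (- g)) (ltW (kern_gt0 g (x - y))).
move: (_ `^ _) (kern _ _) => a b ab.
have -> : (12 * C1 + 2 * K) * a * b = 2 * a * (K * b) + 12 * C1 * (a * b) by ring.
by rewrite lerDl mulr_ge0 // mulr_ge0 // ltW.
Qed.

End Surrogates.

(** * Capacity of a set minus a random set *)

Section Swap.
Context {R : realType} {d : nat}.
Hypothesis d0 : (0 < d)%N.
Variables al g : R.
Hypothesis al0 : 0 < al.
Hypothesis ald : al < d%:R.
Hypothesis g0 : 0 < g.
Hypothesis gd : g < d%:R.
Hypothesis alg : d%:R < al + g.
Implicit Types (A B Q : {fset lattice d}) (x y z : lattice d) (mu : lattice d -> R).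

Let e : R := al + g - d%:R.
Let e0 : 0 < e. Proof. by rewrite subr_gt0. Qed.

(** The identity that lets a surrogate and a given random set trade places. *)
Lemma meets_swap A S (Q : {fset lattice d}) t : 
  meets Q (shift (- t) (fsetdif A S)) = meets S (fsetdif A (shift t Q)).
Proof.
apply/meetsP/meetsP => -[u uQ].
  rewrite mem_shift opprK => /fsetdifP[a [s aA [sS E]]]; exists s => //.
  apply/fsetdifP; exists a, (u + t) => //; split; first by rewrite mem_shift addrK.
  by rewrite E subKr.
move=> /fsetdifP[a [v aA [vQ E]]]; exists (v - t); first by rewrite mem_shift in vQ.
by rewrite mem_shift opprK subrK; apply/fsetdifP; exists a, u => //; split=> //; rewrite E subKr.
Qed.

Lemma sum_pairs (A Q : {fset lattice d}) (F : lattice d * lattice d -> R) :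
  \sum_(i <- [seq (a, q) | a <- A, q <- Q]) F i = \sum_(a <- A) \sum_(q <- Q) F (a, q).
Proof. by rewrite big_allpairs_dep. Qed.

Lemma sub_shift (a b q q' t : lattice d) :
  a - (t + q) - (b - (t + q')) = a - b - (q - q').
Proof. by apply/rowP => j; rewrite !mxE; ring. Qed.

(** A regular set [Q] spreads the equilibrium charges of [A] over [A - Q]
    without loss: around each of its points it carries enough mass, at the
    scale of any given displacement, to rebuild the weaker kernel. *)
Lemma cap_dif_regular : exists2 C : R, 0 < C & forall N A Q t,
  (forall a b, a \in A -> b \in A -> (snorm (a - b) <= 2 ^ N)%N) ->
  (forall x n, x \in Q -> (n <= N)%N ->
      (2 ^ n)%N%:R `^ (d%:R - g) <= #|` nbrs Q x (2 ^ n.+1)|%:R :> R) ->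
  Cap al (fsetdif A (shift t Q)) <= C * #|` Q|%:R * Cap e A.
Proof.
pose K : R := (4 * d)%N%:R `^ al * 2 `^ e.
have K0 : 0 < K by rewrite mulr_gt0 ?powR_gt0 // ltr0n muln_gt0.
exists ((2 * d)%N%:R `^ al * K); first by rewrite mulr_gt0 ?powR_gt0 // ltr0n muln_gt0.
move=> N A Q t Adiam reg.
have [->|A0] := eqVneq A fset0.
  rewrite (_ : fsetdif fset0 _ = fset0) ?cap0 ?mulr0 //.
  by apply/fsetP => x; rewrite inE; apply/fsetdifP => -[a [b]]; rewrite inE.
have [mu muP mumin] := exists_minimizer e A0; have [mu0 mu1] := muP.
have E0 := energy_gt0 e muP; have capA := capE muP mumin.
have spread a b q : a \in A -> b \in A -> q \in Q ->
    kern e (a - b) <= \sum_(q' <- Q) K * kern al (a - b - (q - q')).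
  move=> aA bA qQ; pose n := up_log 2 (bracket (a - b)%R).
  have an : (bracket (a - b)%R <= 2 ^ n)%N by exact: up_logP.
  have na : (2 ^ n <= 2 * bracket (a - b)%R)%N by apply: up_log2_le; exact: bracket_gt0.
  have nN : (n <= N)%N.
    by apply: up_log_min => //; rewrite bracket_leP ?expn_gt0 ?Adiam.
  apply: (@le_trans _ _ (\sum_(q' <- nbrs Q q (2 ^ n.+1)) 2 `^ e * (2 ^ n)%N%:R `^ (- al))).
    rewrite big_const_seq count_predT iter_addr_0 -[leRHS]mulr_natl.
    apply: (@le_trans _ _ (2 `^ e * (2 ^ n)%N%:R `^ (- e))).
      by apply: le_trans (kern_le_bpow _ (ltW e0)) _; apply: bpow_scale; rewrite ?expn_gt0 // ltW.
    have -> : (2 ^ n)%N%:R `^ (- e) = (2 ^ n)%N%:R `^ (d%:R - g) * (2 ^ n)%N%:R `^ (- al) :> R.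
      rewrite -powRD; last by apply/implyP => _; rewrite pnatr_eq0 expn_eq0.
      by congr (_ `^ _); rewrite /e; ring.
    by rewrite mulrCA ler_wpM2r ?mulr_ge0 ?powR_ge0 ?reg.
  apply: (@le_trans _ _ (\sum_(q' <- Q | (snorm (q' - q) <= 2 ^ n.+1)%N)
      K * kern al (a - b - (q - q')))); last first.
    rewrite [leLHS]big_mkcond; apply: ler_sum => q' _; case: ifP => // _.
    by rewrite mulr_ge0 ?(ltW K0) // ltW ?kern_gt0.
  rewrite [leRHS]big_fset_condE big_seq [leRHS]big_seq; apply: ler_sum => q'.
  rewrite !inE => /andP[_ q'q].
  rewrite /K [_ * 2 `^ e]mulrC -[leRHS]mulrA ler_wpM2l ?powR_ge0 //.
  apply: (@le_trans _ _ (4 `^ al * bpow al (a - b - (q - q')))).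
    apply: (@bpow_scale _ al 4); rewrite ?bracket_gt0 ?(ltW al0) //.
    have : (bracket (a - b - (q - q'))%R <= bracket (a - b)%R + bracket (q - q')%R)%N.
      by rewrite -(bracketN (q - q')); exact: bracketD.
    have : (bracket (q - q')%R <= 2 ^ n.+1)%N.
      by rewrite bracket_distC bracket_leP ?expn_gt0.
    by rewrite expnS; move: (bracket _) (bracket _) (bracket _) (2 ^ n)%N an; clear => u v w p; lia.
  by rewrite natrM powRM ?ler0n // -mulrA ler_wpM2l ?powR_ge0 ?bpow_le_kern // ltW.
pose r := [seq (a, q) | a <- A, q <- Q].
have rP i : i \in r -> i.1 \in A /\ i.2 \in Q by move/allpairsP => [[a q] /= [aA qQ ->]].
have muC i : i \in r -> 0 <= K * Cap e A * mu i.1.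
  by move/rP => [iA _]; rewrite !mulr_ge0 ?mu0 ?cap_ge0 ?(ltW K0).
apply: le_trans (@cap_le_mass R d al _ _ r (fun i => K * Cap e A * mu i.1)
   (fun i => i.1 - (t + i.2)) d0 (ltW al0) muC _) _.
  move=> _ /fsetdifP[a [v aA [vQ ->]]].
  have [q qQ ->] : exists2 q, q \in Q & v = t + q.
    by exists (v - t); [rewrite -mem_shift|rewrite addrC subrK].
  rewrite sum_pairs /=.
  apply: (@le_trans _ _ (\sum_(b <- A) Cap e A * (mu b * kern e (a - b)))).
    rewrite -mulr_sumr -/(pot e A mu a) capA mulrC ler_pdivlMr // mul1r.
    by apply: minimizer_pot_ge => //; exact: ltW.
  rewrite big_seq [leRHS]big_seq; apply: ler_sum => b bA.
  apply: (@le_trans _ _ (Cap e A * mu b * \sum_(q' <- Q) K * kern al (a - b - (q - q')))).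
    by rewrite mulrA ler_wpM2l ?mulr_ge0 ?cap_ge0 ?mu0 ?spread.
  rewrite mulr_sumr le_eqVlt; apply/orP; left; apply/eqP; apply: eq_bigr => q' _.
  by rewrite sub_shift; ring.
rewrite -mulrA -[leRHS]mulrA ler_wpM2l ?powR_ge0 // sum_pairs /=.
under eq_bigr do rewrite big_const_seq count_predT iter_addr_0 -mulr_natr.
rewrite -mulr_suml -mulr_sumr mu1 mulr1 mulrAC -mulrA le_eqVlt; apply/orP; left.
by rewrite mulrA.
Qed.

End Swap.

Section CapDif.
Context {R : realType} {d : nat}.
Hypothesis d0 : (0 < d)%N.
Variables al g : R.
Hypothesis al0 : 0 < al.
Hypothesis ald : al < d%:R.
Hypothesis g0 : 0 < g.
Hypothesis gd : g < d%:R.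
Hypothesis alg : d%:R < al + g.
Implicit Types (A B Q : {fset lattice d}) (x y z : lattice d) (mu : lattice d -> R).

Let e : R := al + g - d%:R.
Let e0 : 0 < e. Proof. by rewrite subr_gt0. Qed.

(** If the random set [S] (drawn with weights [w]) hits with probability at
    most [p Cap_al], then the mean of [Cap_g (A - S)] is bounded by [Cap_e A]:
    replace [Cap_g] by the hitting probability of a surrogate [Q], swap [Q]
    with [S], and use the hypothesis on the set [A - Q]. *)
Lemma cap_dif_le : exists2 C : R, 0 < C &
  forall N A t (I : eqType) (r : seq I) (w : I -> R) (S : I -> {fset lattice d}) (p : R),
  (forall i, i \in r -> 0 <= w i) -> 0 <= p ->
  (forall a b, a \in A -> b \in A -> (snorm (a - b) <= 2 ^ N)%N) ->
  (forall i, i \in r -> (fsetdif A (S i) `<=` shift t (dbox (d * N)))%fset) ->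
  (forall B, B != fset0 -> \sum_(i <- r) w i * (meets (S i) B)%:R <= p * Cap al B) ->
  \sum_(i <- r) w i * Cap g (fsetdif A (S i)) <= C * p * (2 ^ N)%N%:R ^+ d * Cap e A.
Proof.
have [C1 C10 H1] := surrogate_regular d0 g0 gd.
have [C2 C20 H2] := cap_dif_regular d0 al0 alg.
exists (C1 * C2 * C1); first by rewrite !mulr_gt0.
move=> N A t I r w S p w0 p0 Adiam HS Hhit.
have [Qs [Qs0 Qin Qcard Qreg Qhit]] := H1 N.
set L := (2 ^ N)%N%:R; have L0 : 0 < L :> R by exact: side_gt0.
pose h Q := \sum_(i <- r) w i * (meets (S i) (fsetdif A (shift t Q)))%:R.
apply: (@le_trans _ _ (C1 * L `^ g * avg Qs h)).
  rewrite avg_sum mulr_sumr big_seq [leRHS]big_seq; apply: ler_sum => i ir.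
  rewrite avgMl mulrCA ler_wpM2l ?w0 //.
  rewrite -(cap_translate _ (- t) (ltW g0)); apply: le_trans (Qhit _ _) _.
    apply/fsubsetP => x; rewrite mem_shift opprK => /(fsubsetP (HS _ ir)).
    by rewrite mem_shift addrK.
  rewrite le_eqVlt; apply/orP; left; apply/eqP; congr (_ * _).
  by apply: eq_avg => Q _; rewrite meets_swap.
have hle Q : Q \in Qs -> h Q <= p * (C2 * (C1 * L `^ (d%:R - g)) * Cap e A).
  move=> HQ; have [E|E] := eqVneq (fsetdif A (shift t Q)) fset0.
    rewrite /h E big1 => [|i _]; last by rewrite meets0 mulr0.
    by rewrite !mulr_ge0 ?powR_ge0 ?cap_ge0 // ltW.
  apply: le_trans (Hhit _ E) _; rewrite ler_wpM2l //.
  apply: le_trans (H2 _ _ _ t Adiam (fun x n => Qreg Q x n HQ)) _.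
  by rewrite ler_wpM2r ?cap_ge0 // ler_wpM2l ?Qcard // ltW.
apply: (@le_trans _ _ (C1 * L `^ g * (p * (C2 * (C1 * L `^ (d%:R - g)) * Cap e A)))).
  rewrite ler_wpM2l ?mulr_ge0 ?powR_ge0 ?(ltW C10) //.
  by rewrite -[leRHS](avg_cst _ Qs0); apply: le_avg.
rewrite side_split -/L le_eqVlt; apply/orP; left; apply/eqP.
transitivity ((L `^ g * L `^ (- g)) * (C1 * C2 * C1 * p * L ^+ d * Cap e A)); first by ring.
by rewrite powR_mulN // mul1r.
Qed.

Lemma card_dbox m : #|` @dbox d m| = (2 ^ m)%N.
Proof.
elim: m => [|m IH]; first by rewrite /= cardfs1.
by rewrite -[dbox m.+1]/(glue m (dbox m) (dbox m)) card_glue // IH expnS; lia.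
Qed.

Lemma card_ind m Q : (Q `<=` dbox m)%fset -> #|` Q|%:R = \sum_(x <- dbox m) ind x Q :> R.
Proof.
move=> HQ; rewrite (@eq_bigr _ _ _ _ _ _ (fun x => ind x Q) (fun x => if x \in Q then 1 else 0)); last first.
  by move=> x _; rewrite /ind; case: (_ \in _).
rewrite -big_mkcond big_fset_condE /= big_const_seq count_predT iter_addr_0.
congr (_%:R); apply/esym; congr (size _); congr enum_fset.
apply/fsetP => x; rewrite !inE; apply: andb_idl => xQ; exact: (fsubsetP HQ).
Qed.

(** The percolation set spreads charges with small mean energy, by its
    two-point function and the composition of the two kernels. *)
Lemma avg_cap_dif : exists2 C : R, 0 < C & forall N A t (Qs : seq {fset lattice d}) (D : R),
  (0 < size Qs)%N -> inbox (d * N) Qs -> 0 < D ->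
  (forall x, x \in dbox (d * N) -> (2 ^ N)%N%:R `^ (- g) <= avg Qs (ind x) :> R) ->
  (forall x y, x \in dbox (d * N) -> y \in dbox (d * N) ->
      avg Qs (fun Q => ind x Q * ind y Q) <= D * (2 ^ N)%N%:R `^ (- g) * kern g (x - y)) ->
  (2 ^ N)%N%:R `^ (d%:R - g) * Cap e A <=
    C * D * avg Qs (fun Q => Cap al (fsetdif A (shift t Q))).
Proof.
have gd' : 0 <= g < d%:R by rewrite ltW.
have ald' : 0 <= al < d%:R by rewrite ltW.
have gal : d%:R < g + al by rewrite addrC.
have [C1 C10 H1] := @conv_bpow R d _ _ gd' ald' gal.
exists (C1 * d%:R `^ e); first by rewrite mulr_gt0 ?powR_gt0 // ltr0n.
move=> N A t Qs D Qs0 Qin D0 P1 P2.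
set L := (2 ^ N)%N%:R; have L0 : 0 < L :> R by exact: side_gt0.
set a := avg Qs _.
have a0 : 0 <= a by apply: avg_ge0 => Q _; exact: cap_ge0.
have [->|A0] := eqVneq A fset0.
  rewrite cap0 mulr0; apply: mulr_ge0 => //.
  by rewrite !mulr_ge0 ?powR_ge0 ?(ltW C10) ?(ltW D0).
have [mu muP mumin] := exists_minimizer e A0; have [mu0 mu1] := muP.
have E0 := energy_gt0 e muP; rewrite (capE muP mumin).
pose r Q := [seq (x, q) | x <- A, q <- Q].
pose z (i : lattice d * lattice d) := i.1 - (t + i.2).
pose Y Q := \sum_(i <- r Q) \sum_(j <- r Q) mu i.1 * mu j.1 * kern al (z i - z j).
pose K x y (q q' : lattice d) := mu x * mu y * kern al (x - y - (q - q')).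
have YE Q : Q \in Qs -> Y Q = \sum_(q <- dbox (d * N)) \sum_(q' <- dbox (d * N))
    (ind q Q * ind q' Q) * \sum_(x <- A) \sum_(y <- A) K x y q q'.
  move=> HQ; have /fsubsetP QB := Qin _ HQ.
  have sumQ (F : lattice d -> R) : \sum_(q <- Q) F q = \sum_(q <- dbox (d * N)) ind q Q * F q.
    transitivity (\sum_(q <- dbox (d * N)) if q \in Q then F q else 0).
      rewrite -big_mkcond [RHS]big_fset_condE /=; congr (\sum_(q <- enum_fset _) _).
      by apply/fsetP => x; rewrite !inE andb_idl // => /QB.
    by apply: eq_bigr => q _; rewrite /ind; case: (_ \in _); rewrite ?mul1r ?mul0r.
  rewrite /Y sum_pairs.
  under eq_bigr => x _ do under eq_bigr => q _ do rewrite sum_pairs.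
  rewrite exchange_big sumQ; apply: eq_bigr => q _.
  transitivity (ind q Q * \sum_(x <- A) \sum_(q' <- Q) \sum_(y <- A) K x y q q').
    apply: (congr1 (fun v => ind q Q * v)).
    apply: eq_bigr => x _.
    rewrite [LHS]exchange_big /=.
    apply: eq_bigr => q' _.
    by apply: eq_bigr => y _; rewrite /K /z /= sub_shift.
  rewrite exchange_big sumQ mulr_sumr; apply: eq_bigr => q' _.
  by rewrite mulrA.
have K0 x y q q' : x \in A -> y \in A -> 0 <= K x y q q'.
  by move=> xA yA; rewrite !mulr_ge0 ?mu0 // ltW ?kern_gt0.
have Y0 Q : Q \in Qs -> 0 <= Y Q.
  move=> HQ; rewrite YE // sumr_ge0 // => q _; rewrite sumr_ge0 // => q' _.
  apply: mulr_ge0; first by apply: mulr_ge0; exact: ler0n.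
  rewrite big_seq; apply: sumr_ge0 => x xA.
  by rewrite big_seq sumr_ge0 // => y yA; exact: K0.
have charge Q : #|` Q|%:R ^+ 2 <= Cap al (fsetdif A (shift t Q)) * Y Q.
  have rP i : i \in r Q -> i.1 \in A /\ i.2 \in Q.
    by move/allpairsP => [[x q] /= [xA qQ ->]].
  have := @cap_ge_charges R d al (fsetdif A (shift t Q)) _ (r Q) (fun i => mu i.1) z (ltW al0).
  have -> : \sum_(i <- r Q) mu i.1 = #|` Q|%:R.
    rewrite sum_pairs /=.
    under eq_bigr do rewrite big_const_seq count_predT iter_addr_0 -mulr_natr.
    by rewrite -mulr_suml mu1 mul1r.
  apply=> i /rP[i1 i2]; first exact: mu0.
  by apply: mem_fsetdif; rewrite // mem_shift addrC addKr.
have YF Q : Q \in Qs -> Y Q = 0 -> #|` Q|%:R = 0 :> R.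
  move=> HQ Y00; apply/eqP; have := charge Q; rewrite Y00 mulr0 => H.
  by rewrite -sqrf_eq0; apply/eqP/le_anti; rewrite H sqr_ge0.
have := avg_CS Y0 YF => CS.
have EQ : L `^ (d%:R - g) <= avg Qs (fun Q => #|` Q|%:R).
  rewrite (@eq_avg _ _ _ _ (fun Q => \sum_(x <- dbox (d * N)) ind x Q)); last first.
    by move=> Q HQ; rewrite (card_ind (Qin _ HQ)).
  rewrite avg_sum side_split -/L.
  have -> : L ^+ d * L `^ (- g) = \sum_(x <- @dbox d (d * N)) L `^ (- g).
    rewrite big_const_seq count_predT iter_addr_0 -[RHS]mulr_natl card_dbox.
    by rewrite natrX side_exp.
  by rewrite big_seq [leRHS]big_seq; apply: ler_sum => x; exact: P1.
have EY : avg Qs Y <= C1 * d%:R `^ e * D * L `^ (d%:R - g) * energy e A mu.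
  rewrite (eq_avg YE) avg_sum.
  apply: (@le_trans _ _ (\sum_(q <- dbox (d * N)) \sum_(q' <- dbox (d * N))
      (D * L `^ (- g) * kern g (q - q')) * \sum_(x <- A) \sum_(y <- A) K x y q q')).
    rewrite big_seq [leRHS]big_seq; apply: ler_sum => q qB.
    rewrite avg_sum big_seq [leRHS]big_seq; apply: ler_sum => q' q'B.
    rewrite avgMr; apply: ler_wpM2r; last exact: P2.
    by rewrite big_seq sumr_ge0 // => x xA; rewrite big_seq sumr_ge0 // => y yA; exact: K0.
  have -> : C1 * d%:R `^ e * D * L `^ (d%:R - g) * energy e A mu =
     \sum_(q <- @dbox d (d * N)) D * L `^ (- g) * (C1 * d%:R `^ e * energy e A mu).
    rewrite big_const_seq count_predT iter_addr_0 -[RHS]mulr_natl card_dbox.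
    by rewrite natrX side_exp side_split; ring.
  apply: ler_sum => q _; under eq_bigr do rewrite -mulrA; rewrite -mulr_sumr.
  rewrite ler_wpM2l ?mulr_ge0 ?powR_ge0 ?(ltW D0) //.
  under eq_bigr do rewrite mulr_sumr; rewrite exchange_big /energy mulr_sumr /=.
  rewrite big_seq [leRHS]big_seq; apply: ler_sum => x xA.
  under eq_bigr do rewrite mulr_sumr; rewrite exchange_big mulr_sumr /=.
  rewrite big_seq [leRHS]big_seq; apply: ler_sum => y yA.
  rewrite /K; under eq_bigr do rewrite mulrCA; rewrite -mulr_sumr.
  rewrite [leRHS]mulrCA ler_wpM2l ?mulr_ge0 ?mu0 //.
  have inj : injective (fun q' : lattice d => q - q') by move=> u v /addrI/oppr_inj.
  apply: (@le_trans _ _ (\sum_(u <- [fset q - q' | q' in dbox (d * N)]%fset) 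
      bpow g u * bpow al (x - y - u))).
    rewrite sum_imfset //; apply: ler_sum => q' _.
    by apply: ler_pM; rewrite ?kern_le_bpow ?(ltW al0) ?(ltW g0) // ltW ?kern_gt0.
  apply: le_trans (H1 _ _) _; rewrite -mulrA ler_wpM2l ?(ltW C10) //.
  by rewrite (addrC g) bpow_le_kern // ltW.
have ELd : 0 < L `^ (d%:R - g) by rewrite powR_gt0.
rewrite -(ler_pM2l ELd) mulrA -expr2 ler_pdivrMr //.
apply: (@le_trans _ _ (avg Qs (fun Q => #|` Q|%:R) ^+ 2)).
  by rewrite lerXn2r ?nnegrE ?(ltW ELd) // (le_trans (ltW ELd)).
apply: le_trans CS _.
apply: (@le_trans _ _ (a * (C1 * d%:R `^ e * D * L `^ (d%:R - g) * energy e A mu))); last first.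
  by rewrite le_eqVlt; apply/orP; left; apply/eqP; ring.
apply: ler_pM => //.
- by apply: avg_ge0 => Q HQ; rewrite divr_ge0 ?sqr_ge0 ?Y0.
- exact: avg_ge0.
apply: le_avg => Q HQ; have [->|Yn] := eqVneq (Y Q) 0.
  by rewrite invr0 mulr0 cap_ge0.
by rewrite ler_pdivrMr ?charge // lt_def Yn Y0.
Qed.

(** The reverse of [cap_dif_le], with percolation as the surrogate. *)
Lemma cap_dif_ge : exists2 C : R, 0 < C &
  forall N A t (I : eqType) (r : seq I) (w : I -> R) (S : I -> {fset lattice d}) (p : R),
  (forall i, i \in r -> 0 <= w i) -> 0 <= p ->
  (forall B, B != fset0 -> (B `<=` fsetdif A (shift t (dbox (d * N))))%fset ->
     p * Cap al B <= \sum_(i <- r) w i * (meets (S i) B)%:R) ->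
  p * (2 ^ N)%N%:R ^+ d * Cap e A <=
    C * \sum_(i <- r) w i * Cap g (fsetdif A (S i) `&` shift t (dbox (d * N)))%fset.
Proof.
have [C1 C10 H1] := surrogate_percolation d0 g0 gd.
have [C2 C20 H2] := avg_cap_dif.
exists (C2 * C1 * C1); first by rewrite !mulr_gt0.
move=> N A t I r w S p w0 p0 Hhit.
have [Qs [Qs0 Qin Qhit P1 P2]] := H1 N.
set L := (2 ^ N)%N%:R; have L0 : 0 < L :> R by exact: side_gt0.
pose h Q := \sum_(i <- r) w i * (meets (S i) (fsetdif A (shift t Q)))%:R.
set W := \sum_(i <- r) _.
have hW : avg Qs h <= C1 * L `^ (- g) * W.
  rewrite avg_sum mulr_sumr big_seq [leRHS]big_seq; apply: ler_sum => i ir.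
  rewrite avgMl [leRHS]mulrCA ler_wpM2l ?w0 //.
  rewrite -(cap_translate _ (- t) (ltW g0)); apply: le_trans (Qhit _ _); last first.
    apply/fsubsetP => x; rewrite mem_shift opprK inE => /andP[_].
    by rewrite mem_shift addrK.
  apply: le_avg => Q HQ; rewrite -meets_swap.
  case: (boolP (meets Q (shift (- t) (fsetdif A (S i))))) => [|_]; last exact: ler0n.
  move=> /meetsP[x xQ]; rewrite mem_shift opprK => xA.
  suff -> : meets Q (shift (- t) (fsetdif A (S i) `&` shift t (dbox (d * N)))%fset) by [].
  apply/meetsP; exists x => //; rewrite mem_shift opprK inE xA mem_shift addrK.
  exact: (fsubsetP (Qin _ HQ)).
have hp : p * avg Qs (fun Q => Cap al (fsetdif A (shift t Q))) <= avg Qs h.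
  rewrite -avgMl; apply: le_avg => Q HQ.
  have [->|E] := eqVneq (fsetdif A (shift t Q)) fset0.
    by rewrite cap0 mulr0 /h big_seq sumr_ge0 // => i ir; rewrite mulr_ge0 ?w0.
  apply: Hhit => //; apply/fsubsetP => x /fsetdifP[a [b aA [bQ ->]]].
  apply: mem_fsetdif => //; rewrite mem_shift in bQ; rewrite mem_shift.
  exact: (fsubsetP (Qin _ HQ)).
have := H2 N A t Qs C1 Qs0 Qin C10 P1 P2; rewrite side_split -/L => H.
have Lg : 0 < L `^ (- g) by rewrite powR_gt0.
rewrite -(ler_pM2l Lg).
apply: (@le_trans _ _ (p * (C2 * C1 * avg Qs (fun Q => Cap al (fsetdif A (shift t Q)))))).
  have -> : L `^ (- g) * (p * L ^+ d * Cap e A) = p * (L ^+ d * L `^ (- g) * Cap e A) by ring.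
  by rewrite ler_wpM2l.
apply: (@le_trans _ _ (C2 * C1 * (C1 * L `^ (- g) * W))); last first.
  by rewrite le_eqVlt; apply/orP; left; apply/eqP; ring.
rewrite mulrCA ler_wpM2l ?(le_trans hp) //.
by rewrite mulr_ge0 // ltW.
Qed.

End CapDif.

(** * Hitting probabilities of sums, one summand at a time *)

Section HitSum.
Context {R : realType} {d : nat} {I : eqType}.
Variable D : {fset lattice d}.
Variable w : I -> {fset lattice d} -> R.
Hypothesis w0 : forall i V, 0 <= w i V.
Implicit Types (A B V : {fset lattice d}) (s : seq I).

Definition hit1 (i : I) B : R := \sum_(V <- fpowerset D) w i V * (meets V B)%:R.

(** The probability that a sum of independent random subsets of [D] hits [B],
    the [i]-th one having law [w i], computed by revealing them in turn. *)
Fixpoint hitsum s B : R :=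
  if s is i :: s' then \sum_(V <- fpowerset D) w i V * hitsum s' (fsetdif B V)
  else (0 \in B)%:R.

Lemma hit1_ge0 i B : 0 <= hit1 i B.
Proof. by rewrite sumr_ge0 // => V _; rewrite mulr_ge0 ?ler0n. Qed.

Lemma hitsum_ge0 s B : 0 <= hitsum s B.
Proof.
elim: s B => [|i s IH] B /=; first exact: ler0n.
by rewrite sumr_ge0 // => V _; rewrite mulr_ge0.
Qed.

Lemma fsetdif0 V : fsetdif fset0 V = fset0.
Proof. by apply/fsetP => x; rewrite inE; apply/fsetdifP => -[a [b]]; rewrite inE. Qed.

Lemma fsetdif_subl A B V : (A `<=` B)%fset -> (fsetdif A V `<=` fsetdif B V)%fset.
Proof.
move=> /fsubsetP AB; apply/fsubsetP => x /fsetdifP[a [v aA [vV ->]]].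
by rewrite mem_fsetdif ?AB.
Qed.

Lemma hitsum0 s : hitsum s fset0 = 0.
Proof.
elim: s => [|i s IH] /=; first by [].
by rewrite big1 // => V _; rewrite fsetdif0 IH mulr0.
Qed.

Lemma le_hitsum s A B : (A `<=` B)%fset -> hitsum s A <= hitsum s B.
Proof.
elim: s A B => [|i s IH] A B AB /=.
  by rewrite ler_nat; case: (boolP (0 \in A)) => // /(fsubsetP AB) ->.
by apply: ler_sum => V _; rewrite ler_wpM2l // IH // fsetdif_subl.
Qed.

Lemma hitsum1 i B : hitsum [:: i] B = hit1 i B.
Proof.
apply: eq_bigr => V _; congr (_ * _%:R); congr nat_of_bool.
apply/fsetdifP/meetsP => [[a [v aB [vV /esym/eqP]]]|[x xV xB]].
  by rewrite subr_eq0 => /eqP E; exists v; rewrite // -E.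
by exists x, x => //; rewrite subrr.
Qed.

(** Fractional subadditivity: averaging over a cover of multiplicity [m]
    avoids any choice of a tiling. *)
Lemma hitsum_cover s B (Y : {fset lattice d}) (By : lattice d -> {fset lattice d}) (m : R) :
  (forall b, b \in B -> m <= \sum_(y <- Y) (b \in By y)%:R) ->
  m * hitsum s B <= \sum_(y <- Y) hitsum s (By y).
Proof.
elim: s B By => [|i s IH] B By H /=.
  case: (boolP (0 \in B)) => [/H|_]; first by rewrite mulr1.
  by rewrite mulr0 sumr_ge0.
rewrite exchange_big /= mulr_sumr; apply: ler_sum => V _.
rewrite mulrCA -mulr_sumr; apply: ler_wpM2l => //; apply: IH => _ /fsetdifP[a [v aB [vV ->]]].
apply: le_trans (H _ aB) _; apply: ler_sum => y _; rewrite ler_nat.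
by case: (boolP (a \in By y)) => // aBy; rewrite mem_fsetdif.
Qed.

End HitSum.

(** * Distance profiles *)

Section Profiles.
Context {R : realType} {d : nat}.
Implicit Types (u y : lattice d).

(** A power of the distance, up to a term that is negligible far away; the
    second coefficient absorbs all that happens near the origin. *)
Definition profile (de b M : R) u : R := bpow b u + M * bpow (b + de) u.

Lemma profile_ge0 de b M u : 0 <= M -> 0 <= profile de b M u.
Proof. by move=> M0; rewrite addr_ge0 ?mulr_ge0 ?bpow_ge0. Qed.

Lemma bpow_anti (b c : R) u : b <= c -> bpow c u <= bpow b u.
Proof. by move=> bc; rewrite ler_powR ?lerN2 // ler1n bracket_gt0. Qed.

(** Profiles are closed under convolution: the mixed terms of the product have
    an exponent larger by at least [de]. *)
Lemma conv_profile (de b c : R) : 0 <= de -> 0 <= b -> 0 <= c ->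
  b + de < d%:R -> c + de < d%:R -> d%:R < b + c ->
  exists2 K : R, 0 < K & forall (Y : {fset lattice d}) M M' u, 0 <= M -> 0 <= M' ->
    \sum_(y <- Y) profile de b M y * profile de c M' (u - y) <=
      K * profile de (b + c - d%:R) (M + M' + M * M') u.
Proof.
move=> de0 b0 c0 bd cd bc.
have [||K1 K10 H1] := @conv_bpow R d b c _ _ bc; [lra|lra|].
have [|||K2 K20 H2] := @conv_bpow R d (b + de) c; [lra|lra|lra|].
have [|||K3 K30 H3] := @conv_bpow R d b (c + de); [lra|lra|lra|].
have [|||K4 K40 H4] := @conv_bpow R d (b + de) (c + de); [lra|lra|lra|].
exists (K1 + K2 + K3 + K4); first by rewrite !addr_gt0.
move=> Y M M' u M0 M'0.
set e := b + c - d%:R; set B1 := bpow e u; set B2 := bpow (e + de) u.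
have B10 : 0 <= B1 by exact: bpow_ge0.
have B20 : 0 <= B2 by exact: bpow_ge0.
have {}H2 : \sum_(y <- Y) bpow (b + de) y * bpow c (u - y) <= K2 * B2.
  by apply: le_trans (H2 Y u) _; rewrite (_ : b + de + c - d%:R = e + de) // /e; ring.
have {}H3 : \sum_(y <- Y) bpow b y * bpow (c + de) (u - y) <= K3 * B2.
  by apply: le_trans (H3 Y u) _; rewrite (_ : b + (c + de) - d%:R = e + de) // /e; ring.
have {}H4 : \sum_(y <- Y) bpow (b + de) y * bpow (c + de) (u - y) <= K4 * B2.
  apply: le_trans (H4 Y u) _; rewrite ler_pM2l //; apply: bpow_anti; rewrite /e; lra.
have {}H1 := H1 Y u.
apply: (@le_trans _ _ (K1 * B1 + M * (K2 * B2) + M' * (K3 * B2) + M * M' * (K4 * B2))).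
  have -> : \sum_(y <- Y) profile de b M y * profile de c M' (u - y) =
    \sum_(y <- Y) bpow b y * bpow c (u - y) + M * (\sum_(y <- Y) bpow (b + de) y * bpow c (u - y))
    + M' * (\sum_(y <- Y) bpow b y * bpow (c + de) (u - y))
    + M * M' * (\sum_(y <- Y) bpow (b + de) y * bpow (c + de) (u - y)).
    rewrite !mulr_sumr -!big_split /=; apply: eq_bigr => y _; rewrite /profile; ring.
  by rewrite !lerD // ler_wpM2l // mulr_ge0.
rewrite /profile -/B1 -/B2; set T := K1 + K2 + K3 + K4.
have T1 : K1 <= T by rewrite /T; lra.
have T2 : K2 <= T by rewrite /T; lra.
have T3 : K3 <= T by rewrite /T; lra.
have T4 : K4 <= T by rewrite /T; lra.
have mon k m : 0 <= m -> k <= T -> m * (k * B2) <= T * (m * B2).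
  by move=> m0 kT; rewrite mulrCA ler_wpM2r ?mulr_ge0.
have -> : T * (B1 + (M + M' + M * M') * B2) =
    T * B1 + T * (M * B2) + T * (M' * B2) + T * (M * M' * B2) by ring.
rewrite !lerD ?mon //; first by rewrite ler_wpM2r.
exact: mulr_ge0.
Qed.

End Profiles.

(** * Exponents of partial sums *)

Section Exponents.
Context {R : realType} {I : Type}.
Variable d : nat.
Implicit Types (f : I -> R) (s : seq I).

(** The exponent, of the capacity or of the distance, that belongs to the sum of
    the sets indexed by [s]. *)
Definition excess f s : R := \sum_(i <- s) f i - ((size s)%:R - 1) * d%:R.

Lemma excess1 f i : excess f [:: i] = f i.
Proof. by rewrite /excess big_seq1 /= subrr mul0r subr0. Qed.

Lemma excess_cons f i s : excess f (i :: s) = f i + excess f s - d%:R.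
Proof. by rewrite /excess big_cons /= -natr1; ring. Qed.

Lemma excess_lt f s (c : R) : c <= d%:R -> (forall i, f i < c) -> (0 < size s)%N -> excess f s < c.
Proof.
move=> cd fc; elim: s => // i [|j s] IH _; first by rewrite excess1.
by rewrite excess_cons; have := IH isT; have := fc i; lra.
Qed.

End Exponents.

(** * Localization in balls *)

Section Windows.
Context {R : realType} {d : nat}.
Hypothesis d0 : (0 < d)%N.
Implicit Types (A B V : {fset lattice d}) (u y : lattice d).

Definition corner (n : nat) : lattice d := \row_j (- n%:Z).

Lemma cube_sub_dbox n N A : (2 * n < 2 ^ N)%N -> (forall a, a \in A -> (snorm a <= n)%N) ->
  (A `<=` shift (corner n) (dbox (d * N)))%fset.
Proof.
move=> nN HA; apply/fsubsetP => a aA; rewrite mem_shift; apply/(dboxP d0) => j.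
rewrite rowBE mxE /dexp mulKn // modnMr ltn0 addn0.
have := leq_coord a j; have := HA a aA.
by move: (snorm a) (a _ _) (2 ^ N)%N nN => m z p; clear; lia.
Qed.

Lemma snorm_dbox_le N x : x \in @dbox d (d * N) -> (snorm x <= 2 ^ N)%N.
Proof.
move=> /(dboxP d0) H; apply/snormP => j; have := H j.
rewrite /dexp mulKn // modnMr ltn0 addn0.
by move: (x _ _) (2 ^ N)%N => z p; clear; lia.
Qed.

(** The law of the trace of a random set on the ball of radius [l] around
    [y], recentred at the origin. *)
Definition window l y V : {fset lattice d} :=
  shift (- y) [fset v in V | (snorm (v - y) <= l)%N]%fset.

Lemma mem_window l y V x : (x \in window l y V) = (x + y \in V) && (snorm x <= l)%N.
Proof. by rewrite mem_shift opprK !inE /= addrK. Qed.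

(** The balls of radius [l] cover each point as often as they have points. *)
Lemma cover_count l (D : {fset lattice d}) v : v \in D ->
  ((2 * l).+1 ^ d)%N%:R <= \sum_(y <- fsetdif D (cube l)) (snorm (v - y) <= l)%N%:R :> R.
Proof.
move=> vD; have inj : injective (fun c : lattice d => v - c) by move=> a b /addrI/oppr_inj.
apply: (@le_trans _ _ (\sum_(y <- [fset v - c | c in @cube d l]%fset) (snorm (v - y) <= l)%N%:R)).
  rewrite sum_imfset // big_seq (eq_bigr (fun=> 1)); last first.
    by move=> c; rewrite cubeP subKr => ->.
  by rewrite -big_seq big_const_seq count_predT iter_addr_0 card_cube.
have sub : ([fset (v - c)%R | c in @cube d l] `<=` fsetdif D (cube l))%fset.
  by apply/fsubsetP => _ /imfsetP[c /= cl ->]; exact: mem_fsetdif.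
rewrite (big_fset_incl _ sub) // => y _ yN; case: (boolP (_ <= l)%N) => // vy.
by move/imfsetP: yN => []; exists (v - y); rewrite /= ?cubeP ?subKr.
Qed.

End Windows.

(** * Bounds for the sum of independent sets *)

Section Bounds.
Context {R : realType} {d : nat} {I : eqType}.
Hypothesis d0 : (0 < d)%N.
Variables al be : I -> R.
Hypothesis al0 : forall i, 0 < al i.
Hypothesis ald : forall i, al i < d%:R.
Implicit Types (A B V D : {fset lattice d}) (s : seq I) (u y : lattice d).

Let gam s : R := excess d al s.
Let bet s : R := excess d be s.

Let gam_lt s : (0 < size s)%N -> gam s < d%:R.
Proof. exact: excess_lt. Qed.

Section Upper.
Variable de : R.
Hypothesis de0 : 0 < de.
Hypothesis be0 : forall i, 0 < be i.
Hypothesis bed : forall i, be i + de < d%:R.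

Let bet_lt s : (0 < size s)%N -> bet s + de < d%:R.
Proof.
move=> s0; rewrite -ltrBrDr; have dd : d%:R - de <= d%:R by rewrite gerBl ltW.
by apply: (excess_lt dd) => // i; rewrite ltrBrDr.
Qed.

(** Upper bound for the sum. Each new summand is localized in balls of the
    size of the target, [cap_dif_le] is applied in each ball, and summing over
    the centres of the balls convolves the two distance profiles. *)
Lemma hitsum_le s (ka : nat) : (0 < size s)%N -> 0 < gam s -> 0 < bet s ->
  exists2 C : R, 0 < C & forall M1, 0 <= M1 -> exists2 M : R, 0 <= M &
  forall l (C0 : R) D (w : I -> {fset lattice d} -> R), 0 < C0 -> (forall i V, 0 <= w i V) ->
  (forall i u B, B != fset0 -> (forall b, b \in B -> (snorm (b - u) <= ka * 2 ^ l)%N) ->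
     hit1 D w i B <= C0 * profile de (be i) M1 u * Cap (al i) B) ->
  forall A m u, (forall a, a \in A -> (snorm a <= m * 2 ^ l)%N) -> (m + size s <= ka)%N ->
  hitsum D w s (shift u A) <= C * C0 ^+ size s * profile de (bet s) M u * Cap (gam s) A.
Proof.
case: s => // i s _; elim: s i => [|j s IH] i gs0 bs0.
  exists 1 => // M1 M10; exists M1 => // l C0 D w C00 w0 HU A m u Am mk.
  rewrite hitsum1 expr1 mul1r /bet /gam !excess1.
  have [->|A0] := eqVneq A fset0.
    rewrite cap0 mulr0 (_ : shift u fset0 = fset0) -?(hitsum1 D w) ?hitsum0 //.
    by apply/fsetP => x; rewrite mem_shift !in_fset0.
  rewrite -(cap_translate A u (ltW (al0 i))); apply: HU.
    by rewrite -cardfs_gt0 card_shift cardfs_gt0.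
  move=> b; rewrite mem_shift => /Am bm; apply: leq_trans bm _.
  by rewrite leq_mul2r; move: mk; rewrite /=; lia.
pose s' := j :: s; rewrite -/s' in gs0 bs0 *.
have ge : gam (i :: s') = al i + gam s' - d%:R by exact: excess_cons.
have bte : bet (i :: s') = be i + bet s' - d%:R by exact: excess_cons.
have g1 : 0 < gam s' by have := ald i; lra.
have b1 : 0 < bet s' by have := bed i; have := de0; lra.
have gd1 : gam s' < d%:R by exact: gam_lt.
have bd1 : bet s' + de < d%:R by exact: bet_lt.
have [C1 C10 H1] := IH j g1 b1.
have agd : d%:R < al i + gam s' by lra.
have bbd : d%:R < be i + bet s' by lra.
have [CU CU0 HCU] := cap_dif_le d0 (al0 i) g1 gd1 agd.
have [K K0 HK] := @conv_profile R d de (be i) (bet s') (ltW de0) (ltW (be0 i)) (ltW b1) (bed i) bd1 bbd.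
(* boxes of side [2 ^ (l + ka')] contain all the sets met in the recursion *)
pose ka' := (2 * ka).+1.
exists (C1 * CU * K * (2 ^ ka')%N%:R ^+ d).
  by rewrite !mulr_gt0 // exprn_gt0 // ltr0n expn_gt0.
move=> M1 M10; have [M2 M20 {}H1] := H1 M1 M10.
exists (M1 + M2 + M1 * M2); first by rewrite !addr_ge0 ?mulr_ge0.
move=> l C0 D w C00 w0 HU A m u Am mk.
have {}H1 := H1 l C0 D w C00 w0 HU.
set L := (2 ^ l)%N.
have L0 : (0 < L)%N by rewrite expn_gt0.
pose Y := fsetdif D (cube L).
pose mult : R := ((2 * L).+1 ^ d)%N%:R.
have mult0 : 0 < mult by rewrite ltr0n expn_gt0.
pose F1 := @profile R d de (be i) M1; pose F2 := @profile R d de (bet s') M2.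
have F10 y : 0 <= F1 y by exact: profile_ge0.
have F20 y : 0 <= F2 y by exact: profile_ge0.
have mka : (m + 1 <= ka)%N by move: mk; rewrite /=; clear; lia.
have kaL : (2 * (ka * L) < 2 ^ (l + ka'))%N.
  rewrite mulnA expnD [(2 ^ l * _)%N]mulnC -/L ltn_mul2r L0 /=.
  by apply: ltn_trans (ltn_expl _ (isT : (1 < 2)%N)) _; rewrite ltn_exp2l.
have mL : ((m + 1) * L <= ka * L)%N by rewrite leq_mul2r mka orbT.
(* recentring the part of [A - V] that comes from the ball around [y] *)
have recentre V y : fsetdif (shift u A) [fset v in V | (snorm (v - y) <= L)%N]%fset
    = shift (u - y) (fsetdif A (window L y V)).
  apply/fsetP => x; rewrite mem_shift; apply/fsetdifP/fsetdifP => -[a [v]].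
    rewrite mem_shift !inE /= => aA [/andP[vV vL] ->].
    exists (a - u), (v - y) => //; split; first by rewrite mem_window subrK vV.
    by apply/rowP => k; rewrite !mxE; ring.
  rewrite mem_window => aA [/andP[vV vL] E].
  exists (u + a), (v + y); first by rewrite mem_shift addrC addKr.
  split; first by rewrite !inE /= vV addrK.
  by rewrite -[x](subrK (u - y)) E; apply/rowP => k; rewrite !mxE; ring.
have local y : \sum_(V <- fpowerset D) w i V *
      hitsum D w s' (shift (u - y) (fsetdif A (window L y V))) <=
    C1 * C0 ^+ size s' * F2 (u - y) *
      (CU * (C0 * F1 y) * (2 ^ (l + ka'))%N%:R ^+ d * Cap (gam (i :: s')) A).
  apply: (@le_trans _ _ (C1 * C0 ^+ size s' * F2 (u - y) *
      \sum_(V <- fpowerset D) w i V * Cap (gam s') (fsetdif A (window L y V)))).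
    rewrite mulr_sumr; apply: ler_sum => V _; rewrite [leRHS]mulrCA ler_wpM2l //.
    apply: (H1 _ (m + 1)%N); last by move: mk; rewrite /=; clear; lia.
    move=> _ /fsetdifP[a [v aA [+ ->]]]; rewrite mem_window => /andP[_ vL].
    apply: leq_trans (snormB _ _) _; rewrite mulnDl mul1n leq_add //; exact: Am.
  apply: ler_wpM2l; first by rewrite !mulr_ge0 ?exprn_ge0 ?(ltW C10) ?(ltW C00).
  rewrite ge; apply: (HCU (l + ka')%N A (corner (ka * L))) => //.
  - by rewrite mulr_ge0 // ltW.
  - move=> a b aA bA; apply: leq_trans (snormB _ _) _.
    have := Am _ aA; have := Am _ bA; move: mL kaL; rewrite -/L mulnDl.
    by move: (snorm a) (snorm b) (m * L)%N (ka * L)%N (2 ^ _)%N; clear; lia.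
  - move=> V _; apply: cube_sub_dbox => // _ /fsetdifP[a [v aA [+ ->]]].
    rewrite mem_window => /andP[_ vL]; apply: leq_trans (snormB _ _) _.
    apply: leq_trans mL; rewrite mulnDl mul1n leq_add //; exact: Am.
  move=> B B0; pose B' := [fset b in shift y B | (snorm (b - y) <= L)%N]%fset.
  apply: (@le_trans _ _ (hit1 D w i B')).
    apply: ler_sum => V _; rewrite ler_wpM2l // ler_nat.
    case: (boolP (meets (window L y V) B)) => // /meetsP[x].
    rewrite mem_window => /andP[xV xL] xB; rewrite lt0b; apply/meetsP; exists (x + y) => //.
    by rewrite !inE /= mem_shift addrK xB.
  have [->|B'0] := eqVneq B' fset0.
    by rewrite -hitsum1 hitsum0 !mulr_ge0 ?cap_ge0 // ltW.
  apply: le_trans (HU i y B' B'0 _) _.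
    move=> b; rewrite !inE /= => /andP[_ bL]; apply: leq_trans bL _.
    by rewrite -/L leq_pmull //; move: mka; clear; lia.
  rewrite ler_wpM2l ?mulr_ge0 ?(ltW C00) // -(cap_translate B y (ltW (al0 i))).
  by apply: cap_mono; [exact: ltW|apply/fsubsetP => b; rewrite !inE => /andP[]].
have cover : mult * hitsum D w (i :: s') (shift u A) <=
   \sum_(y <- Y) \sum_(V <- fpowerset D) w i V *
      hitsum D w s' (shift (u - y) (fsetdif A (window L y V))).
  rewrite exchange_big /= mulr_sumr big_seq [leRHS]big_seq; apply: ler_sum => V.
  rewrite fpowersetE => /fsubsetP VD; rewrite mulrCA -mulr_sumr ler_wpM2l //.
  under [leRHS]eq_bigr do rewrite -recentre.
  apply: (@hitsum_cover R d I D w w0 s' (fsetdif (shift u A) V) Y (fun y =>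
    fsetdif (shift u A) [fset v in V | (snorm (v - y) <= L)%N]%fset)) => _ /fsetdifP[a [v aA [vV ->]]].
  apply: le_trans (cover_count L (VD _ vV)) _; apply: ler_sum => y _; rewrite ler_nat.
  case: (boolP (snorm (v - y)%R <= L)%N) => // vL; rewrite lt0b; apply: mem_fsetdif => //.
  by rewrite !inE /= vV vL.
rewrite -(ler_pM2l mult0); apply: le_trans cover _.
set G := Cap _ A; have G0 : 0 <= G by exact: cap_ge0.
set E := C1 * C0 ^+ size s' * (CU * C0 * (2 ^ (l + ka'))%N%:R ^+ d * G).
have E0 : 0 <= E.
  by rewrite !mulr_ge0 ?exprn_ge0 ?ler0n ?(ltW C10) ?(ltW C00) ?(ltW CU0).
apply: (@le_trans _ _ (E * \sum_(y <- Y) F1 y * F2 (u - y))).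
  rewrite mulr_sumr; apply: ler_sum => y _; apply: le_trans (local y) _.
  by rewrite le_eqVlt; apply/orP; left; apply/eqP; rewrite /E -/G; ring.
apply: le_trans (ler_wpM2l E0 (HK Y M1 M2 u M10 M20)) _.
rewrite -bte; set P := profile _ _ _ _; have P0 : 0 <= P.
  by apply: profile_ge0; rewrite !addr_ge0 ?mulr_ge0.
have Lm : (2 ^ (l + ka'))%N%:R ^+ d <= mult * (2 ^ ka')%N%:R ^+ d.
  rewrite expnD natrM exprMn ler_wpM2r ?exprn_ge0 ?ler0n // -natrX ler_nat.
  by rewrite leq_exp2r // -/L; clear; lia.
rewrite /E.
have -> : C1 * C0 ^+ size s' * (CU * C0 * (2 ^ (l + ka'))%N%:R ^+ d * G) * (K * P) =
   (2 ^ (l + ka'))%N%:R ^+ d * (C1 * CU * K * C0 ^+ size (i :: s') * P * G).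
  by rewrite [size (i :: s')]/= exprS; ring.
apply: le_trans (ler_wpM2r _ Lm) _.
  do 3!apply: mulr_ge0 => //; last by rewrite exprn_ge0 // ltW.
  by rewrite !mulr_ge0 ?(ltW C10) ?(ltW CU0) ?(ltW K0).
by rewrite le_eqVlt; apply/orP; left; apply/eqP; ring.
Qed.

End Upper.

(** Lower bound for the sum: only the contribution of one ball per summand is
    kept, the balls being centred at points [y i] adding up to the target. *)
Lemma hitsum_ge s : (0 < size s)%N -> 0 < gam s ->
  exists2 C : R, 0 < C &
  forall N D (w : I -> {fset lattice d} -> R) (y : I -> lattice d) (p : I -> R),
  (forall i V, 0 <= w i V) -> (forall i, 0 <= p i) ->
  (forall i B, B != fset0 -> (forall b, b \in B -> (snorm (b - y i) <= 2 ^ N.+1)%N) ->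
     p i * Cap (al i) B <= hit1 D w i B) ->
  forall A, (forall a, a \in A -> (snorm (a - \sum_(i <- s) y i)%R <= 2 ^ N)%N) ->
  (\prod_(i <- s) p i) * (2 ^ N)%N%:R ^+ (d * (size s).-1) * Cap (gam s) A
     <= C * hitsum D w s A.
Proof.
case: s => // i s _; elim: s i => [|j s IH] i gs0.
  exists 1 => // N D w y p w0 p0 HL A HA.
  rewrite big_seq1 muln0 expr0 mulr1 mul1r hitsum1 /gam excess1.
  have [->|A0] := eqVneq A fset0; first by rewrite cap0 mulr0 hit1_ge0.
  apply: HL => // b /HA; rewrite big_seq1 => H; apply: leq_trans H _.
  by rewrite leq_exp2l.
pose s' := j :: s; rewrite -/s' in gs0 *.
have ge : gam (i :: s') = al i + gam s' - d%:R by exact: excess_cons.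
have g1 : 0 < gam s' by have := ald i; lra.
have gd1 : gam s' < d%:R by exact: gam_lt.
have agd : d%:R < al i + gam s' by lra.
have [C1 C10 H1] := IH j g1.
have [CL CL0 HCL] := cap_dif_ge d0 (al0 i) (ald i) g1 gd1 agd.
exists (C1 * CL); first exact: mulr_gt0.
move=> N D w y p w0 p0 HL A HA.
have {}H1 := H1 N D w y p w0 p0 HL.
set Ys := \sum_(i <- s') y i in H1.
have HAi a : a \in A -> (snorm (a - (y i + Ys))%R <= 2 ^ N)%N.
  by move/HA; rewrite big_cons.
pose T := shift Ys (@dbox d (d * N)).
have := HCL N A Ys _ (fpowerset D) (w i) id (p i) (fun V _ => w0 i V) (p0 i).
rewrite -/T => /(_ _) H2.
have {H2} : p i * (2 ^ N)%N%:R ^+ d * Cap (al i + gam s' - d%:R) A <=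
    CL * \sum_(V <- fpowerset D) w i V * Cap (gam s') (fsetdif A V `&` T)%fset.
  apply: H2 => B B0 /fsubsetP HB; apply: HL => // b /HB /fsetdifP[a [u aA [uT ->]]].
  rewrite mem_shift in uT; have := snorm_dbox_le d0 uT; have := HAi _ aA.
  have -> : a - u - y i = (a - (y i + Ys)) - (u - Ys) by apply/rowP => k; rewrite !mxE; ring.
  move=> h1 h2; apply: leq_trans (snormB _ _) _; rewrite expnS.
  by move: (snorm _) (snorm _) h1 h2 => k m; clear; lia.
rewrite -ge => H2.
set Pi := \prod_(i <- s') p i in H1 *.
have Pi0 : 0 <= Pi by apply: prodr_ge0.
set L := (2 ^ N)%N%:R in H1 H2 *.
have L0 : 0 <= L by rewrite ler0n.
apply: (@le_trans _ _ (Pi * L ^+ (d * size s) * (CL *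
    \sum_(V <- fpowerset D) w i V * Cap (gam s') (fsetdif A V `&` T)%fset))).
  rewrite big_cons -/Pi [(size _).-1]/= mulnS exprD.
  have -> : p i * Pi * (L ^+ d * L ^+ (d * size s)) * Cap (gam (i :: s')) A =
     Pi * L ^+ (d * size s) * (p i * L ^+ d * Cap (gam (i :: s')) A) by ring.
  by rewrite ler_wpM2l // mulr_ge0 ?exprn_ge0.
rewrite mulrCA [C1 * CL]mulrC -[leRHS]mulrA ler_pM2l //.
rewrite mulr_sumr [hitsum _ _ (i :: s') _]/= mulr_sumr; apply: ler_sum => V _.
rewrite mulrCA [leRHS]mulrCA ler_wpM2l //.
apply: (@le_trans _ _ (C1 * hitsum D w s' (fsetdif A V `&` T)%fset)).
  apply: H1 => x; rewrite inE => /andP[_]; rewrite mem_shift; exact: snorm_dbox_le.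
rewrite ler_pM2l //; apply: (@le_hitsum R d I D w w0 s'); exact: fsubsetIl.
Qed.

End Bounds.

Local Open Scope classical_set_scope.
Local Open Scope ring_scope.

(** * Sums of independent random sets *)

Section FinitePartition.
Context {disp : measure_display} {T : measurableType disp} {R : realType}.
Variable P : probability T R.

(** Total probability over the values of a finitely valued function, with an
    event that may depend on the value. *)
Lemma measure_fin_cases (K : eqType) (r : seq K) (f : T -> K) (A : K -> set T) :
  uniq r -> (forall V, measurable ([set t | f t = V] `&` A V)) ->
  measurable [set t | f t \in r /\ A (f t) t] /\
  P [set t | f t \in r /\ A (f t) t] = (\sum_(V <- r) P ([set t | f t = V] `&` A V))%E.
Proof.
move=> + mA; elim: r => [|V r IH] /=.
  move=> _; rewrite big_nil (_ : [set t | _] = set0) ?measure0; first by split.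
  by rewrite -subset0 => t [].
move=> /andP[Vr ur]; have [m1 e1] := IH ur.
have -> : [set t | f t \in V :: r /\ A (f t) t] =
    ([set t | f t = V] `&` A V) `|` [set t | f t \in r /\ A (f t) t].
  apply/seteqP; split => [t [] /=|t [[] /= ->|[] /= fr]]; rewrite ?inE.
  - by move=> /orP[/eqP <-|fr] At; [left|right].
  - by rewrite eqxx.
  - by rewrite fr orbT.
split; first exact: measurableU.
rewrite big_cons -e1; apply: measureU => //.
by rewrite -subset0 => t [[/= ->] _ []]; rewrite (negbTE Vr).
Qed.

End FinitePartition.

Section SumOfSets.
Context {disp : measure_display} {Omega : measurableType disp} {R : realType} {d : nat}.
Variable P : probability Omega R.
Context {I : finType}.
Variable X : I -> {RV P >-> setspace d}.
Hypothesis indep : mutually_independent X.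
Implicit Types (A B D V : {fset lattice d}) (s : seq I).

Lemma measurable_point (z : lattice d) : measurable [set S : setspace d | (S : set (lattice d)) z].
Proof. by apply: sub_sigma_algebra; exists z. Qed.

Definition trace D (S : set (lattice d)) : {fset lattice d} := [fset z in D | `[< S z >]]%fset.

Lemma mem_trace D (S : set (lattice d)) z : (z \in trace D S) = (z \in D) && `[< S z >].
Proof. by rewrite !inE. Qed.

Lemma measurable_trace D V : measurable [set S : setspace d | trace D S = V].
Proof.
have [VD|VD] := boolP (V `<=` D)%fset; last first.
  rewrite (_ : [set S | _] = set0) // -subset0 => S /= E; move: VD; rewrite -E.
  by case/negP; apply/fsubsetP => z; rewrite mem_trace => /andP[].
have -> : [set S : setspace d | trace D S = V] =
    \bigcap_(z in [set` D]) (if z \in V then [set S : setspace d | (S : set _) z]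
                             else ~` [set S : setspace d | (S : set _) z]).
  apply/seteqP; split => [S /= <- z zD|S /= H].
    by rewrite mem_trace; move: zD => /= -> /=; case: asboolP.
  apply/fsetP => z; rewrite mem_trace; case: (boolP (z \in D)) => zD /=.
    by have := H z zD; case: ifP => _ /= Sz; [exact/asboolP|exact/asboolP].
  by apply/esym/negbTE; apply: contra zD; exact: (fsubsetP VD).
apply: fin_bigcap_measurable; first exact: finite_fset.
by move=> z _; case: ifP => _; [|apply: measurableC]; exact: measurable_point.
Qed.

Definition sumset D s (om : Omega) : set (lattice d) :=
  \big[msum/[set 0]]_(i <- s) (X i om `&` [set` D]).

Definition hits D s B : set Omega := [set om | exists2 b, b \in B & sumset D s om b].

Definition law D (i : I) V : R := fine (P [set om | trace D (X i om) = V]).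

Lemma measurable_RV_trace D i V : measurable [set om | trace D (X i om) = V].
Proof. exact: (measurable_funPTI (X i) (measurable_trace D V)). Qed.

Lemma law_ge0 D i V : 0 <= law D i V.
Proof. exact: fine_ge0. Qed.

Lemma lawE D i V : ((law D i V)%:E = P [set om | trace D (X i om) = V])%E.
Proof. by rewrite fineK // fin_num_measure //; exact: measurable_RV_trace. Qed.

Lemma hits_cons D i s B om : hits D (i :: s) B om <->
  hits D s (fsetdif B (trace D (X i om))) om.
Proof.
rewrite /hits /sumset /= big_cons; split.
  move=> [b bB [x [Xx Dx] [y Hy E]]]; exists y => //; apply/fsetdifP.
  exists b, x => //; rewrite mem_trace; split; last by rewrite -E addrC addKr.
  by apply/andP; split; [exact: Dx|exact/asboolP].
move=> [y /fsetdifP[b [x bB [+ E]]] Hy]; rewrite mem_trace => /andP[xD /asboolP Xx].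
exists b => //; exists x => //; exists y => //.
by rewrite E addrC subrK.
Qed.

(** Revealing the sets one at a time turns the probability of hitting [B]
    into the recursion [hitsum]; the event [G] records what has been revealed
    about the other sets. *)
Lemma prob_hits D s B (J : {set I}) (E : I -> set (setspace d)) :
  uniq s -> (forall i, i \in s -> i \notin J) -> (forall i, measurable (E i)) ->
  let G := \bigcap_(i in [set` J]) (X i @^-1` E i) in
  measurable (hits D s B) /\
  P (G `&` hits D s B) = (P G * (hitsum D (law D) s B)%:E)%E.
Proof.
elim: s B J E => [|i s IH] B J E.
  move=> _ _ mE G; rewrite /hits /sumset /=.
  have [B0|B0] := boolP (0 \in B).
    rewrite (_ : [set om | _] = setT); first by split; rewrite // setIT mule1.
    apply/seteqP; split => // om _; exists 0 => //.
    by rewrite big_nil.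
  rewrite (_ : [set om | _] = set0); first by split; rewrite // setI0 measure0 mule0.
  rewrite -subset0 => om [b bB]; rewrite big_nil => b0.
  by move: B0; rewrite -b0 bB.
rewrite cons_uniq => /andP[iNs us] sJ mE G.
have iJ : i \notin J by apply: sJ; rewrite mem_head.
have mG : measurable G.
  apply: fin_bigcap_measurable => // j _; exact: (measurable_funPTI (X j)).
pose J' := i |: J.
pose E' V j := if j == i then [set S : setspace d | trace D S = V] else E j.
have mE' V j : measurable (E' V j) by rewrite /E'; case: ifP => // _; exact: measurable_trace.
have sJ' j : j \in s -> j \notin J'.
  move=> js; rewrite !inE negb_or sJ ?inE ?js ?orbT // andbT.
  by apply: contraNneq iNs => <-.
have GE V : \bigcap_(j in [set` J']) (X j @^-1` E' V j) =
    [set om | trace D (X i om) = V] `&` G.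
  apply/seteqP; split => [om H|om [H1 H2] j /=].
    split; first by have := H i; rewrite /= !inE eqxx /E' eqxx => /(_ isT).
    move=> j jJ; have := H j; rewrite /= !inE; move: (jJ) => /= -> /(_ (orbT _)).
    by rewrite /E'; case: eqP => // ji; move: iJ; rewrite -ji jJ.
  rewrite !inE /E'; case: eqP => [-> _|_ /= jJ]; first exact: H1.
  exact: H2.
have PGE V : P ([set om | trace D (X i om) = V] `&` G) = (P G * (law D i V)%:E)%E.
  rewrite -GE indep // big_setU1 //= muleC lawE; congr (_ * _)%E; last by rewrite /E' eqxx.
  rewrite /G indep //; apply: eq_bigr => j jJ; rewrite /E'; case: eqP => // ji.
  by move: iJ; rewrite -ji jJ.
have step V := IH (fsetdif B V) J' (E' V) us sJ' (mE' V).
have mcase (H : set Omega) : measurable H -> forall V,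
    measurable ([set om | trace D (X i om) = V] `&` (H `&` hits D s (fsetdif B V))).
  move=> mH V; apply: measurableI; first exact: measurable_RV_trace.
  by apply: measurableI => //; have [] := step V.
have hitsE H : H `&` hits D (i :: s) B =
    [set om | trace D (X i om) \in fpowerset D /\
       (H `&` hits D s (fsetdif B (trace D (X i om)))) om].
  apply/seteqP; split => [om [Hom /hits_cons h]|om [_ [Hom h]]]; last first.
    by split => //; exact/hits_cons.
  split => //; rewrite fpowersetE; apply/fsubsetP => z.
  by rewrite mem_trace => /andP[].
have uD : uniq (fpowerset D) by exact: fset_uniq.
split.
  rewrite -[hits _ _ _]setTI hitsE.
  exact: (measure_fin_cases P uD (mcase _ measurableT)).1.
rewrite hitsE (measure_fin_cases P uD (mcase _ mG)).2.
rewrite /= -sumEFin ge0_sume_distrr; last first.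
  by move=> V _; rewrite lee_fin mulr_ge0 ?law_ge0 // hitsum_ge0 // => *; exact: law_ge0.
apply: eq_bigr => V _; rewrite setIA -GE (step V).2 GE PGE EFinM muleA //.
Qed.

Lemma hits_measurable D s B : uniq s -> measurable (hits D s B).
Proof.
move=> us; have H i : i \in s -> i \notin (finset.set0 : {set I}) by rewrite inE.
by case: (@prob_hits D s B _ (fun=> setT) us H (fun=> measurableT)).
Qed.

Lemma prob_hitsE D s B : uniq s -> P (hits D s B) = ((hitsum D (law D) s B)%:E)%E.
Proof.
move=> us; have H i : i \in s -> i \notin (finset.set0 : {set I}) by rewrite inE.
have [_] := @prob_hits D s B _ (fun=> setT) us H (fun=> measurableT).
rewrite (_ : \bigcap_(i in _) _ = setT); first by rewrite setTI probability_setT mul1e.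
by apply/seteqP; split => // om _ i; rewrite /= inE.
Qed.

Definition fullsum s (om : Omega) : set (lattice d) := \big[msum/[set 0]]_(i <- s) X i om.

Lemma sumset_cons D i s om :
  sumset D (i :: s) om = msum (X i om `&` [set` D]) (sumset D s om).
Proof. by rewrite /sumset big_cons. Qed.

Lemma sumset_mono D D' s om : (D `<=` D')%fset -> sumset D s om `<=` sumset D' s om.
Proof.
move=> /fsubsetP DD; elim: s => [|i s IH]; first by rewrite /sumset !big_nil.
rewrite !sumset_cons => b [x [Xx xD] [y Hy E]].
exists x; first by split => //; exact: DD.
by exists y => //; exact: IH.
Qed.

Lemma sumset_fullsum D s om : sumset D s om `<=` fullsum s om.
Proof.
elim: s => [|i s IH]; first by rewrite /sumset /fullsum !big_nil.
rewrite sumset_cons /fullsum big_cons => b [x [Xx xD] [y Hy E]].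
by exists x => //; exists y => //; exact: IH.
Qed.

Lemma cube_mono m n : (m <= n)%N -> (@cube d m `<=` cube n)%fset.
Proof. by move=> mn; apply/fsubsetP => x; rewrite !cubeP => /leq_trans; apply. Qed.

Lemma fullsum_exhaust s om b : fullsum s om b -> exists n, sumset (cube n) s om b.
Proof.
elim: s b => [|i s IH] b.
  by rewrite /fullsum big_nil => b0; exists 0%N; rewrite /sumset big_nil.
rewrite /fullsum big_cons => -[x Xx [y /IH[n Hy] E]].
exists (maxn n (snorm x)); rewrite sumset_cons; exists x.
  by split => //; rewrite /= cubeP leq_maxr.
exists y => //; apply: sumset_mono Hy; apply: cube_mono; exact: leq_maxl.
Qed.

Lemma translateE x A z : translate x A z <-> z \in shift x A.
Proof.
rewrite mem_shift; split => [[a aA <-]|zA]; first by rewrite addrC addKr.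
by exists (z - x) => //; rewrite addrC subrK.
Qed.

Lemma hit_eventE s x A :
  [set om | fullsum s om `&` translate x A !=set0] = \bigcup_n hits (cube n) s (shift x A).
Proof.
apply/seteqP; split => [om [b [/fullsum_exhaust[n Hb] /translateE bA]]|om [n _ [b bA Hb]]].
  by exists n => //; exists b.
by exists b; split; [exact: sumset_fullsum Hb|exact/translateE].
Qed.

Lemma measurable_hit_event s x A : uniq s ->
  measurable [set om | fullsum s om `&` translate x A !=set0].
Proof.
by move=> us; rewrite hit_eventE; apply: bigcup_measurable => n _; exact: hits_measurable.
Qed.

Lemma fine_prob_le (E F : set Omega) : measurable E -> measurable F -> E `<=` F ->
  fine (P E) <= fine (P F).
Proof.
move=> mE mF EF; apply: fine_le; rewrite ?fin_num_measure //.
by apply: le_measure; rewrite ?inE.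
Qed.

Lemma hit_prob_ge s x A n : uniq s ->
  hitsum (cube n) (law (cube n)) s (shift x A) <= hit_prob P (fullsum s) x A.
Proof.
move=> us; rewrite -[leLHS]/(fine (hitsum _ _ _ _)%:E) -prob_hitsE //.
apply: fine_prob_le; [exact: hits_measurable|exact: measurable_hit_event|].
by rewrite hit_eventE => om H; exists n.
Qed.

Lemma hit_prob_le s x A (c : R) : uniq s ->
  (forall n, hitsum (cube n) (law (cube n)) s (shift x A) <= c) ->
  hit_prob P (fullsum s) x A <= c.
Proof.
move=> us H; rewrite /hit_prob hit_eventE.
have mH n : measurable (hits (cube n) s (shift x A)) by exact: hits_measurable.
have mU : measurable (\bigcup_n hits (cube n) s (shift x A)) by exact: bigcup_measurable.
have mono : {homo (fun n => hits (cube n) s (shift x A)) : m n / (m <= n)%N >-> (m <= n)%O}.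
  move=> m n mn; apply/subsetPset => om [b bA Hb]; exists b => //.
  by apply: sumset_mono Hb; exact: cube_mono.
have cv := nondecreasing_cvg_mu (mu := P) mH mU mono.
suff : (P (\bigcup_n hits (cube n) s (shift x A)) <= c%:E)%E.
  by move=> /(fine_le _ (isT : c%:E \is a fin_num)); apply; rewrite fin_num_measure.
rewrite -(cvg_lim _ cv) //; apply: lime_le; first by apply/cvg_ex; eexists; exact: cv.
by apply: nearW => n /=; rewrite prob_hitsE // lee_fin.
Qed.

Lemma hits1E D i B : hits D [:: i] B = [set om | exists2 b, b \in B & b \in D /\ X i om b].
Proof.
apply/seteqP; split => [om [b bB]|om [b bB [bD Xb]]].
  rewrite sumset_cons /sumset big_nil => -[x [Xx xD] [y ->]]; rewrite addr0 => xb.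
  by exists b => //; rewrite -xb.
exists b => //; rewrite sumset_cons /sumset big_nil; exists b => //.
by exists 0 => //; rewrite addr0.
Qed.

Lemma hit_event1 i x A : [set w | X i w `&` translate x A !=set0] = 
  hits (shift x A) [:: i] (shift x A).
Proof.
rewrite hits1E; apply/seteqP; split => [om [b [Xb /translateE bA]]|om [b bA [_ Xb]]].
  by exists b.
by exists b; split => //; apply/translateE.
Qed.

Lemma hit1_le D i x A : hit1 D (law D) i (shift x A) <= hit_prob P (X i) x A.
Proof.
rewrite -(hitsum1 D) -[leLHS]/(fine (hitsum _ _ _ _)%:E) -prob_hitsE // /hit_prob hit_event1.
apply: fine_prob_le; try exact: hits_measurable.
by rewrite !hits1E => om [b bA [bD Xb]]; exists b.
Qed.

Lemma hit1_eq D i x A : (shift x A `<=` D)%fset ->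
  hit1 D (law D) i (shift x A) = hit_prob P (X i) x A.
Proof.
move=> AD; apply/le_anti; rewrite hit1_le /=.
rewrite -(hitsum1 D) -[leRHS]/(fine (hitsum _ _ _ _)%:E) -prob_hitsE // /hit_prob hit_event1.
apply: fine_prob_le; try exact: hits_measurable.
by rewrite !hits1E => om [b bA [_ Xb]]; exists b => //; split => //; exact: (fsubsetP AD).
Qed.

Lemma hit_prob_le1 i x A : hit_prob P (X i) x A <= 1.
Proof.
rewrite /hit_prob hit_event1 -[leRHS]/(fine 1%E); apply: fine_le => //.
  by rewrite fin_num_measure //; exact: hits_measurable.
by apply: probability_le1; exact: hits_measurable.
Qed.

End SumOfSets.

(** * From local hitting estimates to the two bounds *)

Section Assembly.
Context {R : realType} {d : nat}.
Hypothesis d0 : (0 < d)%N.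
Implicit Types (A B D : {fset lattice d}) (x y u : lattice d).

Lemma diam_le B (c : R) : 0 <= c ->
  (forall x y, x \in B -> y \in B -> enorm (x - y) <= c) -> diam B <= c.
Proof.
move=> c0 H; rewrite /diam big_seq; elim/big_ind : _ => // [a b ac bc|x xB].
  by rewrite ge_max ac bc.
rewrite big_seq; elim/big_ind : _ => // [a b ac bc|y yB]; last exact: H.
by rewrite ge_max ac bc.
Qed.

(** Any point of [B] can serve as its origin. *)
Lemma recentre_at B b : b \in B -> exists2 B0, 0 \in B0 & B = shift b B0.
Proof.
move=> bB; exists (shift (- b) B); first by rewrite mem_shift sub0r opprK.
by apply/fsetP => x; rewrite !mem_shift opprK subrK.
Qed.

Lemma diam_ball B B0 b u (r : nat) : B = shift b B0 ->
  (forall z, z \in B -> (snorm (z - u) <= r)%N) -> diam B0 <= (d * (2 * r))%N%:R :> R.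
Proof.
move=> E H; apply: diam_le; first exact: ler0n.
move=> x y xB yB; apply: le_trans (enorm_le _) _; rewrite -natrM ler_nat leq_mul2l.
have hx := H (b + x); have hy := H (b + y).
have {}hx : (snorm (b + x - u) <= r)%N by apply: hx; rewrite E mem_shift addrC addKr.
have {}hy : (snorm (b + y - u) <= r)%N by apply: hy; rewrite E mem_shift addrC addKr.
have := snormB (b + x - u) (b + y - u).
have -> : b + x - u - (b + y - u) = x - y by apply/rowP => k; rewrite !mxE; ring.
move: (snorm _) (snorm _) (snorm _) hx hy => p q m; clear; lia.
Qed.

Definition local_hitting {disp : measure_display} {Omega : measurableType disp}
    (P : probability Omega R) {I : Type} (X : I -> {RV P >-> setspace d})
    (al be : I -> R) (c C : R) : Prop :=
  forall i B x, 0 \in B -> x != 0 -> 2 * diam B <= enorm x :> R ->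
  c * enorm x `^ (- be i) * Cap (al i) B <= hit_prob P (X i) x B /\
  hit_prob P (X i) x B <= C * enorm x `^ (- be i) * Cap (al i) B.

Section OneSet.
Context {disp : measure_display} {Omega : measurableType disp}.
Variable P : probability Omega R.
Context {I : finType}.
Variable X : I -> {RV P >-> setspace d}.
Hypothesis indep : mutually_independent X.
Variables al be : I -> R.
Hypothesis al0 : forall i, 0 < al i.
Hypothesis be0 : forall i, 0 < be i.
Variables c C : R.
Hypothesis c0 : 0 < c.
Hypothesis cC : c <= C.
Hypothesis hyp : local_hitting X al be c C.

Let C0 : R := Num.max 1 (C * 2 `^ d%:R).

(** The hypothesis applies to a set that is far from the origin compared with
    its size. Closer to the origin the trivial bound by one is used; there it is
    absorbed by the second term of the profile, since capacities are at least
    one. *)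
Lemma hit1_upper (de : R) (r : nat) D i u B : 0 < de -> be i + de < d%:R -> (0 < r)%N ->
  B != fset0 -> (forall b, b \in B -> (snorm (b - u) <= r)%N) ->
  hit1 D (law X D) i B <=
    C0 * profile de (be i) (((4 * d + 2) * r) ^ d)%N%:R u * Cap (al i) B.
Proof.
move=> de0 bed r0 B0 HB; have /fset0Pn[b bB] := B0.
have [B1 B10 E] := recentre_at bB.
have C00 : 0 < C0 by rewrite lt_max ltr01.
set M1 := _%:R.
have capB : 1 <= Cap (al i) B by apply: cap_ge1 => //; exact: ltW.
have [far|near] := leqP ((4 * d + 2) * r) (snorm u); last first.
  rewrite E; apply: le_trans (hit1_le indep D i b B1) _; rewrite -E.
  apply: le_trans (hit_prob_le1 indep i b B1) _.
  apply: le_trans capB _; rewrite -[leLHS]mul1r ler_wpM2r ?cap_ge0 //.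
  rewrite -[leLHS]mul1r ler_pM ?ler01 //; first by rewrite le_max lexx.
  rewrite /profile; apply: ler_wpDl; first exact: bpow_ge0.
  have a0 := bracket_gt0 u; have T0 : (0 < (4 * d + 2) * r)%N by rewrite muln_gt0 r0 addn2.
  have au : (bracket u <= (4 * d + 2) * r)%N by rewrite bracket_leP //; exact: ltnW.
  apply: (@le_trans _ _ (M1 * ((4 * d + 2) * r)%N%:R `^ (- d%:R))).
    rewrite /M1 natrX -powR_mulrn ?ler0n // powR_mulN ?ltr0n //.
  rewrite ler_wpM2l ?ler0n // /bpow.
  apply: (@le_trans _ _ (((4 * d + 2) * r)%N%:R `^ (- (be i + de)))).
    by rewrite ler_powR ?ler1n // lerN2 ltW.
  by apply: powRN_anti; rewrite ?ltr0n ?ler_nat // addr_ge0 // ltW.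
have bu := HB _ bB.
have bs : (snorm u <= snorm b + r)%N.
  have := snormB b (b - u); rewrite subKr => H; apply: leq_trans H _.
  by rewrite leq_add2l.
have dr : (0 < d * r)%N by rewrite muln_gt0 d0.
have far' : (4 * (d * r) + 2 * r <= snorm u)%N by move: far; rewrite mulnDl mulnA.
have b_gt : (4 * (d * r) <= snorm b)%N.
  by move: bs far' dr; move: (snorm _) (snorm _) (d * r)%N => p q m; clear; lia.
have bn0 : b != 0.
  by rewrite -snorm_eq0 -lt0n; move: b_gt dr; move: (snorm _) (d * r)%N => p m; clear; lia.
have dB1 : 2 * diam B1 <= enorm b :> R.
  apply: (@le_trans _ _ (2 * (d * (2 * r))%N%:R)).
    by rewrite ler_pM2l // (diam_ball E HB).
  apply: le_trans (enorm_ge b); rewrite -natrM ler_nat.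
  by apply: leq_trans b_gt; rewrite [(d * (2 * r))%N]mulnCA !mulnA.
have [_ H] := hyp i B10 bn0 dB1.
rewrite E; apply: le_trans (hit1_le indep D i b B1) _; apply: le_trans H _.
rewrite cap_translate ?(ltW (al0 i)) // ler_wpM2r ?cap_ge0 //.
apply: (@le_trans _ _ (C * 2 `^ d%:R * bpow (be i) u)).
  rewrite -mulrA ler_wpM2l //; first by rewrite (le_trans (ltW c0)).
  apply: (@le_trans _ _ ((bracket b)%:R `^ (- be i))).
    apply: powRN_anti; rewrite ?ltr0n ?bracket_gt0 ?(ltW (be0 i)) //.
    by rewrite bracketE // enorm_ge.
  apply: (@le_trans _ _ (2 `^ be i * (bracket u)%:R `^ (- be i))).
    apply: bpow_scale; rewrite ?bracket_gt0 ?(ltW (be0 i)) // [bracket b]bracketE // bracket_leP.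
      by move: bs far' r0; move: (snorm _) (snorm _) (d * r)%N => p q m; clear; lia.
    by rewrite muln_gt0 /= lt0n snorm_eq0.
  by rewrite ler_wpM2r ?powR_ge0 // ler_powR ?ler1n //; have := de0; lra.
apply: ler_pM; rewrite ?bpow_ge0 ?mulr_ge0 ?powR_ge0 ?(le_trans (ltW c0)) //.
  by rewrite le_max lexx orbT.
by rewrite lerDl mulr_ge0 ?ler0n ?bpow_ge0.
Qed.

Lemma hit1_lower (r n s : nat) i y B : B != fset0 ->
  (forall b, b \in B -> (snorm (b - y) <= r)%N) -> (forall b, b \in B -> (snorm b <= s)%N) ->
  ((4 * d + 1) * r < snorm y)%N -> (s <= n)%N ->
  c * (d * s)%N%:R `^ (- be i) * Cap (al i) B <= hit1 (cube n) (law X (cube n)) i B.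
Proof.
move=> B0 HB Hs ry sn; have /fset0Pn[b bB] := B0.
have [B1 B10 E] := recentre_at bB.
have bs : (snorm y <= snorm b + r)%N.
  have := snormB b (b - y); rewrite subKr => H; apply: leq_trans H _.
  by rewrite leq_add2l; exact: HB.
have b_gt : (4 * (d * r) < snorm b)%N.
  by move: ry bs; rewrite mulnDl mulnA; move: (snorm _) (snorm _) => p q; clear; lia.
have bn0 : b != 0.
  by rewrite -snorm_eq0 -lt0n; apply: leq_ltn_trans b_gt.
have dB1 : 2 * diam B1 <= enorm b :> R.
  apply: (@le_trans _ _ (2 * (d * (2 * r))%N%:R)).
    by rewrite ler_pM2l // (diam_ball E HB).
  apply: le_trans (enorm_ge b); rewrite -natrM ler_nat.
  by apply: leq_trans (ltnW b_gt); rewrite [(d * (2 * r))%N]mulnCA !mulnA.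
have [H _] := hyp i B10 bn0 dB1.
have sub : (shift b B1 `<=` cube n)%fset.
  by rewrite -E; apply/fsubsetP => z /Hs zs; rewrite cubeP (leq_trans zs).
rewrite E (hit1_eq indep) //; apply: le_trans H.
rewrite cap_translate ?(ltW (al0 i)) // ler_wpM2r ?cap_ge0 // ler_pM2l //.
have eb : 0 < enorm b :> R.
  by apply: lt_le_trans (enorm_ge b); rewrite ltr0n lt0n snorm_eq0.
apply: powRN_anti; rewrite ?(ltW (be0 i)) //.
by apply: le_trans (enorm_le b) _; rewrite -natrM ler_nat leq_mul2l (Hs _ bB) orbT.
Qed.

End OneSet.

End Assembly.

Lemma exists_slack {R : realType} (I : finType) (be : I -> R) (m : R) :
  (forall i, be i < m) -> exists2 de : R, 0 < de & forall i, be i + de < m.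
Proof.
move=> H; suff [de de0 Hde] : exists2 de : R, 0 < de & forall i, i \in enum I -> be i + de < m.
  by exists de => // i; apply: Hde; rewrite mem_enum.
elim: (enum I) => [|i s [de de0 IH]]; first by exists 1.
have hi := H i; exists (Num.min de ((m - be i) / 2)).
  by rewrite lt_min de0 divr_gt0 // subr_gt0.
move=> j; rewrite inE => /orP[/eqP ->|/IH Hj].
  have : Num.min de ((m - be i) / 2) <= (m - be i) / 2 by rewrite ge_min lexx orbT.
  by move: (Num.min _ _) => z; lra.
have : Num.min de ((m - be i) / 2) <= de by rewrite ge_min lexx.
by move: (Num.min _ _) => z; lra.
Qed.

Lemma prod_powR {R : realType} (I : Type) (s : seq I) (a : R) (f : I -> R) : 0 < a ->
  \prod_(i <- s) a `^ (f i) = a `^ (\sum_(i <- s) f i).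
Proof.
move=> a0; elim: s => [|i s IH]; first by rewrite !big_nil powRr0.
by rewrite !big_cons IH powRD //; apply/implyP => _; rewrite gt_eqF.
Qed.

Section Centres.
Context {d k : nat}.
Implicit Types (x : lattice d).

(** Points adding up to [x], all at distance of the order of [x] from the
    origin: the choice [2 x] leaves a non-zero remainder for the last one. *)
Definition centre x (i0 i : 'I_k) : lattice d :=
  if i == i0 then x - x *+ (2 * k.-1) else x *+ 2.

Lemma sum_centre x (i0 : 'I_k) : \sum_(i < k) centre x i0 i = x.
Proof.
rewrite (bigD1 i0) //= {1}/centre eqxx.
rewrite (eq_bigr (fun=> x *+ 2)) => [|i /negbTE H]; last by rewrite /centre H.
rewrite sumr_const -mulrnA.
have -> : #|[pred i : 'I_k | i != i0]| = k.-1.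
  by have := cardC1 i0; rewrite card_ord => <-; apply: eq_card.
by rewrite subrK.
Qed.

Lemma snorm_centre x (i0 i : 'I_k) :
  (snorm x <= snorm (centre x i0 i))%N /\ (snorm (centre x i0 i) <= 2 * k * snorm x)%N.
Proof.
have k0 : (0 < k)%N by case: (i0) => m /=; case: (k).
rewrite /centre; case: ifP => _; last first.
  by rewrite snorm_mulrn; move: (snorm x) => p; nia.
have [->|k1] := eqVneq k 1%N.
  by rewrite /= muln0 mulr0n subr0; move: (snorm x) => p; lia.
have -> : x - x *+ (2 * k.-1) = - (x *+ (2 * k.-1).-1).
  have -> : (2 * k.-1 = ((2 * k.-1).-1).+1)%N by lia.
  by rewrite mulrS /= opprD addrA subrr sub0r.
by rewrite snormN snorm_mulrn; move: (snorm x) => p; nia.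
Qed.

End Centres.

(** * The two bounds *)

Section Final.
Context {R : realType} {d k : nat}.
Hypothesis d0 : (0 < d)%N.
Hypothesis k0 : (0 < k)%N.
Variables al be : 'I_k -> R.
Hypothesis al0 : forall i, 0 < al i.
Hypothesis ald : forall i, al i < d%:R.
Hypothesis be0 : forall i, 0 < be i.
Hypothesis bed : forall i, be i < d%:R.
Implicit Types (A B : {fset lattice d}) (x y u : lattice d).

Let s := index_enum 'I_k.
Let gam : R := excess d al s.
Let bet : R := excess d be s.
Hypothesis gam0 : 0 < gam.
Hypothesis bet0 : 0 < bet.

Let us : uniq s. Proof. exact: index_enum_uniq. Qed.
Let size_s : size s = k.
Proof. by rewrite /s -(card_uniqP us) -[RHS](card_ord k); apply: eq_card => i; rewrite mem_index_enum. Qed.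
Let s_gt0 : (0 < size s)%N. Proof. by rewrite size_s. Qed.

Definition radius A : nat := (\max_(a <- A) snorm a)%N.

Lemma radiusP A a : a \in A -> (snorm a <= radius A)%N.
Proof. by move=> aA; apply: leq_bigmax_seq. Qed.

Lemma bpow_le_enorm b x : x != 0 -> 0 <= b -> bpow b x <= d%:R `^ b * enorm x `^ (- b) :> R.
Proof.
move=> xn b0; apply: le_trans (bpow_le_kern _ d0 b0) _; rewrite ler_wpM2l ?powR_ge0 //.
have e1 : 1 <= enorm x :> R.
  by apply: le_trans (enorm_ge x); rewrite ler1n lt0n snorm_eq0.
by rewrite /kern; move: e1; case: leP.
Qed.

(** For [|x|] large depending on [A], the first term of the profile dominates. *)
Lemma upper_bound : exists rho : {fset lattice d} -> R, forall c C : R, 0 < c -> c <= C ->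
  exists2 K : R, 0 < K & forall (disp : measure_display) (Omega : measurableType disp)
    (P : probability Omega R) (X : 'I_k -> {RV P >-> setspace d}),
  mutually_independent X -> local_hitting X al be c C -> forall A x, x != 0 -> rho A <= (snorm x)%:R ->
  hit_prob P (fullsum X s) x A <= K * (enorm x `^ (- bet) * Cap gam A).
Proof.
have [de de0 Hde] := exists_slack bed.
have [C1 C10 H1] := hitsum_le d0 al0 ald de0 be0 Hde k.+1 s_gt0 gam0 bet0.
pose M1 A : R := (((4 * d + 2) * (k.+1 * 2 ^ radius A)) ^ d)%N%:R.
have [Mf HMf] := choice (fun A => (exists2P _ _).1 (H1 (M1 A) (ler0n _ _))).
exists (fun A => Mf A `^ de^-1) => c C c0 cC.
pose C0 : R := Num.max 1 (C * 2 `^ d%:R).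
have C00 : 0 < C0 by rewrite lt_max ltr01.
exists (C1 * C0 ^+ k * (2 * d%:R `^ bet)).
  by rewrite !mulr_gt0 ?exprn_gt0 ?powR_gt0 ?ltr0n.
move=> disp Omega P X indep hyp A x xn rhoA.
apply: hit_prob_le => // n; have [Mf0 {}HMf] := HMf A.
have law0 := @law_ge0 _ _ R d P _ X (cube n).
apply: le_trans (HMf (radius A) C0 (cube n) (law X (cube n)) C00 law0 _ A 1%N x _ _) _.
- move=> i u B B0 HB; apply: (hit1_upper d0 indep al0 be0 c0 cC hyp) => //.
  by rewrite muln_gt0 expn_gt0.
- by move=> a /radiusP aA; rewrite mul1n (leq_trans aA) // ltnW // ltn_expl.
- by rewrite size_s add1n.
rewrite size_s -/bet -/gam -!mulrA !ler_wpM2l ?exprn_ge0 ?(ltW C10) ?(ltW C00) //.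
rewrite !mulrA ler_wpM2r ?cap_ge0 //.
apply: (@le_trans _ _ (2 * bpow bet x)); last first.
  by rewrite -mulrA ler_wpM2l // bpow_le_enorm // ltW.
rewrite /profile mulr_natl mulr2n lerD2l.
have sx : 0 < (bracket x)%:R :> R by rewrite ltr0n bracket_gt0.
have -> : bpow (bet + de) x = bpow bet x * (bracket x)%:R `^ (- de).
  by rewrite /bpow opprD powRD //; apply/implyP => _; rewrite gt_eqF.
rewrite mulrCA -[leRHS]mulr1 ler_wpM2l ?bpow_ge0 //.
rewrite -[leRHS](@powR_mulN _ (bracket x)%:R de) // ler_wpM2r ?powR_ge0 //.
have -> : Mf A = (Mf A `^ de^-1) `^ de by rewrite -powRrM mulVf ?powRr1 ?gt_eqF.
by apply: ge0_ler_powR; rewrite ?nnegrE ?powR_ge0 ?(ltW de0) ?ler0n // bracketE.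
Qed.

(** The balls are centred at the points [centre x i0 i], at distance of the order
    of [|x|] from the origin. *)
Lemma lower_bound : exists rho : {fset lattice d} -> R, forall c C : R, 0 < c -> c <= C ->
  exists2 K : R, 0 < K & forall (disp : measure_display) (Omega : measurableType disp)
    (P : probability Omega R) (X : 'I_k -> {RV P >-> setspace d}),
  mutually_independent X -> local_hitting X al be c C -> forall A x, x != 0 -> rho A <= (snorm x)%:R ->
  K * (enorm x `^ (- bet) * Cap gam A) <= hit_prob P (fullsum X s) x A.
Proof.
have [C1 C10 H1] := hitsum_ge d0 al0 ald s_gt0 gam0.
exists (fun A => (16 * d * (2 * (radius A).+1))%N%:R) => c C c0 cC.
pose La : R := (d * (2 * k + 1))%N%:R.
have La0 : 0 < La by rewrite ltr0n muln_gt0 d0 addn1.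
pose sb := \sum_(i < k) be i.
pose W : R := (32 * d)%N%:R ^+ (d * k.-1).
have W0 : 0 < W by rewrite exprn_gt0 // ltr0n muln_gt0.
exists (c ^+ k * La `^ (- sb) / W / C1).
  by rewrite !divr_gt0 // mulr_gt0 ?exprn_gt0 ?powR_gt0.
move=> disp Omega P X indep hyp A x xn rhoA.
set sx := snorm x in rhoA.
have sx0 : (0 < sx)%N by rewrite lt0n snorm_eq0.
have {}rhoA : (16 * d * (2 * (radius A).+1) <= sx)%N by rewrite -(ler_nat R).
(* The radius [2 ^ N] is the largest power of two below [|x| / (16 d)]: small
   enough for the hypothesis to apply around every centre, and still of the
   order of [|x|]. *)
pose q := (sx %/ (16 * d))%N; pose N := trunc_log 2 q.
have d16 : (0 < 16 * d)%N by rewrite muln_gt0.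
have qr : (2 * (radius A).+1 <= q)%N by rewrite leq_divRL // mulnC.
have q0 : (0 < q)%N by apply: leq_trans qr; rewrite muln_gt0.
have /andP[Nq qN] := trunc_log_bounds (isT : (1 < 2)%N) q0.
rewrite -/N in Nq qN.
have NA : (radius A <= 2 ^ N)%N.
  by move: qr qN; rewrite expnS; move: (radius A) (2 ^ N)%N => a b; clear; lia.
have Nsx : (16 * d * 2 ^ N <= sx)%N.
  by apply: leq_trans (leq_divM sx (16 * d)); rewrite mulnC leq_mul2r Nq orbT.
have sxN : (sx <= 32 * d * 2 ^ N)%N.
  have := ltn_ceil sx d16; rewrite -/q => /ltnW H; apply: leq_trans H _.
  have -> : (32 * d * 2 ^ N = 2 ^ N.+1 * (16 * d))%N.
    by rewrite expnS -[32%N]/(2 * 16)%N -[LHS]mulnA -[LHS]mulnA [LHS]mulnA -mulnA mulnCA; clear; nia.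
  by rewrite leq_mul2r qN orbT.
pose n := ((2 * k + 1) * sx)%N.
pose i0 : 'I_k := Ordinal k0.
apply: le_trans (hit_prob_ge indep x A n us).
have law0 := @law_ge0 _ _ R d P _ X (cube n).
pose p i : R := c * (La * sx%:R) `^ (- be i).
have p0 i : 0 <= p i by rewrite mulr_ge0 ?powR_ge0 // ltW.
have := H1 N (cube n) (law X (cube n)) (centre x i0) p law0 p0 _ (shift x A) _.
rewrite cap_translate ?(ltW gam0) // size_s -/gam => H2.
have {H2} : \prod_(i < k) p i * (2 ^ N)%N%:R ^+ (d * k.-1) * Cap gam A
    <= C1 * hitsum (cube n) (law X (cube n)) s (shift x A).
  apply: H2 => [i B B0 HB|a].
    have [h1 h2] := snorm_centre x i0 i.
    have -> : p i = c * (d * n)%N%:R `^ (- be i).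
      by rewrite /p /La /n -natrM mulnA.
    have t1 : (2 ^ N <= d * 2 ^ N)%N by rewrite leq_pmull.
    have t0 : (0 < 2 ^ N)%N by rewrite expn_gt0.
    have Hs b : b \in B -> (snorm b <= n)%N.
      move=> bB; have := HB b bB; have := snormD (b - centre x i0 i) (centre x i0 i).
      rewrite subrK /n mulnDl mul1n expnS; move: h2 Nsx t1; rewrite -/sx -mulnA.
      move: (snorm _) (snorm _) (snorm _) (d * 2 ^ N)%N (2 ^ N)%N (2 * k * sx)%N.
      by clear => u v w t z K; lia.
    have Hr : ((4 * d + 1) * 2 ^ N.+1 < snorm (centre x i0 i))%N.
      apply: leq_trans h1; rewrite -/sx; apply: leq_trans Nsx.
      rewrite expnS mulnDl mul1n -!mulnA [(d * (2 * _))%N]mulnCA.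
      by move: (d * 2 ^ N)%N (2 ^ N)%N t0 t1; clear => t z; lia.
    exact (hit1_lower indep al0 be0 c0 hyp i B0 HB Hs Hr (leqnn n)).
  rewrite mem_shift sum_centre => /radiusP aA; exact: leq_trans aA NA.
rewrite big_split /= prodr_const card_ord prod_powR; last first.
  by rewrite mulr_gt0 // ltr0n.
rewrite sumrN -/sb => H2.
rewrite -(ler_pM2l C10); apply: le_trans H2.
have capA := cap_ge0 gam A.
have -> : C1 * (c ^+ k * La `^ (- sb) / W / C1 * (enorm x `^ (- bet) * Cap gam A)) =
    c ^+ k * (La `^ (- sb) * (enorm x `^ (- bet) / W)) * Cap gam A.
  by field; rewrite !gt_eqF.
rewrite ler_wpM2r // -mulrA ler_wpM2l ?exprn_ge0 ?(ltW c0) //.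
rewrite powRM ?(ltW La0) ?ler0n // -mulrA ler_wpM2l ?powR_ge0 //.
rewrite ler_pdivrMr //.
have sxR : 0 < sx%:R :> R by rewrite ltr0n.
apply: (@le_trans _ _ (sx%:R `^ (- bet))).
  by apply: powRN_anti; rewrite ?(ltW bet0) // enorm_ge.
have -> : - bet = - sb + (d * k.-1)%N%:R :> R.
  rewrite /bet /excess size_s -/sb natrM -subn1 natrB //; ring.
rewrite powRD; last by apply/implyP => _; rewrite gt_eqF.
rewrite -mulrA ler_wpM2l ?powR_ge0 // powR_mulrn ?ler0n // /W -exprMn.
by rewrite lerXn2r ?nnegrE ?mulr_ge0 ?ler0n // -natrM ler_nat mulnC.
Qed.

End Final.

Theorem theorem1p1 (R : realType) (d k : nat) (alpha beta : 'I_k -> R) :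
  (1 <= d)%N -> (1 <= k)%N ->
  (forall i, 0 < alpha i < d%:R) ->
  (forall i, 0 < beta i < d%:R) ->
  (k%:R - 1) * d%:R < \sum_(i < k) alpha i ->
  (k%:R - 1) * d%:R < \sum_(i < k) beta i ->
  exists rho : {fset lattice d} -> R,
  forall c C : R, 0 < c -> c <= C ->
  exists c' C' : R, [/\ 0 < c', c' <= C' &
    forall (disp : measure_display) (Omega : measurableType disp)
      (P : probability Omega R) (X : 'I_k -> {RV P >-> setspace d}),
    mutually_independent X ->
    (forall (i : 'I_k) (B : {fset lattice d}) (x : lattice d),
      0 \in B -> x != 0 -> 2 * diam B <= enorm x :> R ->
      c * enorm x `^ (- beta i) * Cap (alpha i) B <= hit_prob P (X i) x B /\
      hit_prob P (X i) x B <= C * enorm x `^ (- beta i) * Cap (alpha i) B) ->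
    forall (A : {fset lattice d}) (x : lattice d),
      0 \in A -> rho A <= enorm x ->
      let ratio :=
        hit_prob P (fun w => \big[msum/[set 0]]_(i < k) X i w) x A /
        (enorm x `^ ((k%:R - 1) * d%:R - \sum_(i < k) beta i) *
         Cap (\sum_(i < k) alpha i - (k%:R - 1) * d%:R) A) in
      c' <= ratio /\ ratio <= C'].
Proof.
move=> d0 k0 Ha Hb Sa Sb.
have al0 i : 0 < alpha i by case/andP: (Ha i).
have ald i : alpha i < d%:R by case/andP: (Ha i).
have be0 i : 0 < beta i by case/andP: (Hb i).
have bed i : beta i < d%:R by case/andP: (Hb i).
have size_k : size (index_enum 'I_k) = k.
  rewrite -(card_uniqP (index_enum_uniq _)) -[RHS](card_ord k).
  by apply: eq_card => i; rewrite mem_index_enum.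
have gE : excess d alpha (index_enum 'I_k) = \sum_(i < k) alpha i - (k%:R - 1) * d%:R.
  by rewrite /excess size_k.
have bE : - excess d beta (index_enum 'I_k) = (k%:R - 1) * d%:R - \sum_(i < k) beta i.
  by rewrite /excess size_k opprB.
have g0 : 0 < excess d alpha (index_enum 'I_k) by rewrite gE subr_gt0.
have b0 : 0 < excess d beta (index_enum 'I_k) by rewrite -oppr_lt0 bE subr_lt0.
have [rU HU] := upper_bound d0 k0 al0 ald be0 bed g0 b0.
have [rL HL] := lower_bound d0 k0 al0 ald be0 g0 b0.
exists (fun A => d%:R * (1 + `|rU A| + `|rL A|)) => c C c0 cC.
have [KU KU0 {}HU] := HU c C c0 cC; have [KL KL0 {}HL] := HL c C c0 cC.
exists KL, (Num.max KL KU); split=> //; first by rewrite le_max lexx.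
move=> disp Omega P X indep hyp A x A0 rhoA; cbv zeta.
have dR : 0 < d%:R :> R by rewrite ltr0n.
have sx : 1 + `|rU A| + `|rL A| <= (snorm x)%:R.
  by rewrite -(ler_pM2l dR); apply: le_trans rhoA _; exact: enorm_le.
have nU := normr_ge0 (rU A); have nL := normr_ge0 (rL A).
have sx1 : 1 <= (snorm x)%:R :> R by apply: le_trans sx; rewrite -addrA lerDl addr_ge0.
have xn : x != 0 by rewrite -snorm_eq0 -lt0n -(ltr_nat R) (lt_le_trans ltr01).
have ex : 0 < enorm x :> R by apply: lt_le_trans (enorm_ge x); apply: lt_le_trans sx1.
rewrite -bE -gE; set G := Cap _ A.
have G0 : 0 < G.
  apply: lt_le_trans ltr01 (cap_ge1 (ltW g0) _).
  by apply/fset0Pn; exists 0.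
have D0 : 0 < enorm x `^ (- excess d beta (index_enum 'I_k)) * G by rewrite mulr_gt0 ?powR_gt0.
rewrite ler_pdivlMr // ler_pdivrMr //; split.
  apply: (HL disp Omega P X indep hyp A x xn); apply: le_trans sx.
  by apply: le_trans (ler_norm _) _; rewrite lerDr addr_ge0.
apply: (@le_trans _ _ (KU * (enorm x `^ (- excess d beta (index_enum 'I_k)) * G))).
  apply: (HU disp Omega P X indep hyp A x xn); apply: le_trans sx.
  by apply: le_trans (ler_norm _) _; rewrite addrAC lerDr addr_ge0.
by rewrite ler_wpM2r ?(ltW D0) // le_max lexx orbT.
Qed.
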